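(* Let $F:\mathbb{R}^3\to\mathbb{R}^3$ be a polynomial mapping which is a local diffeomorphism. Then the set $S_F$ of non-properness of $F$ is not a line, i.e., $S_F$ is not a closed subset of $\mathbb{R}^3$ homeomorphic to $\mathbb{R}$.
   Context: For a mapping $F:\mathbb{R}^n\to\mathbb{R}^n$, the set of non-properness is $S_F=\{y\in\mathbb{R}^n : \text{there exists an unbounded sequence } (x_k) \text{ in } \mathbb{R}^n \text{ with } F(x_k)\to y\}$. A subset of $\mathbb{R}^3$ is called a line if it is closed and homeomorphic to $\mathbb{R}$. *)

(* Defs.v *)
From HB Require Import structures.
From mathcomp Require Import all_boot all_order all_algebra.
From mathcomp Require Import all_classical all_reals all_analysis.
Set Implicit Arguments. Unset Strict Implicit. Unset Printing Implicit Defensive.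
Import Order.TTheory GRing.Theory Num.Theory.
Import numFieldNormedType.Exports.
Local Open Scope classical_set_scope.
Local Open Scope ring_scope.

Definition poly_fun3 (R : realType) (f : 'rV[R]_3 -> R) : Prop :=
  exists s : seq (R * (nat * nat * nat)),
    forall x : 'rV[R]_3,
      f x = \sum_(m <- s) m.1 * (x ord0 (0 : 'I_3) ^+ m.2.1.1
                                 * x ord0 (1 : 'I_3) ^+ m.2.1.2
                                 * x ord0 (2 : 'I_3) ^+ m.2.2).

Definition polynomial_map3 (R : realType) (F : 'rV[R]_3 -> 'rV[R]_3) : Prop :=
  forall i : 'I_3, poly_fun3 (fun x => F x ord0 i).

Definition local_diffeo (R : realType) (F : 'rV[R]_3 -> 'rV[R]_3) : Prop :=
  forall x : 'rV[R]_3, exists (U V : set 'rV[R]_3) (G : 'rV[R]_3 -> 'rV[R]_3),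
    [/\ open U, U x, open V & F @` U = V] /\
    [/\ (forall u, U u -> G (F u) = u),
        (forall v, V v -> U (G v) /\ F (G v) = v),
        (forall u, U u -> differentiable F u) &
        (forall v, V v -> differentiable G v)].

Definition nonproper_set (R : realType) (F : 'rV[R]_3 -> 'rV[R]_3)
  : set 'rV[R]_3 :=
  [set y | exists x : nat -> 'rV[R]_3,
     (forall M : R, exists k, M < `|x k|) /\ (F \o x) @ \oo --> y].

Definition is_line (R : realType) (S : set 'rV[R]_3) : Prop :=
  closed S /\
  exists (f : R -> 'rV[R]_3) (g : 'rV[R]_3 -> R),
    [/\ continuous f, f @` setT = S,
        (forall t, g (f t) = t) &
        {within S, continuous g}].

(* Main.v *)
(* Write L for the set of non-properness, assumed to be a line f : R -> L.  Rescaling restrictions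
   of F to lines far away, one finds through each point of L a nonconstant polynomial curve of
   bounded degree inside L; it covers a half line of L.  Hence |f - a|^2 has finitely many local
   extrema for every a, and L crosses every small sphere about one of its points, and every large
   sphere, in exactly two points.

   Off L the map F is a covering, and a sheet of F over a neighbourhood in a spherical shell of a
   strand of L extends to the whole shell minus L, cyclically around the two strands.  If F^-1(L)
   is nonempty, some sheet is single valued near L; comparing shells around points of L and around
   infinity shows that every sheet near L is, so that F has a section over the complement of L,
   which contradicts non-properness along L.  If F^-1(L) is empty, a loop around L lifts to a loop
   after n turns, and the lifted loop is contractible in the domain.  Two tangent fields on the
   spheres, obtained by transporting fields perpendicular to x - f t from t = +oo and t = -oo,
   have relative winding number 2n <> 0 along the loop: a contradiction. *)

Require Import Defs.
From HB Require Import structures.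
From mathcomp Require Import all_boot all_order all_algebra.
From mathcomp Require Import all_classical all_reals all_analysis.
From mathcomp Require Import ring lra.
From mathcomp Require polyorder polyrcf.
Set Implicit Arguments. Unset Strict Implicit. Unset Printing Implicit Defensive.
Import Order.TTheory GRing.Theory Num.Theory.
Import numFieldNormedType.Exports.
Local Open Scope classical_set_scope.
Local Open Scope ring_scope.

(** * Connectedness and uniqueness of lifts *)

Section Connectedness.
Variables T : topologicalType.
Implicit Types A U W : set T.

(** The line [L] is only a topological line, so it might be knotted at every scale and have no
    tubular neighbourhood. The polynomial curves exclude this: bounded degree turns extrema of the
    distance to [a], and points of [L] in an axis direction from [a], into roots of nonzero
    polynomials. Spherical shells then replace tubes. A sphere minus two points is an annulus, so
    the only monodromy in a shell is a rotation about a strand, and it is trivial as soon as one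
    sheet is single valued near one point of the strand. If [L] meets the image, triviality spreads
    for a global reason: far out in the domain all points lie over a neighbourhood of [L] and of
    infinity, and the exterior of a ball is connected. If [L] misses the image, the number 2 in [2n]
    is the Euler number of the sphere, read off from two stereographic fields, one for each pole.
    Covering theory is reduced to lifting over convex domains, with angles unrolled by logarithmic
    polar coordinates. *)

Lemma connected_open_split A U W : connected A -> open U -> open W ->
  (forall x, A x -> U x \/ W x) -> (forall x, A x -> U x -> W x -> False) ->
  (exists2 x, A x & U x) -> forall x, A x -> U x.
Proof.
move=> cA oU oW AUW AUWn [x0 Ax0 Ux0].
have E : A `&` U = A.
  apply: cA; first by exists x0.
    by exists U.
  exists (~` W); first exact: open_closedC.
  apply/seteqP; split => x [Ax Ux]; split => //.
    by move=> Wx; exact: (AUWn x).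
  by case: (AUW x Ax).
by move=> x; rewrite -{1}E => -[].
Qed.

Lemma open_split_connected A :
  (forall U W, open U -> open W -> (forall x, A x -> U x \/ W x) ->
    (forall x, A x -> U x -> W x -> False) ->
    (exists2 x, A x & U x) -> forall x, A x -> U x) -> connected A.
Proof.
move=> H B [x0 Bx0] [U oU BU] [C cC BC].
apply/seteqP; split => [x|x Ax]; first by rewrite BU => -[].
have : U x; last by move=> Ux; rewrite BU.
apply: (H U (~` C)) => //; first exact: closed_openC.
- move=> y Ay; case: (pselect (C y)) => Cy; last by right.
  by left; have : B y by [rewrite BC]; rewrite BU => -[].
- move=> y Ay Uy; apply; have : B y by rewrite BU.
  by rewrite BC => -[].
- by exists x0; move: Bx0; rewrite BU => -[].
Qed.

End Connectedness.

Section Convexity.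
Variables (R : realType) (V : normedModType R).

Definition is_convex (C : set V) :=
  forall x y t, C x -> C y -> 0 <= t -> t <= 1 -> C (x + t *: (y - x)).

Lemma ball_is_convex (c : V) r : is_convex (ball c r).
Proof.
move=> x y t; rewrite -!ball_normE /ball_ /= => cx cy t0 t1.
have -> : c - (x + t *: (y - x)) = (1 - t) *: (c - x) + t *: (c - y).
  rewrite scalerBl scale1r -addrA (addrC (- _)) -scalerBr opprB [c - y]addrC.
  by rewrite addrACA subrr addr0 opprD addrA -scalerN opprB (addrC (- y)).
apply: (le_lt_trans (ler_normD _ _)); rewrite !normrZ (ger0_norm t0) ger0_norm; last lra.
have [->|t0'] := eqVneq t 0; first by rewrite mul0r addr0 subr0 mul1r.
have tp : 0 < t by rewrite lt_def t0'.
have h1 : t * `|c - y| < t * r by rewrite ltr_pM2l.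
have h2 : (1 - t) * `|c - x| <= (1 - t) * r by rewrite ler_wpM2l// ?subr_ge0 // ltW.
lra.
Qed.

Lemma is_convexI (C D : set V) : is_convex C -> is_convex D -> is_convex (C `&` D).
Proof. by move=> cC cD x y t [? ?] [? ?] t0 t1; split; [exact: cC|exact: cD]. Qed.

Lemma segment_continuous (x y : V) : continuous (fun t : R => x + t *: (y - x)).
Proof.
move=> t; apply: cvgD; first exact: cvg_cst.
by apply: cvgZ; [exact: cvg_id|exact: cvg_cst].
Qed.

Lemma is_convex_connected (C : set V) : is_convex C -> connected C.
Proof.
move=> cC; apply: open_split_connected => U W oU oW CUW CUWn [x Cx Ux] y Cy.
pose f t := x + t *: (y - x).
have f0 : f 0 = x by rewrite /f scale0r addr0.
have f1 : f 1 = y by rewrite /f scale1r addrC subrK.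
rewrite -f1; have cf := @segment_continuous x y.
have H := @connected_open_split R `[0, 1]%classic (f @^-1` U) (f @^-1` W).
apply: (H _ _ _ _ _ _ 1).
- exact: segment_connected.
- by apply: open_comp => // t _; exact: cf.
- by apply: open_comp => // t _; exact: cf.
- move=> t /=; rewrite in_itv /= => /andP[t0 t1]; apply: CUW; exact: cC.
- move=> t /=; rewrite in_itv /= => /andP[t0 t1]; apply: CUWn; exact: cC.
- by exists 0; rewrite /= ?f0// in_itv /= lexx ler01.
- by rewrite /= in_itv /= lexx ler01.
Qed.

End Convexity.

Section Lifts.
Variables (T E : topologicalType) (B : Type) (F : E -> B).
Hypothesis hE : hausdorff_space E.
Hypothesis injF : forall x : E, exists2 U : set E, nbhs x U & {in U &, injective F}.

Lemma lift_agree_near (s s' : T -> E) z : {for z, continuous s} ->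
  {for z, continuous s'} -> (\forall w \near z, F (s w) = F (s' w)) ->
  s z = s' z -> \forall w \near z, s w = s' w.
Proof.
move=> cs cs' FF ssz; have [U nU iU] := injF (s z).
have h1 : \forall w \near z, U (s w) by exact: cs.
have h2 : \forall w \near z, U (s' w) by apply: cs'; rewrite -ssz.
apply: filter_app FF; apply: filter_app h1; apply: filter_app h2.
by apply: nearW => w h2 h1 ?; apply: iU; rewrite ?inE.
Qed.

(** Local injectivity of [F] makes the coincidence set open; the Hausdorff property of [E] makes its
    complement open. *)
Lemma lift_unique (s s' : T -> E) A z0 : connected A ->
  (forall z, A z -> {for z, continuous s}) ->
  (forall z, A z -> {for z, continuous s'}) ->
  (forall z, A z -> \forall w \near z, F (s w) = F (s' w)) ->
  A z0 -> s z0 = s' z0 -> forall z, A z -> s z = s' z.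
Proof.
move=> cA cs cs' FF Az0 s0 z Az.
suff : (interior [set w | s w = s' w]) z by move/interior_subset.
apply: (@connected_open_split _ A _ (interior [set w | s w <> s' w])) Az => //.
- exact: open_interior.
- exact: open_interior.
- move=> w Aw; have [e|ne] := pselect (s w = s' w); [left|right].
    by apply: lift_agree_near => //; [exact: cs|exact: cs'|exact: FF].
  move: hE; rewrite open_hausdorff => /(_ (s w) (s' w)).
  have neb : s w != s' w by apply/eqP.
  move=> /(_ neb) [[P Q] /= [/set_mem Pw /set_mem Qw] [oP oQ /eqP PQ]].
  have h1 : \forall v \near w, P (s v) by apply: (cs _ Aw); exact: open_nbhs_nbhs.
  have h2 : \forall v \near w, Q (s' v) by apply: (cs' _ Aw); exact: open_nbhs_nbhs.
  rewrite /interior /=; near=> v => /= sv.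
  have : (P `&` Q) (s v).
    split; first by near: v.
    by rewrite sv; near: v.
  by rewrite PQ.
- by move=> w _ /interior_subset e /interior_subset; apply.
- exists z0 => //; apply: lift_agree_near => //; [exact: cs|exact: cs'|exact: FF].
Unshelve. all: by end_near.
Qed.

End Lifts.

(** * Lifting over growing balls *)

Section Growth.
Variables (R : realType) (n : nat) (E : topologicalType) (Y : Type) (F : E -> Y).
Local Notation V := 'rV[R]_n.
Hypothesis hE : hausdorff_space E.
Hypothesis injF : forall x : E, exists2 U : set E, nbhs x U & {in U &, injective F}.
Variables (D : set V) (h : V -> Y).
Hypothesis clD : closed D.
Hypothesis cD : forall C : set V, open C -> is_convex C -> connected (C `\` D).
Hypothesis eD : forall C : set V, open C -> C !=set0 -> C `\` D !=set0.

(** The set [D] is cut out of the domain so that one theory serves twice: [D] is the line and [h]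
    the identity for sections of [F]; [D] is empty for lifts of a map [h]. *)
Definition lift_on (A : set V) (s : V -> E) :=
  forall w, A w -> ~ D w -> {for w, continuous s} /\ F (s w) = h w.

(** One radius serves every [x] over the ball, as for a covering. The centre [y] may belong to [D]:
    there the hypothesis says that sheets have no monodromy around [D]. *)
Hypothesis loc : forall y : V, exists2 d : R, 0 < d & forall (z : V) x, ball y d z -> ~ D z ->
  F x = h z -> exists2 s, lift_on (ball y d) s & s z = x.

Lemma lift_on_agree (C : set V) s s' z : open C -> is_convex C -> lift_on C s -> lift_on C s' ->
  C z -> ~ D z -> s z = s' z -> forall w, C w -> ~ D w -> s w = s' w.
Proof.
move=> oC vC ls ls' Cz Dz sz w Cw Dw.
have oCD : open (C `\` D) by apply: openI => //; exact: closed_openC.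
apply: (lift_unique hE injF (cD oC vC)) sz _ _ => //.
- by move=> v [Cv Dv]; have [] := ls v Cv Dv.
- by move=> v [Cv Dv]; have [] := ls' v Cv Dv.
- move=> v Cv; have : \forall u \near v, (C `\` D) u by exact: open_nbhs_nbhs.
  apply: filterS => u [Cu Du].
  by have [_ ->] := ls u Cu Du; have [_ ->] := ls' u Cu Du.
Qed.

Lemma open_meets_ball (O : set V) c (r : R) w : open O -> O w -> 0 < r -> `|c - w| <= r ->
  exists2 v, O v & ball c r v.
Proof.
move=> oO Ow r0 cw.
have : \forall t \near (0 : R), O (w + t *: (c - w)).
  apply: (@segment_continuous _ _ w c 0 O); rewrite scale0r addr0.
  exact: open_nbhs_nbhs.
move=> /nbhs_ballP[e /= e0 eO].
pose t := Num.min (e / 2) 1.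
have t0 : 0 < t by rewrite lt_min ltr01 andbT divr_gt0.
exists (w + t *: (c - w)).
  apply: eO; rewrite -ball_normE /ball_ /= sub0r normrN gtr0_norm //.
  by rewrite gt_min; apply/orP; left; rewrite ltr_pdivrMr// ltr_pMr// ltr1n.
rewrite -ball_normE /ball_ /=.
have -> : c - (w + t *: (c - w)) = (1 - t) *: (c - w).
  by rewrite scalerBl scale1r opprD addrA.
have t1 : t <= 1 by rewrite ge_min lexx orbT.
rewrite normrZ ger0_norm ?subr_ge0//.
have : (1 - t) * `|c - w| <= (1 - t) * r by rewrite ler_wpM2l// subr_ge0.
have : 0 < t * r by rewrite mulr_gt0.
lra.
Qed.

Lemma closed_norm_ball (c : V) r : closed [set w | `|c - w| <= r].
Proof.
rewrite (_ : mkset _ = (fun w => `|c - w|) @^-1` [set x | x <= r])//.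
apply: closed_comp; last exact: closed_le.
move=> w _; apply: (@cvg_norm _ _ _ (nbhs w)).
by apply: cvgB; [exact: cvg_cst|exact: cvg_id].
Qed.

Lemma compact_norm_ball (c : V) r : compact [set w | `|c - w| <= r].
Proof.
apply: bounded_closed_compact; last exact: closed_norm_ball.
exists (`|c| + r); split; first exact: num_real.
move=> M ltM w /= cw; apply: ltW; apply: le_lt_trans ltM.
rewrite -[w](subKr c); apply: (le_trans (ler_normB _ _)); lra.
Qed.

Lemma compact_ball_fits (O : set V) c r : open O -> 0 < r ->
  (forall w, `|c - w| <= r -> O w) ->
  exists2 r', r < r' & forall w, `|c - w| < r' -> O w.
Proof.
move=> oO r0 KO.
pose K := [set w | `|c - w| <= r + 1] `&` ~` O.
have cK : compact K.
  apply: compact_closedI; first exact: compact_norm_ball.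
  exact: open_closedC.
have [[w0 Kw0]|nK] := pselect (K !=set0); last first.
  exists (r + 1); first lra.
  move=> w cw; apply: contrapT => nO; apply: nK; exists w; split => //=; exact: ltW.
have cf : continuous (fun w : V => `|c - w|).
  move=> w; apply: (@cvg_norm _ _ _ (nbhs w)).
  by apply: cvgB; [exact: cvg_cst|exact: cvg_id].
have [] := EVT_min_rV _ cK (continuous_subspaceT cf); first by exists w0.
move=> m /set_mem[/= m1 mO] mmin.
exists (Num.min `|c - m| (r + 1)).
  rewrite lt_min; apply/andP; split; last lra.
  by rewrite ltNge; apply/negP => /KO.
move=> w; rewrite lt_min => /andP[w1 w2]; apply: contrapT => nO.
have : w \in K by rewrite inE; split => //=; exact: ltW.
by move=> /mmin; rewrite leNgt w1.
Qed.

(** Every point of the closed ball gets a local lift that agrees with [s] on the overlap. These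
    local lifts fit together on a union of small balls, which by compactness contains a larger
    concentric ball. *)
Lemma lift_on_extend (c : V) (r : R) s : 0 < r -> ~ D c -> lift_on (ball c r) s ->
  exists r' s', [/\ r < r', lift_on (ball c r') s' & s' c = s c].
Proof.
move=> r0 Dc ls; pose K : set V := [set w | `|c - w| <= r].
have /choice[d dP] : forall y, exists d, 0 < d /\ (forall z x, ball y d z -> ~ D z ->
    F x = h z -> exists2 s, lift_on (ball y d) s & s z = x).
  by move=> y; have [d ? ?] := loc y; exists d.
have /choice[S SP] : forall y, exists s', K y -> lift_on (ball y (d y)) s' /\
    (forall w, ball y (d y) w -> ball c r w -> ~ D w -> s' w = s w).
  move=> y; have [Ky|] := pselect (K y); last by exists s.
  have [d0 dl] := dP y.
  have [v yv cv] : exists2 v, ball y (d y) v & ball c r v.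
    by apply: (open_meets_ball _ _ r0 Ky); [exact: ball_open|exact: ballxx].
  have [z [[yz cz] Dz]] : (ball y (d y) `&` ball c r) `\` D !=set0.
    by apply: eD; [apply: openI; exact: ball_open|exists v].
  have [s' ls' s'z] := dl z (s z) yz Dz (ls z cz Dz).2.
  exists s' => _; split => // w yw cw Dw.
  apply: (@lift_on_agree (ball y (d y) `&` ball c r) s' s z) => //.
  - by apply: openI; exact: ball_open.
  - by apply: is_convexI; exact: ball_is_convex.
  - by move=> u [] /ls' + _; apply.
  - by move=> u [] _ /ls; apply.
pose O : set V := \bigcup_(y in K) ball y (d y).
have [r' rr' r'O] : exists2 r', r < r' & forall w, `|c - w| < r' -> O w.
  apply: compact_ball_fits => //; first by apply: bigcup_open => y _; exact: ball_open.
  by move=> w Kw; exists w => //; apply: ballxx; exact: (dP w).1.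
have /choice[p pP] : forall w, exists y, O w -> K y /\ ball y (d y) w.
  by move=> w; have [[y Ky yw]|] := pselect (O w); [exists y|exists c].
have agree (y y' w : V) : K y -> K y' -> ball y (d y) w -> ball y' (d y') w -> ~ D w ->
    S y w = S y' w.
  move=> Ky Ky' yw y'w Dw; have [d0 _] := dP y; have [d'0 _] := dP y'.
  (* This weight puts [v] within [d y] of [y] and within [d y'] of [y'], on the segment between
     them, hence in the closed ball. So two small balls that meet also meet inside [ball c r], where
     both lifts equal [s]. *)
  pose t : R := d y / (d y + d y').
  have t0 : 0 <= t by rewrite divr_ge0// ltW// addr_gt0.
  have yy' : `|y - y'| < d y + d y'.
    have := ler_normD (y - w) (w - y'); rewrite addrA subrK => /le_lt_trans; apply.
    move: yw y'w; rewrite -!ball_normE /ball_ /= (distrC y' w) => ? ?; lra.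
  have t1 : t < 1 by rewrite ltr_pdivrMr ?addr_gt0// mul1r ltrDl.
  have tE : t * (d y + d y') = d y by rewrite divfK// gt_eqF// addr_gt0.
  clearbody t; pose v : V := y + t *: (y' - y).
  have Kv : K v.
    rewrite /K /=; have -> : c - v = (1 - t) *: (c - y) + t *: (c - y').
      rewrite scalerBl scale1r -addrA (addrC (- _)) -scalerBr opprB [c - y']addrC.
      by rewrite addrACA subrr addr0 /v opprD addrA -scalerN opprB (addrC (- y')).
    apply: (le_trans (ler_normD _ _)); rewrite !normrZ (ger0_norm t0) ger0_norm; last lra.
    have : t * `|c - y'| <= t * r by rewrite ler_wpM2l.
    have : (1 - t) * `|c - y| <= (1 - t) * r by rewrite ler_wpM2l// subr_ge0 ltW.
    lra.
  have yv : ball y (d y) v.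
    rewrite -ball_normE /ball_ /= /v opprD addrA subrr sub0r normrN normrZ ger0_norm//.
    rewrite distrC; have := ler_wpM2l t0 (ltW yy'); rewrite tE => h1.
    have [tz|tn] := eqVneq t 0; first by rewrite tz mul0r.
    by rewrite -tE ltr_pM2l// lt_def tn.
  have y'v : ball y' (d y') v.
    rewrite -ball_normE /ball_ /=.
    have -> : y' - v = (1 - t) *: (y' - y).
      by rewrite /v opprD addrA scalerBl scale1r.
    rewrite normrZ ger0_norm ?subr_ge0 1?ltW// distrC.
    have e : (1 - t) * (d y + d y') = d y' by rewrite mulrBl mul1r tE addrC addKr.
    by rewrite -[X in _ < X]e ltr_pM2l// subr_gt0.
  pose W := ball y (d y) `&` ball y' (d y').
  have oW : open W by apply: openI; exact: ball_open.
  have vW : is_convex W by apply: is_convexI; exact: ball_is_convex.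
  have [u [yu y'u] cu] : exists2 u, W u & ball c r u by apply: (open_meets_ball oW _ r0 Kv).
  have [z [[[yz y'z] cz] Dz]] : (W `&` ball c r) `\` D !=set0.
    by apply: eD; [apply: openI => //; exact: ball_open|exists u].
  have [ly sy] := SP y Ky; have [ly' sy'] := SP y' Ky'.
  apply: (@lift_on_agree W _ _ z) => //.
  - by move=> x [] /ly + _; apply.
  - by move=> x [] _ /ly'; apply.
  - by rewrite sy// sy'.
exists r', (fun w => S (p w) w); split => //.
- move=> w; rewrite -ball_normE /ball_ /= => /r'O Ow Dw.
  have [Kp pw] := pP w Ow; have [lp _] := SP _ Kp; have [cp Fp] := lp w pw Dw.
  split => //.
  have e : \forall u \near w, S (p w) u = S (p u) u.
    have : \forall u \near w, (ball (p w) (d (p w)) `\` D) u.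
      apply: open_nbhs_nbhs; split => //; apply: openI; first exact: ball_open.
      exact: closed_openC.
    apply: filterS => u [pu Du].
    have Ou : O u by exists (p w).
    by have [Ku puu] := pP u Ou; apply: agree.
  by rewrite /continuous_at; apply: cvg_trans cp; exact: (near_eq_cvg e).
- have Kc : K c by rewrite /K /= subrr normr0 ltW.
  have Oc : O c by exists c => //; apply: ballxx; exact: (dP c).1.
  have [Kp pw] := pP c Oc; have [_ sp] := SP _ Kp.
  by apply: sp => //; exact: ballxx.
Qed.

Lemma lift_glue (P : R -> Prop) c x : ~ D c ->
  (forall r, P r -> 0 < r /\ exists2 s, lift_on (ball c r) s & s c = x) ->
  exists2 s, lift_on (\bigcup_(r in P) ball c r) s & ((exists r, P r) -> s c = x).
Proof.
move=> Dc HP.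
have /choice[S SP] : forall r, exists s, P r -> lift_on (ball c r) s /\ s c = x.
  move=> r; have [Pr|] := pselect (P r); last by exists (fun=> x).
  by have [_ [s ? ?]] := HP r Pr; exists s.
have agree r r' (w : V) : P r -> P r' -> ball c r w -> ball c r' w -> ~ D w -> S r w = S r' w.
  move=> Pr Pr' rw r'w Dw; have [l e] := SP r Pr; have [l' e'] := SP r' Pr'.
  have [r0 _] := HP r Pr; have [r'0 _] := HP r' Pr'.
  apply: (@lift_on_agree (ball c r `&` ball c r') _ _ c) => //.
  - by apply: openI; exact: ball_open.
  - by apply: is_convexI; exact: ball_is_convex.
  - by move=> u [] /l + _; apply.
  - by move=> u [] _ /l'; apply.
  - by split; exact: ballxx.
  - by rewrite e e'.
pose O := \bigcup_(r in P) ball c r.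
have /choice[p pP] : forall w, exists r, O w -> P r /\ ball c r w.
  by move=> w; have [[y Ky yw]|] := pselect (O w); [exists y|exists 0].
exists (fun w => S (p w) w).
- move=> w Ow Dw; have [Pp pw] := pP w Ow; have [lp _] := SP _ Pp.
  have [cp Fp] := lp w pw Dw; split => //.
  have e : \forall u \near w, S (p w) u = S (p u) u.
    have : \forall u \near w, (ball c (p w) `\` D) u.
      apply: open_nbhs_nbhs; split => //; apply: openI; first exact: ball_open.
      exact: closed_openC.
    apply: filterS => u [pu Du].
    have Ou : O u by exists (p w).
    by have [Pu puu] := pP u Ou; apply: agree.
  by rewrite /continuous_at; apply: cvg_trans cp; exact: (near_eq_cvg e).
- move=> [r Pr]; have [r0 _] := HP r Pr.
  have Oc : O c by exists r => //; exact: ballxx.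
  by have [Pp _] := pP c Oc; have [] := SP _ Pp.
Qed.

(* Among the radii [r] such that a lift exists on [ball c r], compactness of the closed ball
   forbids a finite supremum. *)
Lemma lift_global c x : ~ D c -> F x = h c -> exists2 s, lift_on setT s & s c = x.
Proof.
move=> Dc Fx.
pose P r := 0 < r /\ exists2 s, lift_on (ball c r) s & s c = x.
have [s ls sc] := @lift_glue P c x Dc (fun r h => h).
have [d d0 dl] := loc c.
have Pd : P d by split => //; apply: dl => //; exact: ballxx.
have [ub|nub] := pselect (has_ubound P); last first.
  exists s; last by apply: sc; exists d.
  move=> w _ Dw; apply: ls => //.
  have : exists2 r, P r & `|c - w| < r.
    apply: contrapT => nr; apply: nub; exists `|c - w| => r Pr.
    by rewrite leNgt; apply/negP => lr; apply: nr; exists r.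
  by move=> [r Pr cw]; exists r => //; rewrite -ball_normE.
have sP : has_sup P by split => //; exists d.
have s0 : 0 < sup P by apply: (lt_le_trans d0); exact: ub_le_sup.
have ls' : lift_on (ball c (sup P)) s.
  move=> w cw Dw; apply: ls => //.
  move: cw; rewrite -ball_normE /ball_ /= => cw.
  have e0 : 0 < sup P - `|c - w| by rewrite subr_gt0.
  have [r Pr] := sup_adherent e0 sP; rewrite subKr => lr.
  by exists r => //; rewrite -ball_normE.
have [r' [s' [rr' l' e']]] := lift_on_extend s0 Dc ls'.
have : r' <= sup P.
  apply: ub_le_sup => //; split; first exact: lt_trans rr'.
  by exists s' => //; rewrite e'; apply: sc; exists d.
by rewrite leNgt rr'.
Qed.

End Growth.

(** * Vectors in space *)

Section ContinuousAt.
Variables (R : realType) (T : topologicalType).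
Implicit Types (f g : T -> R) (z : T).

Lemma cont_cst (U : topologicalType) (c : U) z : {for z, continuous (fun=> c : U)}.
Proof. exact: cvg_cst. Qed.

Lemma cont_add f g z : {for z, continuous f} -> {for z, continuous g} ->
  {for z, continuous (fun x => f x + g x)}.
Proof. by move=> cf cg; apply: cvgD. Qed.

Lemma cont_opp f z : {for z, continuous f} -> {for z, continuous (fun x => - f x)}.
Proof. by move=> cf; apply: cvgN. Qed.

Lemma cont_mul f g z : {for z, continuous f} -> {for z, continuous g} ->
  {for z, continuous (fun x => f x * g x)}.
Proof. by move=> cf cg; apply: cvgM. Qed.

Lemma cont_inv f z : {for z, continuous f} -> f z != 0 ->
  {for z, continuous (fun x => (f x)^-1)}.
Proof. by move=> cf fz; apply: cvgV. Qed.

Lemma cont_comp (U W : topologicalType) (f : T -> U) (g : U -> W) z :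
  {for z, continuous f} -> {for f z, continuous g} -> {for z, continuous (fun x => g (f x))}.
Proof. exact: continuous_comp. Qed.

Lemma cont_row n (f : T -> 'rV[R]_n) z :
  (forall i, {for z, continuous (fun x => f x ord0 i)}) -> {for z, continuous f}.
Proof.
move=> cf A /nbhs_ballP[e /= e0 eA].
have : \forall x \near z, forall i, ball (f z ord0 i) e (f x ord0 i).
  apply: filter_forall => i; apply: (cf i); exact: nbhsx_ballx.
apply: filterS => x fx; apply: eA; split => // i j.
by rewrite (ord1 i); exact: fx.
Qed.

Lemma cont_proj n i (v : 'rV[R]_n) : {for v, continuous (fun v : 'rV[R]_n => v ord0 i)}.
Proof. exact: coord_continuous. Qed.

Lemma cont_id z : {for z, continuous (fun x : T => x)}.
Proof. exact: cvg_id. Qed.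

Lemma cont_coord n (f : T -> 'rV[R]_n) i z : {for z, continuous f} ->
  {for z, continuous (fun x => f x ord0 i)}.
Proof.
by move=> cf; apply: (cont_comp (g := fun v : 'rV[R]_n => v ord0 i) cf); exact: coord_continuous.
Qed.

Lemma cont_addv n (f g : T -> 'rV[R]_n) z : {for z, continuous f} -> {for z, continuous g} ->
  {for z, continuous (fun x => f x + g x)}.
Proof. by move=> cf cg; apply: cvgD. Qed.

Lemma cont_oppv n (f : T -> 'rV[R]_n) z : {for z, continuous f} ->
  {for z, continuous (fun x => - f x)}.
Proof. by move=> cf; apply: cvgN. Qed.

Lemma cont_scalev n f (g : T -> 'rV[R]_n) z : {for z, continuous f} -> {for z, continuous g} ->
  {for z, continuous (fun x => f x *: g x)}.
Proof. by move=> cf cg; apply: cvgZ. Qed.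

Lemma cont_eq_near (U : topologicalType) (f g : T -> U) z : {for z, continuous f} ->
  (\forall x \near z, f x = g x) -> {for z, continuous g}.
Proof.
move=> cf e; have e1 : f z = g z := nbhs_singleton e.
by rewrite /prop_for /continuous_at -e1; apply: cvg_trans cf; exact: (near_eq_cvg e).
Qed.

End ContinuousAt.
Arguments cont_cst {T U} c z.
Arguments cont_id {T} z.
Arguments cont_proj {R n} i v.

Section Space.
Variable R : realType.
Local Notation V := 'rV[R]_3.
Implicit Types x y z : V.

Definition vec3 (a b c : R) : V := \row_(i < 3) nth 0 [:: a; b; c] i.

Lemma vec3E a b c : ((vec3 a b c ord0 0 = a) * (vec3 a b c ord0 1 = b) *
  (vec3 a b c ord0 2 = c))%type.
Proof. by rewrite /vec3 !mxE. Qed.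

Lemma row3P x y : x ord0 0 = y ord0 0 -> x ord0 1 = y ord0 1 -> x ord0 2 = y ord0 2 -> x = y.
Proof.
move=> h0 h1 h2; apply/rowP => -[[|[|[|i]]] //= hi].
- by rewrite (_ : Ordinal hi = 0)//; exact/val_inj.
- by rewrite (_ : Ordinal hi = 1)//; exact/val_inj.
- by rewrite (_ : Ordinal hi = 2)//; exact/val_inj.
Qed.

Definition dot x y := x ord0 0 * y ord0 0 + x ord0 1 * y ord0 1 + x ord0 2 * y ord0 2.

Definition cross x y := vec3 (x ord0 1 * y ord0 2 - x ord0 2 * y ord0 1)
  (x ord0 2 * y ord0 0 - x ord0 0 * y ord0 2) (x ord0 0 * y ord0 1 - x ord0 1 * y ord0 0).

Lemma dotC x y : dot x y = dot y x. Proof. by rewrite /dot; ring. Qed.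
Lemma dotDl x y z : dot (x + y) z = dot x z + dot y z.
Proof. by rewrite /dot !mxE; ring. Qed.
Lemma dotNl x z : dot (- x) z = - dot x z. Proof. by rewrite /dot !mxE; ring. Qed.
Lemma dotZl a x z : dot (a *: x) z = a * dot x z. Proof. by rewrite /dot !mxE; ring. Qed.
Lemma dotDr x y z : dot z (x + y) = dot z x + dot z y.
Proof. by rewrite /dot !mxE; ring. Qed.
Lemma dotNr x z : dot z (- x) = - dot z x. Proof. by rewrite /dot !mxE; ring. Qed.
Lemma dotZr a x z : dot z (a *: x) = a * dot z x. Proof. by rewrite /dot !mxE; ring. Qed.

Lemma dot0l x : dot 0 x = 0. Proof. by rewrite /dot !mxE; ring. Qed.

Definition dotE := (dotDl, dotDr, dotNl, dotNr, dotZl, dotZr).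

Lemma dot_comb a x y : dot (x + a *: y) (x + a *: y) =
  dot x x + a * (dot x y *+ 2) + a ^+ 2 * dot y y.
Proof. by rewrite /dot !mxE; ring. Qed.

Lemma dot_comb2 a b x y : dot (a *: x + b *: y) (a *: x + b *: y) =
  a ^+ 2 * dot x x + a * b * (dot x y *+ 2) + b ^+ 2 * dot y y.
Proof. by rewrite /dot !mxE; ring. Qed.

Lemma dot_ge0 x : 0 <= dot x x.
Proof. by rewrite /dot -!expr2 !addr_ge0// sqr_ge0. Qed.

Lemma dot_eq0 x : dot x x = 0 -> x = 0.
Proof.
rewrite /dot -!expr2 => h.
have := (sqr_ge0 (x ord0 0), sqr_ge0 (x ord0 1), sqr_ge0 (x ord0 2)) => -[[h0 h1] h2].
by apply: row3P; rewrite mxE; apply/eqP; rewrite -sqrf_eq0; apply/eqP; lra.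
Qed.

Lemma dot_gt0 x : x <> 0 -> 0 < dot x x.
Proof.
move=> x0; rewrite lt_def dot_ge0 andbT; apply/eqP => h.
by apply: x0; exact: dot_eq0.
Qed.

Lemma dot_crossl x y : dot x (cross x y) = 0.
Proof. by rewrite /dot /cross !vec3E; ring. Qed.

Lemma dot_crossr x y : dot y (cross x y) = 0.
Proof. by rewrite /dot /cross !vec3E; ring. Qed.

Lemma dot_cross x y : dot (cross x y) (cross x y) = dot x x * dot y y - dot x y ^+ 2.
Proof. by rewrite /dot /cross !vec3E; ring. Qed.

(** Coordinates in the orthogonal frame [E0], [E1], [q] with denominators cleared, using that
    [dot E1 E1] is [dot q q * dot E0 E0]. *)
Lemma orthogonal_expansion q e d (E0 := cross q e) (E1 := cross q E0) :
  (dot q q * dot E0 E0) *: d =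
  (dot q q * dot d E0) *: E0 + dot d E1 *: E1 + (dot E0 E0 * dot d q) *: q.
Proof.
by rewrite /E1 /E0 /dot /cross; apply: row3P; rewrite !vec3E !mxE /=; ring.
Qed.

Section ContinuousDot.
Variable T : topologicalType.
Implicit Types f g : T -> V.

Lemma cont_dot f g t : {for t, continuous f} -> {for t, continuous g} ->
  {for t, continuous (fun u => dot (f u) (g u))}.
Proof.
by move=> cf cg; do 2?apply: cont_add; apply: cont_mul; apply: cont_coord.
Qed.

Lemma cont_vec3 (a b c : T -> R) t : {for t, continuous a} -> {for t, continuous b} ->
  {for t, continuous c} -> {for t, continuous (fun u => vec3 (a u) (b u) (c u))}.
Proof.
move=> ca cb cc; apply: cont_row => -[[|[|[|i]]] //= hi].
- by apply: (cont_eq_near ca); apply: nearW => u; rewrite mxE.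
- by apply: (cont_eq_near cb); apply: nearW => u; rewrite mxE.
- by apply: (cont_eq_near cc); apply: nearW => u; rewrite mxE.
Qed.

Lemma cont_cross f g t : {for t, continuous f} -> {for t, continuous g} ->
  {for t, continuous (fun u => cross (f u) (g u))}.
Proof.
by move=> cf cg; apply: cont_vec3; apply: cont_add; do ?apply: cont_opp;
  apply: cont_mul; apply: cont_coord.
Qed.

End ContinuousDot.

End Space.

(** * Polar coordinates *)

Section Polar.
Variable R : realType.
Local Notation V := 'rV[R]_3.

Lemma cos_eq1_itv (d : R) : 0 <= d -> d < pi *+ 2 -> cos d = 1 -> d = 0.
Proof.
move=> d0 d2 cd; apply/eqP; rewrite eq_le d0 andbT leNgt; apply/negP => dp.
have : 0 < sin (d / 2).
  apply: sin_gt0_pi; rewrite divr_gt0//= ltr_pdivrMr//.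
  by rewrite mulr_natr.
have : cos (d / 2 + d / 2) = 1 by rewrite -splitr.
rewrite cosD; have := cos2Dsin2 (d / 2) => h1 h2 s0.
have : sin (d / 2) ^+ 2 = 0 by lra.
by move=> /eqP; rewrite sqrf_eq0 => /eqP s1; rewrite s1 ltxx in s0.
Qed.

Lemma cos_sin_eq_mod (x y : R) : x <= y -> cos x = cos y -> sin x = sin y ->
  exists n, y = x + pi *+ 2 *+ n.
Proof.
move=> xy cxy sxy; have p2 : 0 < pi *+ 2 :> R by rewrite pmulrn_lgt0// pi_gt0.
pose n := Num.truncn ((y - x) / (pi *+ 2)).
have hx : 0 <= (y - x) / (pi *+ 2) by rewrite divr_ge0 ?subr_ge0// ltW.
have /andP[n1 n2] := Num.Theory.truncn_itv hx.
rewrite -/n ler_pdivlMr// in n1; rewrite -/n ltr_pdivrMr// in n2.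
exists n; pose d := y - x - n%:R * (pi *+ 2).
have nE : pi *+ 2 *+ n = n%:R * (pi *+ 2) :> R by exact: esym (mulr_natl _ _).
have : d = 0.
  apply: cos_eq1_itv; first by rewrite /d; lra.
    by rewrite -addn1 natrD mulrDl mul1r in n2; rewrite /d; lra.
  have -> : cos d = cos (y - x).
    rewrite -(periodicn (@cosD2pi R) n d) nE; congr cos; rewrite /d; ring.
  rewrite cosB cxy sxy -!expr2; exact: cos2Dsin2.
rewrite nE /d; lra.
Qed.

(** The coordinates are the angle, the logarithm of the radius and the height. The logarithm makes
    the whole space the domain, so this is the universal covering of the complement of the third
    axis. *)
Definition polar (u : V) : V :=
  vec3 (expR (u ord0 1) * cos (u ord0 0)) (expR (u ord0 1) * sin (u ord0 0)) (u ord0 2).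

Lemma polar_norm u :
  (polar u ord0 0) ^+ 2 + (polar u ord0 1) ^+ 2 = expR (u ord0 1) ^+ 2.
Proof. by rewrite /polar !vec3E !exprMn -mulrDr cos2Dsin2 mulr1. Qed.

Lemma polar_shift (u : V) n :
  polar (vec3 (u ord0 0 + pi *+ 2 *+ n) (u ord0 1) (u ord0 2)) = polar u.
Proof. by rewrite /polar !vec3E (periodicn (@cosD2pi R)) (periodicn (@sinD2pi R)). Qed.

Lemma polar_cont u : {for u, continuous polar}.
Proof.
apply: cont_vec3.
- apply: cont_mul.
    apply: (cont_comp (g := @expR R)); first exact: coord_continuous.
    exact: continuous_expR.
  apply: (cont_comp (g := @cos R)); first exact: coord_continuous.
  exact: continuous_cos.
- apply: cont_mul.
    apply: (cont_comp (g := @expR R)); first exact: coord_continuous.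
    exact: continuous_expR.
  apply: (cont_comp (g := @sin R)); first exact: coord_continuous.
  exact: continuous_sin.
- exact: coord_continuous.
Qed.

Lemma polar_eq u u' : polar u = polar u' -> exists n,
  u' = vec3 (u ord0 0 + pi *+ 2 *+ n) (u ord0 1) (u ord0 2) \/
  u = vec3 (u' ord0 0 + pi *+ 2 *+ n) (u' ord0 1) (u' ord0 2).
Proof.
move=> e; have e1 : u ord0 1 = u' ord0 1.
  have : expR (u ord0 1) ^+ 2 = expR (u' ord0 1) ^+ 2 by rewrite -!polar_norm e.
  move=> /eqP; rewrite eqrXn2 ?ltW ?expR_gt0// => /eqP h.
  by rewrite -[LHS]expRK h expRK.
have e2 : u ord0 2 = u' ord0 2.
  by have := congr1 (fun v : V => v ord0 2) e; rewrite /polar !vec3E.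
have ep : expR (u ord0 1) != 0 by rewrite gt_eqF// expR_gt0.
have ec : cos (u ord0 0) = cos (u' ord0 0).
  have := congr1 (fun v : V => v ord0 0) e; rewrite /polar !vec3E -e1.
  exact: mulfI.
have es : sin (u ord0 0) = sin (u' ord0 0).
  have := congr1 (fun v : V => v ord0 1) e; rewrite /polar !vec3E -e1.
  exact: mulfI.
have [le|/ltW le] := leP (u ord0 0) (u' ord0 0).
- have [n nE] := cos_sin_eq_mod le ec es; exists n; left.
  by apply: row3P; rewrite !vec3E.
- have [n nE] := cos_sin_eq_mod le (esym ec) (esym es); exists n; right.
  by apply: row3P; rewrite !vec3E.
Qed.

Lemma angle_exists (x y : R) : x ^+ 2 + y ^+ 2 = 1 ->
  exists t, x = cos t /\ y = sin t.
Proof.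
move=> xy.
have x1 : -1 <= x <= 1.
  by rewrite -ler_norml -(@ler_pXn2r _ 2)// ?nnegrE// real_normK ?num_real// expr1n -xy lerDl sqr_ge0.
have yE : Num.sqrt (1 - x ^+ 2) = `|y|.
  by rewrite -sqrtr_sqr; congr Num.sqrt; rewrite -xy; ring.
have [y0|/ltW y0] := leP 0 y.
- exists (acos x); rewrite acosK ?in_itv//=; split => //.
  by rewrite sin_acos// yE ger0_norm.
- exists (- acos x); rewrite cosN acosK ?in_itv//=; split => //.
  by rewrite sinN sin_acos// yE ler0_norm// opprK.
Qed.

Lemma polar_surj (v : V) : 0 < v ord0 0 ^+ 2 + v ord0 1 ^+ 2 -> exists u, polar u = v.
Proof.
move=> v0; pose r := Num.sqrt (v ord0 0 ^+ 2 + v ord0 1 ^+ 2).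
have r0 : 0 < r by rewrite sqrtr_gt0.
have r2 : r ^+ 2 = v ord0 0 ^+ 2 + v ord0 1 ^+ 2 by rewrite sqr_sqrtr// ltW.
have [|t [tc ts]] := @angle_exists (v ord0 0 / r) (v ord0 1 / r).
  by rewrite !exprMn -mulrDl -r2 -exprMn divff ?expr1n// gt_eqF.
exists (vec3 t (ln r) (v ord0 2)); apply: row3P; rewrite /polar !vec3E//.
- by rewrite lnK// -tc mulrC divfK// gt_eqF.
- by rewrite lnK// -ts mulrC divfK// gt_eqF.
Qed.

Lemma sin_atan (x : R) : sin (atan x) = x * (Num.sqrt (1 + x ^+ 2))^-1.
Proof.
have := atanK x; rewrite /tan cos_atan invrK => h.
rewrite -{2}h -mulrA divff ?mulr1// gt_eqF// sqrtr_gt0.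
by rewrite ltr_pwDl// sqr_ge0.
Qed.

(** Rotating by minus the angle of [u0] brings [polar u0] over the positive real half axis, near
    which the angle is [atan (im / re)]. *)
Lemma polar_branch (u0 : V) : exists br : V -> V,
  br (polar u0) = u0 /\
  \forall v \near polar u0, {for v, continuous br} /\ polar (br v) = v.
Proof.
set v0 := polar u0; pose c := cos (u0 ord0 0); pose s := sin (u0 ord0 0).
have cs : c ^+ 2 + s ^+ 2 = 1 by exact: cos2Dsin2.
pose re (v : V) := v ord0 0 * c + v ord0 1 * s.
pose im (v : V) := v ord0 1 * c - v ord0 0 * s.
pose n2 (v : V) := v ord0 0 ^+ 2 + v ord0 1 ^+ 2.
have reim v : re v ^+ 2 + im v ^+ 2 = n2 v.
  have -> : n2 v = n2 v * (c ^+ 2 + s ^+ 2) by rewrite cs mulr1.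
  rewrite /re /im /n2; ring.
have re0 : re v0 = expR (u0 ord0 1).
  rewrite /re /v0 /polar !vec3E -/c -/s.
  by rewrite -!mulrA -mulrDr -!expr2 cs mulr1.
have im0 : im v0 = 0 by rewrite /im /v0 /polar !vec3E -/c -/s; ring.
have n20 : n2 v0 = expR (u0 ord0 1) ^+ 2 by rewrite -reim re0 im0; ring.
have ep := expR_gt0 (u0 ord0 1).
have cre v : {for v, continuous re}.
  by apply: cont_add; apply: cont_mul; (exact: cont_cst || exact: coord_continuous).
have cim v : {for v, continuous im}.
  apply: cont_add; last apply: cont_opp;
  by apply: cont_mul; (exact: cont_cst || exact: coord_continuous).
have cn2 v : {for v, continuous n2}.
  by apply: cont_add; apply: cont_mul; exact: coord_continuous.
pose br v := vec3 (u0 ord0 0 + atan (im v / re v)) (ln (Num.sqrt (n2 v))) (v ord0 2).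
exists br; split.
- apply: row3P; rewrite /br !vec3E.
  + by rewrite im0 mul0r atan0 addr0.
  + by rewrite n20 sqrtr_sqr gtr0_norm// expRK.
  + by rewrite /v0 /polar ?vec3E.
- have : \forall v \near v0, 0 < re v.
    have : \forall v \near v0, ball (re v0) (re v0) (re v).
      by apply: cre; apply: nbhsx_ballx; rewrite re0.
    by apply: filterS => v; rewrite -ball_normE /ball_ /= ltr_norml => /andP[_]; lra.
  apply: filterS => v rv.
  have n2v : 0 < n2 v by rewrite -reim ltr_pwDl ?exprn_gt0// sqr_ge0.
  have sq : Num.sqrt (1 + (im v / re v) ^+ 2) = Num.sqrt (n2 v) / re v.
    have -> : 1 + (im v / re v) ^+ 2 = n2 v * (re v)^-1 ^+ 2.
      by rewrite -reim; field; rewrite gt_eqF.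
    by rewrite sqrtrM ?ltW// sqrtr_sqr ger0_norm// invr_ge0 ltW.
  have sn : Num.sqrt (n2 v) != 0 by rewrite gt_eqF// sqrtr_gt0.
  have rn : re v != 0 by rewrite gt_eqF.
  split.
    have c1 := cont_mul (cim v) (cont_inv (cre v) rn).
    have c2 := cont_comp (g := @atan R) c1 (@continuous_atan _ _).
    have c3 := cont_comp (g := @Num.sqrt R) (cn2 v) (@sqrt_continuous _ _).
    have sp : 0 < Num.sqrt (n2 v) by rewrite sqrtr_gt0.
    have c4 := cont_comp (g := @ln R) c3 (continuous_ln sp).
    exact: (cont_vec3 (cont_add (cont_cst _ v) c2) c4 (cont_proj (2 : 'I_3) v)).
  apply: row3P; rewrite /polar /br !vec3E//.
  + rewrite lnK ?posrE ?sqrtr_gt0// cosD cos_atan sin_atan sq -/c -/s.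
    transitivity (c * re v - s * im v); first by field; rewrite sn rn.
    transitivity (v ord0 0 * (c ^+ 2 + s ^+ 2)); last by rewrite cs mulr1.
    rewrite /re /im; ring.
  + rewrite lnK ?posrE ?sqrtr_gt0// sinD cos_atan sin_atan sq -/c -/s.
    transitivity (s * re v + c * im v); first by field; rewrite sn rn.
    transitivity (v ord0 1 * (c ^+ 2 + s ^+ 2)); last by rewrite cs mulr1.
    rewrite /re /im; ring.
Qed.

End Polar.

(** * Spherical shells *)

Section Shell.
Variable R : realType.
Local Notation V := 'rV[R]_3.
Implicit Types (L : set V) (a x v : V) (p q : R -> V).

(* [L] meets the spherical shell [{x | |x - a|^2 \in I}] in two disjoint strands, parametrised by
   the square [s] of the distance to [a]; no point of a strand lies in the direction [e]. *)
Record shell L a (I : set R) p q : Prop := Shell {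
  shell_open : open I;
  shell_gt0 : forall s, I s -> 0 < s;
  shell_chart : exists rho lam : R -> R, [/\ continuous rho, forall t, I (rho t),
    forall s, I s -> {for s, continuous lam} & forall s, I s -> rho (lam s) = s];
  shell_cont1 : forall s, I s -> {for s, continuous p};
  shell_cont2 : forall s, I s -> {for s, continuous q};
  shell_norm1 : forall s, I s -> dot (p s) (p s) = s;
  shell_norm2 : forall s, I s -> dot (q s) (q s) = s;
  shell_neq : forall s, I s -> p s <> q s;
  shell_axis : exists e, forall s, I s -> cross (p s) e <> 0 /\ cross (q s) e <> 0;
  shell_in : forall x, I (dot (x - a) (x - a)) ->
    (L x <-> x = a + p (dot (x - a) (x - a)) \/ x = a + q (dot (x - a) (x - a)))
}.

Lemma shell_sym L a I p q : shell L a I p q -> shell L a I q p.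
Proof.
case=> h1 h2 h3 h4 h5 h6 h7 h8 [e h9] h10; split => //.
- by move=> s /h8 + /esym.
- by exists e => s /h9 [].
- by move=> x /h10 ->; split => -[]; auto.
Qed.

Lemma inversionK (u : V) (w := (dot u u)^-1 *: u) : u <> 0 -> (dot w w)^-1 *: w = u.
Proof.
move=> /dot_gt0 u0; rewrite /w dotZl dotZr scalerA -[RHS]scale1r; congr (_ *: _).
by field; rewrite gt_eqF.
Qed.

Definition shell_set a (I : set R) : set V := [set x | I (dot (x - a) (x - a))].

Lemma shell_set_open a I : open I -> open (shell_set a I).
Proof.
move=> oI; apply: (open_comp (f := fun x : V => dot (x - a) (x - a))) => // x _.
have c : {for x, continuous (fun x => dot (x - a) (x - a))}; last exact: c.
by apply: cont_dot; apply: cont_addv; (exact: cvg_id || exact: cont_cst).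
Qed.

Section Chart.
Variables (L : set V) (a : V) (I : set R) (p q : R -> V).
Hypothesis sh : shell L a I p q.
Variables (e : V) (rho lam : R -> R).
Hypotheses (he : forall s, I s -> cross (q s) e <> 0) (crho : continuous rho)
  (rhoI : forall t, I (rho t)) (clam : forall s, I s -> {for s, continuous lam})
  (rhoK : forall s, I s -> rho (lam s) = s).

(** [wp s] is the strand point [p s] after inversion about [q s]; [E0] and [E1] span the directions
    perpendicular to [q s]. In [W] the first two coordinates are measured from [wp], so the strand
    [p] becomes the third axis and the strand [q] goes to infinity. *)
Let wp s : V := (dot (p s - q s) (p s - q s))^-1 *: (p s - q s).
Let E0 s : V := cross (q s) e.
Let E1 s : V := cross (q s) (E0 s).
Let W v : V := wp (rho (v ord0 2)) + (v ord0 0 *: E0 (rho (v ord0 2)) + v ord0 1 *: E1 (rho (v ord0 2))).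

(* Inversion centred at [a + q s] maps the sphere minus that point to an affine plane. *)
Definition chart v : V :=
  a + (q (rho (v ord0 2)) + (dot (W v) (W v))^-1 *: W v).

Let pq_gt0 s : I s -> 0 < dot (p s - q s) (p s - q s).
Proof. by move=> Is; apply: dot_gt0 => /subr0_eq; exact: (shell_neq sh). Qed.

Let E0_gt0 s : I s -> 0 < dot (E0 s) (E0 s).
Proof. by move=> Is; apply: dot_gt0; exact: he. Qed.

Let E0q s : dot (E0 s) (q s) = 0. Proof. by rewrite dotC dot_crossl. Qed.
Let E1q s : dot (E1 s) (q s) = 0. Proof. by rewrite dotC dot_crossl. Qed.
Let E01 s : dot (E0 s) (E1 s) = 0. Proof. by rewrite dot_crossr. Qed.

Let E11 s : I s -> dot (E1 s) (E1 s) = s * dot (E0 s) (E0 s).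
Proof. by move=> Is; rewrite dot_cross (shell_norm2 sh Is) dotC E0q; ring. Qed.

(** As [p s] and [q s] have the same norm, [dot (p s - q s) (q s)] is minus half of
    [dot (p s - q s) (p s - q s)]. Inversion about a point of the sphere sends the sphere to the
    plane [dot w (q s) = - 2^-1]. *)
Let wpq s : I s -> dot (wp s) (q s) = - 2^-1.
Proof.
move=> Is; have := pq_gt0 Is; rewrite /wp !dotE (shell_norm1 sh Is) (shell_norm2 sh Is).
by rewrite (dotC (q s) (p s)) => h; field; rewrite gt_eqF//; lra.
Qed.

Let Wq v : dot (W v) (q (rho (v ord0 2))) = - 2^-1.
Proof. by rewrite /W 2!dotDl wpq// 2!dotZl E0q E1q; ring. Qed.

Let W_neq0 v : W v <> 0.
Proof. by move=> W0; have := Wq v; rewrite W0 dot0l; lra. Qed.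

Let WW_neq0 v : dot (W v) (W v) != 0.
Proof. by rewrite gt_eqF//; apply: dot_gt0; exact: W_neq0. Qed.

Lemma chart_radius v : dot (chart v - a) (chart v - a) = rho (v ord0 2).
Proof.
have -> : chart v - a = q (rho (v ord0 2)) + (dot (W v) (W v))^-1 *: W v.
  by rewrite /chart addrC addKr.
rewrite dot_comb (shell_norm2 sh)// (dotC (q _)) Wq.
by have := WW_neq0 v => h; field.
Qed.

Lemma chart_off v : 0 < v ord0 0 ^+ 2 + v ord0 1 ^+ 2 -> ~ L (chart v).
Proof.
move=> v0; have Is := rhoI (v ord0 2).
rewrite (shell_in sh) chart_radius//; set s := rho _ in Is *; case.
- rewrite /chart => /addrI h.
  have pq : p s - q s <> 0 by move=> /subr0_eq; exact: (shell_neq sh).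
  have E : p s - q s = (dot (wp s) (wp s))^-1 *: wp s.
    by rewrite inversionK.
  have : (dot (W v) (W v))^-1 *: W v = (dot (wp s) (wp s))^-1 *: wp s.
    by rewrite -E -h addrC addKr.
  move=> /(congr1 (fun u : V => (dot u u)^-1 *: u)); rewrite !inversionK//; last first.
    by move=> w0; have := wpq Is; rewrite w0 dot0l; lra.
  rewrite /W -/s -[RHS]addr0 => /addrI h0.
  have : dot (v ord0 0 *: E0 s + v ord0 1 *: E1 s) (v ord0 0 *: E0 s + v ord0 1 *: E1 s) = 0.
    by rewrite h0 dot0l.
  rewrite dot_comb2 E01 E11//.
  have e0 := E0_gt0 Is; have s0 := shell_gt0 sh Is.
  rewrite mul0rn mulr0 addr0.
  have h1 : 0 <= v ord0 0 ^+ 2 * dot (E0 s) (E0 s) by rewrite mulr_ge0 ?sqr_ge0// ltW.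
  have h2 : 0 <= v ord0 1 ^+ 2 * (s * dot (E0 s) (E0 s)).
    by rewrite mulr_ge0 ?sqr_ge0// mulr_ge0// ltW.
  move=> h3; have z1 : v ord0 0 ^+ 2 * dot (E0 s) (E0 s) = 0 by lra.
  have z2 : v ord0 1 ^+ 2 * (s * dot (E0 s) (E0 s)) = 0 by lra.
  move: z1 z2 => /eqP; rewrite mulf_eq0 (gt_eqF e0) orbF => /eqP z1 /eqP.
  rewrite mulf_eq0 (gt_eqF (mulr_gt0 s0 e0)) orbF => /eqP z2.
  by move: v0; rewrite z1 z2 addr0 ltxx.
- rewrite /chart -/s => /addrI; rewrite -[RHS]addr0 => /addrI /eqP.
  by rewrite scaler_eq0 invr_eq0 (negbTE (WW_neq0 v)) /= => /eqP; exact: W_neq0.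
Qed.

Lemma chart_strand v : v ord0 0 = 0 -> v ord0 1 = 0 ->
  chart v = a + p (rho (v ord0 2)).
Proof.
move=> v0 v1; rewrite /chart; congr (_ + _); set s := rho _.
have Is : I s by exact: rhoI.
have pq : p s - q s <> 0 by move=> /subr0_eq; exact: (shell_neq sh).
by rewrite /W v0 v1 !scale0r !addr0 -/s /wp inversionK// addrC subrK.
Qed.

Lemma chart_cont v : {for v, continuous chart}.
Proof.
have cr : {for v, continuous (fun v : V => rho (v ord0 2))}.
  exact: (cont_comp (g := rho) (cont_proj (2 : 'I_3) v) (@crho _)).
have cq : {for v, continuous (fun v : V => q (rho (v ord0 2)))}.
  exact: (cont_comp cr (shell_cont2 sh (rhoI _))).
have cp : {for v, continuous (fun v : V => p (rho (v ord0 2)))}.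
  exact: (cont_comp cr (shell_cont1 sh (rhoI _))).
have cpq : {for v, continuous (fun v : V => p (rho (v ord0 2)) - q (rho (v ord0 2)))}.
  exact: (cont_addv cp (cont_oppv cq)).
have cE0 : {for v, continuous (fun v : V => E0 (rho (v ord0 2)))}.
  exact: (cont_cross cq (cont_cst e v)).
have cE1 : {for v, continuous (fun v : V => E1 (rho (v ord0 2)))} by exact: (cont_cross cq cE0).
have cW : {for v, continuous W}.
  apply: (cont_addv (cont_scalev (cont_inv (cont_dot cpq cpq) _) cpq)
    (cont_addv (cont_scalev (cont_proj (0 : 'I_3) v) cE0)
      (cont_scalev (cont_proj (1 : 'I_3) v) cE1))).
  by rewrite gt_eqF// pq_gt0.
exact: (cont_addv (cont_cst a v) (cont_addv cq
  (cont_scalev (cont_inv (cont_dot cW cW) (WW_neq0 v)) cW))).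
Qed.

Let rad x := dot (x - a) (x - a).
Let dd x : V := (dot (x - a - q (rad x)) (x - a - q (rad x)))^-1 *: (x - a - q (rad x)) - wp (rad x).

(** The inverse of [chart]: invert about the point of the strand [q], subtract [wp] and take
    coordinates along [E0] and [E1]. The second denominator is [dot E1 E1]. *)
Definition cochart x : V := vec3 (dot (dd x) (E0 (rad x)) / dot (E0 (rad x)) (E0 (rad x)))
  (dot (dd x) (E1 (rad x)) / (rad x * dot (E0 (rad x)) (E0 (rad x)))) (lam (rad x)).

Lemma cochartK x : I (rad x) -> x <> a + q (rad x) -> chart (cochart x) = x.
Proof.
move=> Is xq; set s := rad x.
have s0 := shell_gt0 sh Is; have e0 := E0_gt0 Is.
have y0 : x - a - q s <> 0.
  by move=> /subr0_eq h; apply: xq; rewrite -/s -h addrC subrK.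
have yp := dot_gt0 y0.
have nq := shell_norm2 sh Is; rewrite -/s in nq e0 s0.
have yq : dot (x - a - q s) (q s) = - 2^-1 * dot (x - a - q s) (x - a - q s).
  have rE : dot (x - a) (x - a) = s by [].
  move: rE; set z := x - a => rE; clearbody z.
  by rewrite !dotE rE nq (dotC (q s) z); field.
have dq : dot (dd x) (q s) = 0.
  rewrite /dd -/s [LHS]dotDl [X in _ + X]dotNl wpq// [X in X - _]dotZl yq; field.
  by rewrite gt_eqF.
have dE : dd x = (dot (dd x) (E0 s) / dot (E0 s) (E0 s)) *: E0 s +
    (dot (dd x) (E1 s) / (s * dot (E0 s) (E0 s))) *: E1 s.
  have := orthogonal_expansion (q s) e (dd x); cbv zeta; rewrite -/(E0 s) -/(E1 s) nq dq mulr0 scale0r addr0.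
  move=> /(congr1 (fun u : V => (s * dot (E0 s) (E0 s))^-1 *: u)).
  rewrite scalerA mulVf ?scale1r; last by rewrite gt_eqF// mulr_gt0.
  move=> {1}->; rewrite scalerDr !scalerA; congr (_ *: _ + _ *: _).
    by field; rewrite !gt_eqF.
  by rewrite mulrC.
have WE : W (cochart x) = (dot (x - a - q s) (x - a - q s))^-1 *: (x - a - q s).
  by rewrite /W /cochart !vec3E rhoK// -/s -dE /dd -/s addrC subrK.
rewrite /chart WE /cochart !vec3E rhoK// -/s inversionK//.
by rewrite (addrC (q s)) subrK addrC subrK.
Qed.

Lemma cochart_cont x : I (rad x) -> x <> a + q (rad x) -> {for x, continuous cochart}.
Proof.
move=> Is xq.
have s0 := shell_gt0 sh Is; have e0 := E0_gt0 Is.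
have cz : {for x, continuous (fun x : V => x - a)}.
  exact: (cont_addv (cont_id x) (cont_cst (- a) x)).
have cr : {for x, continuous rad} by exact: (cont_dot cz cz).
have cq : {for x, continuous (fun x => q (rad x))}.
  exact: (cont_comp cr (shell_cont2 sh Is)).
have cp : {for x, continuous (fun x => p (rad x))}.
  exact: (cont_comp cr (shell_cont1 sh Is)).
have cpq : {for x, continuous (fun x => p (rad x) - q (rad x))}.
  exact: (cont_addv cp (cont_oppv cq)).
have cE0 : {for x, continuous (fun x => E0 (rad x))}.
  exact: (cont_cross cq (cont_cst e x)).
have cE1 : {for x, continuous (fun x => E1 (rad x))} by exact: (cont_cross cq cE0).
have cy : {for x, continuous (fun x => x - a - q (rad x))}.
  exact: (cont_addv cz (cont_oppv cq)).
have y0 : x - a - q (rad x) <> 0.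
  by move=> /subr0_eq h; apply: xq; rewrite -h addrC subrK.
have y1 : dot (x - a - q (rad x)) (x - a - q (rad x)) != 0 by rewrite gt_eqF// dot_gt0.
have pq1 : dot (p (rad x) - q (rad x)) (p (rad x) - q (rad x)) != 0 by rewrite gt_eqF// pq_gt0.
have cd : {for x, continuous dd}.
  exact: (cont_addv (cont_scalev (cont_inv (cont_dot cy cy) y1) cy)
    (cont_oppv (cont_scalev (cont_inv (cont_dot cpq cpq) pq1) cpq))).
have e1 : dot (E0 (rad x)) (E0 (rad x)) != 0 by rewrite gt_eqF.
have e2 : rad x * dot (E0 (rad x)) (E0 (rad x)) != 0 by rewrite gt_eqF// mulr_gt0.
exact: (cont_vec3 (cont_mul (cont_dot cd cE0) (cont_inv (cont_dot cE0 cE0) e1))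
  (cont_mul (cont_dot cd cE1) (cont_inv (cont_mul cr (cont_dot cE0 cE0)) e2))
  (cont_comp cr (clam Is))).
Qed.

Lemma cochart_strand x : I (rad x) -> x = a + p (rad x) ->
  cochart x = vec3 0 0 (lam (rad x)).
Proof.
move=> Is xp; have : dd x = 0.
  have E : x - a - q (rad x) = p (rad x) - q (rad x) by rewrite {1}xp [a + _]addrC addrK.
  by rewrite /dd E /wp subrr.
by move=> d0; rewrite /cochart d0 !dot0l !mul0r.
Qed.

Lemma cochart_off x : I (rad x) -> ~ L x ->
  0 < cochart x ord0 0 ^+ 2 + cochart x ord0 1 ^+ 2.
Proof.
move=> Is Lx; rewrite lt_def addr_ge0 ?sqr_ge0// andbT; apply/negP.
rewrite paddr_eq0 ?sqr_ge0// !sqrf_eq0 => /andP[/eqP c0 /eqP c1].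
apply: Lx; rewrite (shell_in sh)//.
have [xq|xq] := pselect (x = a + q (rad x)); first by right.
left; have E : cochart x ord0 2 = lam (rad x) by rewrite /cochart vec3E.
by have := chart_strand c0 c1; rewrite cochartK// E rhoK.
Qed.

End Chart.

End Shell.

(** * Lifting over a spherical shell *)

Section ShellSection.
Variable R : realType.
Local Notation V := 'rV[R]_3.
Variables (E : topologicalType) (F : E -> V).
Hypothesis hE : hausdorff_space E.
Hypothesis injF : forall x : E, exists2 U : set E, nbhs x U & {in U &, injective F}.
Variable L : set V.
Hypothesis clL : closed L.

Definition section_on := lift_on F L id.

Hypothesis locL : forall y : V, ~ L y -> exists2 d : R, 0 < d & forall x,
  ball y d (F x) -> exists2 s : V -> E, (forall w : V, ball y d w -> {for w, continuous s} /\ F (s w) = w) &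
    s (F x) = x.

(** By [locL] the map [F] is a covering off [L], and the domain of [h] is simply connected; this is
    [lift_global] with nothing cut out. *)
Lemma lift_off (h : V -> V) u0 x0 : continuous h -> (forall u, ~ L (h u)) -> F x0 = h u0 ->
  exists2 s : V -> E, (forall u, {for u, continuous s} /\ F (s u) = h u) & s u0 = x0.
Proof.
move=> ch hL Fx0.
have [s ls su] : exists2 s : V -> E, lift_on F set0 h setT s & s u0 = x0.
  apply: (lift_global hE injF) => //.
  - exact: closed0.
  - by move=> C _ /is_convex_connected; rewrite setD0.
  - by move=> C; rewrite setD0.
  - move=> y; have [d d0 dl] := locL (hL y).
    have : \forall z \near y, ball (h y) d (h z) by apply: ch; exact: nbhsx_ballx.
    move=> /nbhs_ballP[r /= r0 rd]; exists r => // z x yz _ Fx.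
    have hz : ball (h y) d (F x) by rewrite Fx; exact: rd.
    have [s ls sz] := dl x hz; exists (s \o h); last by rewrite /= -Fx.
    move=> w yw _; have [cs Fs] := ls (h w) (rd w yw).
    by split => //; exact: (cont_comp (f := h) (@ch w) cs).
by exists s => // u; have [] := ls u I (fun f => f).
Qed.

Variables (a : V) (I : set R) (p q : R -> V).
Hypothesis sh : shell L a I p q.

(** In the chart the shell minus [L] is the complement of the third axis, so [chart] after [polar]
    unrolls it. *)
Lemma shell_cover : exists Psi : V -> V, [/\ continuous Psi,
  forall u, shell_set a I (Psi u) /\ ~ L (Psi u) &
  forall x, shell_set a I x -> ~ L x -> exists u, Psi u = x].
Proof.
have [rho [lam [crho rhoI clam rhoK]]] := shell_chart sh.
have [e he'] := shell_axis sh.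
have he s : I s -> cross (q s) e <> 0 by move=> /he' [].
exists (chart a p q e rho \o @polar R); split.
- move=> u; apply: (cont_comp (f := @polar R) (@polar_cont R u)).
  exact: (chart_cont sh crho rhoI).
- move=> u; split; first by rewrite /shell_set /= (chart_radius sh e rhoI).
  by apply: (chart_off sh he rhoI); rewrite polar_norm exprn_gt0// expR_gt0.
- move=> x Ix Lx; have [u uE] := polar_surj (cochart_off sh he rhoI rhoK Ix Lx).
  exists u; rewrite /= uE (cochartK sh he rhoK)// => xq.
  by apply: Lx; rewrite (shell_in sh)//; right.
Qed.

Lemma shell_connected : connected (shell_set a I `\` L).
Proof.
have [Psi [cP PL Psurj]] := shell_cover.
have -> : shell_set a I `\` L = Psi @` setT.
  apply/seteqP; split => x; first by move=> [Ix Lx]; have [u <-] := Psurj x Ix Lx; exists u.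
  by move=> [u _ <-]; have [] := PL u.
apply: connected_continuous_connected; last exact: continuous_subspaceT.
by apply: is_convex_connected.
Qed.

(* Lifting along [polar] gives a section depending on the angle; near the strand it agrees with
   [sigma], so it is 2 pi-periodic there, hence everywhere. *)
Lemma shell_section s0 B sigma : I s0 -> nbhs (a + p s0) B -> section_on B sigma ->
  exists2 S, section_on (shell_set a I) S &
    exists2 B' : set V, nbhs (a + p s0) B' & forall w, B' w -> ~ L w -> S w = sigma w.
Proof.
move=> Is0 nB lsig.
have [rho [lam [crho rhoI clam rhoK]]] := shell_chart sh.
have [e he'] := shell_axis sh.
have he s : I s -> cross (q s) e <> 0 by move=> /he' [].
pose ch := chart a p q e rho; pose t0 := lam s0; pose P0 : V := vec3 0 0 t0.
have cch v : {for v, continuous ch} by exact: (chart_cont sh crho rhoI).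
pose Psi := ch \o @polar R.
have cPsi : continuous Psi.
  by move=> u; exact: (cont_comp (f := @polar R) (@polar_cont R u) (cch _)).
have PsiL u : ~ L (Psi u).
  by apply: (chart_off sh he rhoI); rewrite polar_norm exprn_gt0// expR_gt0.
have chP0 : ch P0 = a + p s0 by rewrite /ch (chart_strand sh e rhoI) ?vec3E// rhoK.
have [d d0 dB] : exists2 d : R, 0 < d & forall v, ball P0 d v -> interior B (ch v).
  have : \forall v \near P0, interior B (ch v).
    by apply: cch; rewrite chP0; exact: nbhs_interior.
  by move=> /nbhs_ballP[d /= d0 dB]; exists d.
have ballP (v : V) : `|v ord0 0| < d -> `|v ord0 1| < d -> `|v ord0 2 - t0| < d -> ball P0 d v.
  move=> v0 v1 v2; split => // i; rewrite (ord1 i) => -[[|[|[|j]]] //= hj].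
  - by rewrite mxE -ball_normE /ball_ /= sub0r normrN (_ : Ordinal hj = 0)//; exact/val_inj.
  - by rewrite mxE -ball_normE /ball_ /= sub0r normrN (_ : Ordinal hj = 1)//; exact/val_inj.
  - by rewrite mxE -ball_normE /ball_ /= distrC (_ : Ordinal hj = 2)//; exact/val_inj.
(* Points over a thin tube about the strand. [Q] is convex and invariant under angle shifts, and on
   it the lift [T] equals [sigma] after [Psi], which does not see a full turn. *)
pose Q : set V := [set u | expR (u ord0 1) < d /\ `|u ord0 2 - t0| < d].
have polarQ u : Q u -> ball P0 d (polar u).
  move=> [u1 u2]; apply: ballP; rewrite /polar !vec3E//.
  - rewrite normrM gtr0_norm ?expR_gt0//; apply: le_lt_trans u1.
    by rewrite ler_piMr ?expR_ge0// ler_norml cos_geN1 cos_le1.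
  - rewrite normrM gtr0_norm ?expR_gt0//; apply: le_lt_trans u1.
    by rewrite ler_piMr ?expR_ge0// ler_norml sin_geN1 sin_le1.
have QB u : Q u -> interior B (Psi u) by move=> Qu; apply: dB; exact: polarQ.
have cQ : connected Q.
  apply: is_convex_connected => x y t [x1 x2] [y1 y2] tge0 tle1; split; rewrite !mxE.
  - have [le|/ltW le] := leP (x ord0 1) (y ord0 1).
      apply: le_lt_trans y1; rewrite ler_expR.
      have : t * (y ord0 1 - x ord0 1) <= 1 * (y ord0 1 - x ord0 1).
        by rewrite ler_wpM2r// subr_ge0.
      lra.
    apply: le_lt_trans x1; rewrite ler_expR.
    have : t * (x ord0 1 - y ord0 1) >= 0 by rewrite mulr_ge0// subr_ge0.
    lra.
  - have := @ball_is_convex R R^o t0 d (x ord0 2) (y ord0 2) t.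
    rewrite -!ball_normE /ball_ /= !(distrC t0) => /(_ x2 y2 tge0 tle1).
    by rewrite /GRing.scale /=.
have Qu0 n : Q (vec3 (pi *+ 2 *+ n) (ln d - 1) t0).
  split; rewrite !vec3E ?subrr ?normr0//.
  by rewrite -[X in _ < X](lnK d0) ltr_expR; lra.
pose u0 : V := vec3 0 (ln d - 1) t0.
have Qu00 : Q u0 by exact: (Qu0 0%N).
have sigP u : Q u -> {for Psi u, continuous sigma} /\ F (sigma (Psi u)) = Psi u.
  by move=> /QB /interior_subset h; apply: lsig.
have [T TP Tu0] := lift_off cPsi PsiL (sigP u0 Qu00).2.
have cT u : {for u, continuous T} by have [] := TP u.
have TQ u : Q u -> T u = sigma (Psi u).
  apply: (lift_unique hE injF cQ (s := T) (s' := sigma \o Psi) (z0 := u0)) => //.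
  - by move=> z Qz; exact: (cont_comp (f := Psi) (@cPsi z) (sigP z Qz).1).
  - move=> z Qz; have : \forall w \near z, interior B (Psi w).
      by apply: cPsi; apply: open_nbhs_nbhs; split; [exact: open_interior|exact: QB].
    apply: filterS => w /interior_subset Bw.
    by rewrite (TP w).2 /= (lsig _ Bw (PsiL w)).2.
pose sft n (u : V) : V := vec3 (u ord0 0 + pi *+ 2 *+ n) (u ord0 1) (u ord0 2).
have csft n u : {for u, continuous (sft n)}.
  exact: (cont_vec3 (cont_add (cont_proj (0 : 'I_3) u) (cont_cst _ u))
    (cont_proj (1 : 'I_3) u) (cont_proj (2 : 'I_3) u)).
have TF n (z : V) : \forall w \near z, F ((T \o sft n) w) = F (T w).
  apply: (@filterE _ (nbhs z) (nbhs_filter z)) => w.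
  by rewrite (TP w).2 /= (TP (sft n w)).2 /Psi /= polar_shift.
have Tsft n u : T (sft n u) = T u.
  apply: (lift_unique hE injF (A := setT) (s := T \o sft n) (s' := T) (z0 := u0)) => //.
  - by apply: is_convex_connected.
  - by move=> z _; exact: (cont_comp (f := sft n) (csft n z) (cT _)).
  - have Qs : Q (sft n u0) by rewrite /sft !vec3E add0r; exact: Qu0.
    by rewrite [LHS](TQ _ Qs) (TQ _ Qu00) /Psi /= polar_shift.
have Teq u u' : polar u = polar u' -> T u = T u'.
  by move=> /polar_eq[n [->|->]]; rewrite -/(sft n _) Tsft.
(* [c] chooses angles without any continuity. By [Teq] the value of [S] does not depend on the
   choice, so continuity can be tested with a continuous branch [br]. *)
have /choice[c cP] : forall v : V, exists u, 0 < v ord0 0 ^+ 2 + v ord0 1 ^+ 2 -> polar u = v.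
  move=> v; have [/polar_surj[u uE]|] := pselect (0 < v ord0 0 ^+ 2 + v ord0 1 ^+ 2); first by exists u.
  by exists 0.
pose kap := cochart a p q e lam; pose S x := T (c (kap x)).
have offq x : shell_set a I x -> ~ L x -> x <> a + q (dot (x - a) (x - a)).
  by move=> Ix Lx xq; apply: Lx; rewrite (shell_in sh)//; right.
have kapc x : shell_set a I x -> ~ L x -> polar (c (kap x)) = kap x.
  by move=> Ix Lx; apply: cP; exact: (cochart_off sh he rhoI rhoK).
have Psikap x : shell_set a I x -> ~ L x -> Psi (c (kap x)) = x.
  move=> Ix Lx; rewrite /Psi /= kapc// /ch (cochartK sh he rhoK)//.
  exact: offq.
have ckap x : shell_set a I x -> x <> a + q (dot (x - a) (x - a)) -> {for x, continuous kap}.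
  by move=> Ix xq; exact: (cochart_cont sh he clam).
have oI : open (shell_set a I) by exact: shell_set_open (shell_open sh).
exists S.
  move=> x Ix Lx; split; last by rewrite /S (TP _).2 Psikap.
  have [br [br0 brP]] := polar_branch (c (kap x)).
  rewrite kapc// in br0 brP; have [cbr _] := nbhs_singleton brP.
  have ck : {for x, continuous kap} by apply: ckap => //; exact: offq.
  have cTb : {for x, continuous (fun y => T (br (kap y)))}.
    exact: (cont_comp (cont_comp ck cbr) (cT _)).
  apply: (cont_eq_near cTb).
  have h1 : \forall y \near x, polar (br (kap y)) = kap y.
    have h : \forall y \near x, {for kap y, continuous br} /\ polar (br (kap y)) = kap y.
      exact: (ck _ brP).
    by apply: filterS h => y [].
  have h2 : \forall y \near x, (shell_set a I `\` L) y.
    by apply: open_nbhs_nbhs; split => //; apply: openI => //; exact: closed_openC.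
  apply: filterS2 h1 h2 => y h1 [Iy Ly]; apply: Teq.
  by rewrite kapc.
have rp : dot (a + p s0 - a) (a + p s0 - a) = s0.
  by rewrite [a + _]addrC addrK (shell_norm1 sh).
have ck : {for a + p s0, continuous kap}.
  apply: ckap; first by rewrite /shell_set /= rp.
  by rewrite rp => /addrI; exact: (shell_neq sh).
have kE : kap (a + p s0) = P0.
  by rewrite /kap (cochart_strand (I := I)) ?rp.
have h1 : \forall y \near a + p s0, ball P0 d (kap y).
  by apply: ck; rewrite kE; exact: nbhsx_ballx.
(* The sup norm bounds the coordinates separately, whereas [Q] asks for a Euclidean radius below
   [d]. *)
have h1' : \forall y \near a + p s0, ball (0 : R) (d ^+ 2) (kap y ord0 0 ^+ 2 + kap y ord0 1 ^+ 2).
  have c0 := cont_coord (i := 0 : 'I_3) ck; have c1 := cont_coord (i := 1 : 'I_3) ck.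
  have cc : {for a + p s0, continuous (fun y => kap y ord0 0 ^+ 2 + kap y ord0 1 ^+ 2)}.
    exact: (cont_add (cont_mul c0 c0) (cont_mul c1 c1)).
  apply: cc; rewrite kE !vec3E !expr0n/= addr0; apply: nbhsx_ballx.
  by rewrite exprn_gt0.
have h2 : \forall y \near a + p s0, shell_set a I y.
  by apply: open_nbhs_nbhs; split => //; rewrite /shell_set /= rp.
exists [set y | [/\ ball P0 d (kap y), ball (0 : R) (d ^+ 2) (kap y ord0 0 ^+ 2 + kap y ord0 1 ^+ 2)
    & shell_set a I y]].
  by apply: filterS3 h1 h1' h2 => y; split.
move=> w [[_ kd] kd2 Iw] Lw; rewrite /S TQ ?Psikap//; split.
- move: kd2; have := polar_norm (c (kap w)); rewrite (kapc _ Iw Lw) => ->.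
  rewrite -ball_normE /ball_ /= sub0r normrN.
  by rewrite ger0_norm ?sqr_ge0// ltr_pXn2r// ?nnegrE ?expR_ge0// ltW.
- have -> : c (kap w) ord0 2 = kap w ord0 2.
    by have := congr1 (fun v : V => v ord0 2) (kapc _ Iw Lw); rewrite /polar vec3E.
  by have := kd ord0 2; rewrite /P0 vec3E -ball_normE /ball_ /= distrC.
Qed.

End ShellSection.

(** * The complement of the line *)

Section NormFacts.
Variable R : realType.
Local Notation V := 'rV[R]_3.

Lemma coord_le_norm (x : V) i : `|x ord0 i| <= `|x|.
Proof.
have /mapP[j Hj e] : `|x ord0 i| \in [seq `|x y.1 y.2| | y : 'I_1 * 'I_3].
  by apply/mapP; exists (ord0, i) => //=; rewrite mem_enum.
by rewrite e [leRHS]/Num.norm /= mx_normrE; apply/bigmax_geP; right => /=; exists j.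
Qed.

Lemma norm_lt_coord (x : V) r : 0 < r -> (forall i, `|x ord0 i| < r) -> `|x| < r.
Proof.
move=> r0 h; rewrite [ltLHS]/Num.norm /= mx_normrE; apply/bigmax_ltP; split => // -[i j] _ /=.
by rewrite (ord1 i).
Qed.

Lemma dot_le_norm (x : V) : dot x x <= 3 * `|x| ^+ 2.
Proof.
have h i : x ord0 i * x ord0 i <= `|x| ^+ 2.
  rewrite -expr2 -real_normK ?num_real//.
  by rewrite ler_pXn2r ?nnegrE//; exact: coord_le_norm.
by rewrite /dot; have := h 0; have := h 1; have := h 2; lra.
Qed.

Lemma norm_le_dot (x : V) : `|x| ^+ 2 <= dot x x.
Proof.
have [->|x0] := eqVneq x 0.
  by rewrite normr0 expr0n/=; exact: dot_ge0.
have [] := mx_norm_neq0 (x := x); first by rewrite -[mx_norm x]/(`|x|) normr_eq0.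
move=> [i j]; rewrite -[mx_norm x]/(`|x|) /= (ord1 i) => ->.
rewrite real_normK ?num_real// /dot -!expr2.
have := sqr_ge0 (x ord0 0); have := sqr_ge0 (x ord0 1); have := sqr_ge0 (x ord0 2).
case: j => -[|[|[|j]]] //= hj.
- by rewrite (_ : Ordinal hj = 0); [lra|exact/val_inj].
- by rewrite (_ : Ordinal hj = 1); [lra|exact/val_inj].
- by rewrite (_ : Ordinal hj = 2); [lra|exact/val_inj].
Qed.

Lemma outside_open (M : R) : open [set x : V | M < `|x|].
Proof.
have -> : [set x : V | M < `|x|] = Num.norm @^-1` [set s | M < s] by [].
by apply: open_comp; [move=> x _; exact: norm_continuous|exact: open_gt].
Qed.

(** For the sup norm the exterior is a union of six open half spaces, one for each axis and sign.
    Each is convex, and two belonging to different axes meet. *)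
Lemma outside_connected (M : R) : connected [set x : V | M < `|x|].
Proof.
have [M0|M0] := ltP M 0.
  rewrite (_ : mkset _ = setT); first by apply: is_convex_connected.
  by apply/seteqP; split => // x _ /=; exact: lt_le_trans (normr_ge0 _).
pose H (i : 'I_3) (s : R) : set V := [set x | M < s * x ord0 i].
have cH i s : connected (H i s).
  apply: is_convex_connected => x y t; rewrite /H /= !mxE => x1 y1 t0 t1.
  have -> : s * (x ord0 i + t * (y ord0 i - x ord0 i)) =
      (1 - t) * (s * x ord0 i) + t * (s * y ord0 i) by ring.
  have h1 : (1 - t) * M <= (1 - t) * (s * x ord0 i) by rewrite ler_wpM2l ?subr_ge0// ltW.
  have [t00|t00] := eqVneq t 0; first by rewrite t00 subr0 mul1r mul0r addr0.
  have h2 : t * M < t * (s * y ord0 i) by rewrite ltr_pM2l// lt_def t00.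
  lra.
have HO (x : V) : M < `|x| -> exists i s, (s = 1 \/ s = -1) /\ H i s x.
  move=> Mx; apply: contrapT => nH.
  have : `|x| < `|x|; last by rewrite ltxx.
  apply: norm_lt_coord; first exact: le_lt_trans Mx.
  move=> i; apply: le_lt_trans Mx; rewrite leNgt; apply/negP => Mi; apply: nH.
  have [xi|xi] := leP 0 (x ord0 i).
  - by exists i, 1; split; [left|rewrite /H /= mul1r -(ger0_norm xi)].
  - by exists i, (-1); split; [right|rewrite /H /= mulN1r -(ltr0_norm xi)].
have OH i s x : (s = 1 \/ s = -1) -> H i s x -> M < `|x|.
  move=> s1 Hx; apply: (lt_le_trans Hx); apply: le_trans (coord_le_norm x i).
  apply: (le_trans (ler_norm _)); rewrite normrM.
  by case: s1 => ->; rewrite ?normrN normr1 mul1r.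
apply: open_split_connected => U W oU oW cov dis [x0 Mx0 Ux0].
have step i s : (s = 1 \/ s = -1) -> (exists2 x, H i s x & U x) -> forall x, H i s x -> U x.
  move=> s1 ex x Hx; apply: (@connected_open_split _ (H i s) U W) Hx => //.
  - by move=> y Hy; apply: cov; exact: OH Hy.
  - by move=> y Hy; apply: dis; exact: OH Hy.
have meet i s j t : i != j -> (s = 1 \/ s = -1) -> (t = 1 \/ t = -1) ->
    exists2 x, H i s x & H j t x.
  move=> ij s1 t1; exists (\row_k if k == i then s * (M + 1) else t * (M + 1)).
    by rewrite /H /= mxE eqxx mulrA; case: s1 => ->; lra.
  by rewrite /H /= mxE eq_sym (negbTE ij) mulrA; case: t1 => ->; lra.
have [i [s [s1 Hx0]]] := HO _ Mx0.
have Uis := step i s s1 (ex_intro2 _ _ x0 Hx0 Ux0).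
have Ujt j t : j != i -> (t = 1 \/ t = -1) -> forall x, H j t x -> U x.
  move=> ji t1; apply: step => //.
  by have [x Hx Hx'] := meet j t i s ji t1 s1; exists x => //; exact: Uis.
move=> y My; have [j [t [t1 Hy]]] := HO _ My.
have [ji|ji] := eqVneq j i; last exact: Ujt Hy.
have [k ki] : exists k : 'I_3, k != i.
  by case: (eqVneq i 0) => [->|]; [exists 1|exists 0; rewrite eq_sym].
apply: (step j t t1) Hy.
have jk : j != k by rewrite ji eq_sym.
by have [x Hx Hx'] := meet j t k 1 jk t1 (or_introl erefl); exists x => //; exact: (Ujt k 1 ki (or_introl erefl) _ Hx').
Qed.

End NormFacts.

Section Complement.
Variable R : realType.
Local Notation V := 'rV[R]_3.
Variable L : set V.
Hypothesis shellL : forall y, L y -> exists2 d : R, 0 < d & exists p q,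
  forall r, 0 < r -> r <= d -> shell L y [set s | 0 < s < r] p q.

(** Euclidean, with [r] the square of the radius, to match the parameter of the shells. *)
Definition qball (y : V) (r : R) : set V := [set x | dot (x - y) (x - y) < r].

Lemma qball_open y r : open (qball y r).
Proof.
have -> : qball y r = (fun x : V => dot (x - y) (x - y)) @^-1` [set s | s < r] by [].
apply: open_comp; last exact: open_lt.
move=> x _; have cz := cont_addv (cont_id x) (cont_cst (- y) x).
exact: (cont_dot cz cz).
Qed.

Lemma qball_center y r : 0 < r -> qball y r y.
Proof. by move=> r0; rewrite /qball /= subrr dot0l. Qed.

Lemma qball_in_nbhs y (B : set V) : nbhs y B -> exists2 r : R, 0 < r & qball y r `<=` B.
Proof.
move=> /nbhs_ballP[e /= e0 eB]; exists (e ^+ 2); first by rewrite exprn_gt0.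
move=> x yx; apply: eB; rewrite -ball_normE /ball_ /= distrC.
have := le_lt_trans (norm_le_dot _) yx.
by rewrite ltr_pXn2r// ?nnegrE// ltW.
Qed.

Lemma qball_off y r : L y -> qball y r `\` L = shell_set y [set s | 0 < s < r] `\` L.
Proof.
move=> Ly; apply/seteqP; split => x [xr Lx]; split => //.
- apply/andP; split => //; apply: dot_gt0 => /subr0_eq xy.
  by apply: Lx; rewrite xy.
- by have /andP[] := xr.
Qed.

Lemma compl_nonempty (C : set V) : open C -> C !=set0 -> C `\` L !=set0.
Proof.
move=> oC [y Cy]; have [Ly|nLy] := pselect (L y); last by exists y.
have [d d0 [p [q sh]]] := shellL Ly.
have [r r0 rC] := qball_in_nbhs (open_nbhs_nbhs (conj oC Cy)).
pose m := Num.min r d.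
have m0 : 0 < m by rewrite lt_min r0.
have md : m <= d by rewrite ge_min lexx orbT.
have [Psi [_ PsiL _]] := shell_cover (sh m m0 md).
have [/andP[_ Pm] PL] := PsiL 0.
exists (Psi 0); split => //; apply: rC; rewrite /qball /=.
by apply: (lt_le_trans Pm); rewrite ge_min lexx.
Qed.

(** A splitting of [C] minus [L] would extend to one of [C]: around a point of [L] a small ball
    minus [L] is a shell minus [L], hence connected and on one side. [ext] adds to a side the points
    of [L] so assigned to it. *)
Lemma compl_connected (C : set V) : open C -> connected C -> connected (C `\` L).
Proof.
move=> oC cC; apply: open_split_connected => U W oU oW cov dis [x0 [Cx0 Lx0] Ux0] y [Cy nLy].
have small (z : V) : C z -> L z -> exists2 r : R, 0 < r & qball z r `<=` C /\
    connected (qball z r `\` L).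
  move=> Cz Lz; have [d d0 [p [q sh]]] := shellL Lz.
  have [r r0 rC] := qball_in_nbhs (open_nbhs_nbhs (conj oC Cz)).
  pose m := Num.min r d.
  have m0 : 0 < m by rewrite lt_min r0.
  have md : m <= d by rewrite ge_min lexx orbT.
  exists m => //; split; last first.
    by rewrite qball_off//; apply: (shell_connected (sh m m0 md)).
  by apply: subset_trans rC => x /= /lt_le_trans; apply; rewrite ge_min lexx.
pose ext (O : set V) : set V :=
  [set z | exists2 r : R, 0 < r & forall w, qball z r w -> ~ L w -> C w /\ O w].
have ext_nbhs O : open O -> forall z, C z -> O z -> interior (ext O) z.
  move=> oO z Cz Oz.
  have oCO : open (C `&` O) by exact: openI.
  apply: (filterS _ (open_nbhs_nbhs (conj oCO (conj Cz Oz)))) => w COw.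
  have [r r0 rCO] := qball_in_nbhs (open_nbhs_nbhs (conj oCO COw)).
  by exists r => // u /rCO[].
have ext_open O : open O -> forall z, C z -> ext O z -> interior (ext O) z.
  move=> oO z Cz [r r0 rO].
  have nb : nbhs z (qball z r).
    by apply: open_nbhs_nbhs; split; [exact: qball_open|exact: qball_center].
  apply: filterS nb => w zw.
  have [m m0 mr] := qball_in_nbhs (open_nbhs_nbhs (conj (@qball_open z r) zw)).
  by exists m => // u /mr; exact: rO.
have key (z : V) : C z -> interior (ext U) z.
  apply: (@connected_open_split _ C (interior (ext U)) (interior (ext W))) => //.
  - exact: open_interior.
  - exact: open_interior.
  - move=> w Cw; have [Lw|nLw] := pselect (L w); last first.
      by case: (cov w (conj Cw nLw)) => ?; [left|right]; exact: ext_nbhs.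
    have [r r0 [rC cr]] := small w Cw Lw.
    have [v [wv nLv]] : qball w r `\` L !=set0.
      by apply: compl_nonempty; [exact: qball_open|exists w; exact: qball_center].
    have cov' O O' : open O -> open O' -> (forall x, (C `\` L) x -> O x \/ O' x) ->
        (forall x, (C `\` L) x -> O x -> O' x -> False) -> O v -> ext O w.
      move=> oO oO' c d Ov; exists r => // u wu nLu; split; first exact: rC.
      apply: (connected_open_split cr oO oO') (conj wu nLu).
      - by move=> x [/rC ? ?]; exact: c.
      - by move=> x [/rC ? ?]; exact: d.
      - by exists v.
    case: (cov v (conj (rC _ wv) nLv)) => Hv; [left|right]; apply: ext_open => //.
    + exact: (cov' U W).
    + apply: (cov' W U) => //; first by move=> x /cov[]; auto.
      by move=> x Cx Wx Ux; exact: (dis x).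
  - move=> w Cw /interior_subset[r r0 rU] /interior_subset[r' r'0 rW].
    have [v [[wv w'v] nLv]] : (qball w r `&` qball w r') `\` L !=set0.
      apply: compl_nonempty; first by apply: openI; exact: qball_open.
      by exists w; split; exact: qball_center.
    have [Cv Uv] := rU v wv nLv; have [_ Wv] := rW v w'v nLv.
    exact: (dis v).
  - by exists x0 => //; exact: ext_nbhs.
have /interior_subset[r r0 rU] := key y Cy.
by have [] := rU y (qball_center y r0) nLy.
Qed.

End Complement.

(** * Local homeomorphisms *)

Section LocalHomeo.
Variable R : realType.
Local Notation V := 'rV[R]_3.
Variable F : V -> V.

Definition local_section (x : V) (d : R) (s : V -> V) :=
  (forall w, ball (F x) d w -> {for w, continuous s} /\ F (s w) = w) /\ s (F x) = x.

Definition locally_invertible := forall x, exists2 d : R, 0 < d & exists s, local_section x d s.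

Definition locally_injective := forall x : V, exists2 U : set V, nbhs x U & {in U &, injective F}.

Hypotheses (cF : continuous F) (invF : locally_invertible) (injF : locally_injective).

Lemma section_near x d s : 0 < d -> local_section x d s -> \forall z \near x, s (F z) = z.
Proof.
move=> d0 [ls sx]; have Fx := ls _ (ballxx _ d0).
have c1 : {for x, continuous (fun z => s (F z))} by exact: (cont_comp (@cF x) Fx.1).
apply: (lift_agree_near injF c1 (cont_id x)); last by rewrite sx.
have : \forall z \near x, ball (F x) d (F z) by apply: cF; exact: nbhsx_ballx.
by apply: filterS => z /ls[].
Qed.

Lemma open_image (O : set V) : open O -> open (F @` O).
Proof.
move=> oO; rewrite openE => _ [x Ox <-]; have [d d0 [s [ls sx]]] := invF x.
have [cs _] := ls _ (ballxx _ d0).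
have h1 : \forall w \near F x, O (s w) by apply: cs; rewrite sx; exact: open_nbhs_nbhs.
have h2 : \forall w \near F x, ball (F x) d w by exact: nbhsx_ballx.
by apply: filterS2 h1 h2 => w Osw /ls[_ Fsw]; exists (s w).
Qed.

Variable L : set V.
Hypothesis LP : forall y, L y <-> forall e M : R, 0 < e -> exists x, M < `|x| /\ `|F x - y| < e.

Lemma proper_off y : ~ L y -> exists e M : R, 0 < e /\ forall x, `|F x - y| < e -> `|x| <= M.
Proof.
move=> nLy; apply: contrapT => nE; apply: nLy; apply/LP => e M e0.
apply: contrapT => nx; apply: nE; exists e, M; split => // x Fx.
by rewrite leNgt; apply/negP => Mx; apply: nx; exists x.
Qed.

(** Preimages of points near [y] stay in a compact ball, over which the radius of the local inverses
    can be chosen uniformly. So [F] is a covering off [L]. *)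
Lemma local_sections_off y : ~ L y -> exists2 d : R, 0 < d & forall x : V, ball y d (F x) ->
  exists2 s : V -> V, (forall w : V, ball y d w -> {for w, continuous s} /\ F (s w) = w) &
    s (F x) = x.
Proof.
move=> nLy; have [e [M [e0 eM]]] := proper_off nLy.
pose P (d : R) (x : V) := ball y d (F x) ->
  exists2 s : V -> V, (forall w : V, ball y d w -> {for w, continuous s} /\ F (s w) = w) &
    s (F x) = x.
have H : \forall d \near 0^'+, forall x : V, `|0 - x| <= M -> P d x.
  have /compact_near_coveringP h := @compact_norm_ball R 3 0 M.
  apply: h => x0 _; have [d d0 [s ls]] := invF x0.
  have [lls sx0] := ls.
  have n1 := section_near d0 ls.
  have n2 : \forall z \near x0, ball (F x0) (d / 3) (F z).
    by apply: cF; apply: nbhsx_ballx; rewrite divr_gt0.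
  exists ([set z | s (F z) = z /\ ball (F x0) (d / 3) (F z)], [set t | 0 < t < d / 3]).
    split; first by apply: filterS2 n1 n2 => z.
    near=> t; apply/andP; split; first by near: t; exact: nbhs_right_gt.
    by near: t; apply: nbhs_right_lt; rewrite divr_gt0.
  move=> [z t] /= [[sz Fz] /andP[t0 td]] yz; exists s => // w yw.
  apply: lls; move: yw yz Fz; rewrite -!ball_normE /ball_ /= => yw yz Fz.
  have -> : F x0 - w = (F x0 - F z) + ((F z - y) + (y - w)).
    by rewrite addrA subrKA subrKA.
  apply: (le_lt_trans (ler_normD _ _)).
  have h2 : `|F z - y + (y - w)| <= `|F z - y| + `|y - w| by exact: ler_normD.
  rewrite distrC in yz; lra.
have H2 : \forall d \near 0^'+, d < e by exact: nbhs_right_lt.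
have H3 : \forall d \near 0^'+, (0 : R) < d by exact: nbhs_right_gt.
have [d [[Hd de] d0]] : exists d : R, ((forall x : V, `|0 - x| <= M -> P d x) /\ d < e) /\ 0 < d.
  by apply: (@filter_ex _ (0^'+)%R); apply: filterI => //; exact: filterI.
exists d => // x yx; apply: Hd => //; rewrite sub0r normrN; apply: eM.
by move: yx; rewrite -ball_normE /ball_ /= distrC => /lt_trans; apply.
Unshelve. all: by end_near.
Qed.

Lemma proper_compact (K : set V) : compact K -> (forall y, K y -> ~ L y) ->
  exists M, forall x, K (F x) -> `|x| <= M.
Proof.
move=> cK KL; pose P (M : R) (y : V) := forall x, F x = y -> `|x| <= M.
have H : \forall M \near +oo%R, forall y, K y -> P M y.
  have /compact_near_coveringP h := cK.
  apply: h => y Ky; have [e [M [e0 eM]]] := proper_off (KL y Ky).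
  exists (ball y e, [set t | M < t]).
    by split; [exact: nbhsx_ballx|apply: nbhs_pinfty_gt; exact: num_real].
  move=> [z t] /= [yz Mt] x Fx; apply: ltW; apply: le_lt_trans Mt; apply: eM.
  by move: yz; rewrite Fx -ball_normE /ball_ /= distrC.
have [M HM] := @filter_ex _ (+oo%R) _ _ H.
by exists M => x Kx; exact: (HM (F x)).
Qed.

End LocalHomeo.

(** * The case where the preimage of the line is nonempty *)

Section BranchedCase.
Variable R : realType.
Local Notation V := 'rV[R]_3.
Variables (F : V -> V) (L : set V).
Hypotheses (cF : continuous F) (invF : locally_invertible F) (injF : locally_injective F).
Hypotheses (clL : closed L) (cL : connected L).
Hypothesis LP : forall y, L y <-> forall e M : R, 0 < e -> exists x, M < `|x| /\ `|F x - y| < e.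
Hypothesis shellL : forall y, L y -> exists2 d : R, 0 < d & exists p q,
  forall r, 0 < r -> r <= d -> shell L y [set s | 0 < s < r] p q.
Variable R0 : R.
Hypothesis R0_gt0 : 0 < R0.
Hypothesis shell_oo : exists p q, shell L 0 [set s | R0 < s] p q.

Let hV : hausdorff_space V. Proof. exact: norm_hausdorff. Qed.

Let shell_radius : {dl : V -> R & forall y, L y -> 0 < dl y /\ exists p q,
  forall r, 0 < r -> r <= dl y -> shell L y [set s | 0 < s < r] p q}.
Proof.
apply: (@choice V R (fun y d => L y -> 0 < d /\ exists p q,
  forall r, 0 < r -> r <= d -> shell L y [set s | 0 < s < r] p q)) => y.
have [Ly|] := pselect (L y); last by exists 0.
by have [d d0 h] := shellL Ly; exists d.
Qed.

Let dl := projT1 shell_radius.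
Let dlP : forall y, L y -> 0 < dl y /\ exists p q,
  forall r, 0 < r -> r <= dl y -> shell L y [set s | 0 < s < r] p q :=
  projT2 shell_radius.

(** In [overlap] a point is reached from [y] in three steps below [eta y], and [dot] is at most
    three times the squared sup norm. The two bounds give [3 * (3 * eta y) ^+ 2 <= 27 / 2 * eta y <
    dl y]. The bound 1/2 also keeps a ball that meets the patch at infinity outside the sup-norm
    ball of radius [R0 + 1]. *)
Let eta y := Num.min (2^-1) (dl y / 28).

Let eta_gt0 y : L y -> 0 < eta y.
Proof. by move=> /dlP[d0 _]; rewrite lt_min invr_gt0 ltr0n divr_gt0. Qed.

Let eta_half y : eta y <= 2^-1. Proof. by rewrite ge_min lexx. Qed.

Let eta_dl y (t : R) : L y -> 0 <= t -> t < 3 * eta y -> 3 * t ^+ 2 < dl y.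
Proof.
move=> Ly t0 t3; have [d0 _] := dlP Ly; have e0 := eta_gt0 Ly; have e2 := eta_half y.
have e3 : eta y <= dl y / 28 by rewrite ge_min lexx orbT.
have h1 : t ^+ 2 <= t * (3 * eta y) by rewrite expr2 ler_wpM2l// ltW.
have h2 : t * (3 * eta y) <= (3 * eta y) * (3 * eta y) by rewrite ler_wpM2r ?mulr_ge0// ltW.
have h3 : eta y * eta y <= 2^-1 * eta y by rewrite ler_wpM2r// ltW.
lra.
Qed.

(* Index [Some y] is a small neighbourhood of the point [y] of [L], [None] one of infinity. *)
Let valid (i : option V) : Prop := if i is Some y then L y else True.
Let nb (i : option V) : set V :=
  if i is Some y then ball y (eta y) else [set x | R0 + 2 < `|x|].
Let sh (i : option V) : set V :=
  if i is Some y then shell_set y [set s | 0 < s < dl y] else shell_set 0 [set s | R0 < s].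
Let big (i : option V) : set V :=
  if i is Some y then qball y (dl y) else [set x | R0 < dot x x].
Let center (i : option V) : V := if i is Some y then y else 0.

Let sh_big i x : valid i -> big i x -> x <> center i -> sh i x.
Proof.
case: i => [y|] vi; rewrite /big /sh /shell_set /=; last by rewrite subr0.
move=> h xy; apply/andP; split => //; apply: dot_gt0 => /subr0_eq; exact: xy.
Qed.

Let off_center i x : valid i -> big i x -> ~ L x -> x <> center i.
Proof.
case: i => [y|] /= vi bx nL e; first by apply: nL; rewrite e.
by move: bx; rewrite /big /= e dot0l ltNge ltW.
Qed.

Let nb_open i : open (nb i).
Proof.
case: i => [y|] /=; first exact: ball_open.
exact: outside_open.
Qed.

Let nb_connected i : connected (nb i).
Proof.
case: i => [y|] /=; last exact: outside_connected.
by apply: is_convex_connected; exact: ball_is_convex.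
Qed.

Let dot_lt (x y : V) (t d : R) : `|x - y| <= t -> 3 * t ^+ 2 < d -> dot (x - y) (x - y) < d.
Proof.
move=> xt td; apply: le_lt_trans td; apply: (le_trans (dot_le_norm _)).
by rewrite ler_wpM2l// ler_pXn2r ?nnegrE// (le_trans _ xt).
Qed.

(** [k] is the smaller of the two patches: a ball that meets another with larger [eta] lies within
    three times that [eta] of its centre, and a ball that meets the patch at infinity stays in
    [big None]. *)
Let overlap i j w : valid i -> valid j -> nb i w -> nb j w ->
  exists k, [/\ valid k, nb k w, nb k `<=` big i & nb k `<=` big j].
Proof.
have near1 y y' x : L y -> eta y' <= eta y -> ball y (eta y) w -> ball y' (eta y') w ->
    ball y' (eta y') x -> qball y (dl y) x.
  move=> Ly ee yw y'w y'x; apply: (@dot_lt _ _ `|x - y|) => //.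
  apply: eta_dl => //; move: yw y'w y'x; rewrite -!ball_normE /ball_ /=.
  have -> : x - y = (x - y') + ((y' - w) + (w - y)) by rewrite addrA subrKA subrKA.
  move=> h1 h2 h3; apply: (le_lt_trans (ler_normD _ _)).
  have h4 : `|(y' - w) + (w - y)| <= `|y' - w| + `|w - y| by exact: ler_normD.
  rewrite distrC in h1; rewrite distrC in h3; lra.
have self i' : valid i' -> nb i' `<=` big i'.
  case: i' => [y|] /= vi x.
    rewrite -ball_normE /ball_ /= distrC => h; apply: (@dot_lt _ _ `|x - y|) => //.
    by apply: eta_dl => //; have := eta_gt0 vi; lra.
  move=> h; apply: lt_le_trans (norm_le_dot _).
  have : (R0 + 2) ^+ 2 < `|x| ^+ 2 by rewrite ltr_pXn2r ?nnegrE ?normr_ge0//; have := R0_gt0; lra.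
  by have := sqr_ge0 R0; have := R0_gt0; rewrite sqrrD expr2 => *; lra.
have nearoo y : L y -> ball y (eta y) w -> nb None w -> nb (Some y) `<=` big None.
  move=> Ly yw ow x yx; rewrite /big /=; apply: lt_le_trans (norm_le_dot _).
  have : R0 + 1 < `|x|.
    move: yw ow yx; rewrite /nb /= -!ball_normE /ball_ /= => h1 h2 h3.
    have := eta_half y; have : `|w| <= `|x| + (`|y - x| + `|y - w|).
      have -> : `|w| = `|x + ((y - x) - (y - w))|.
        by rewrite opprB [y - x + _]addrC subrKA addrC subrK.
      apply: (le_trans (ler_normD _ _)); rewrite lerD2l; exact: ler_normB.
    lra.
  move=> h; have : (R0 + 1) ^+ 2 < `|x| ^+ 2 by rewrite ltr_pXn2r ?nnegrE ?normr_ge0//; have := R0_gt0; lra.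
  by have := sqr_ge0 R0; have := R0_gt0; rewrite sqrrD expr2 => *; lra.
case: i => [y|] vi; case: j => [y'|] vj iw jw.
- have [ee|/ltW ee] := leP (eta y') (eta y).
    exists (Some y'); split => //; last exact: self.
    by move=> x; exact: near1.
  exists (Some y); split => //; first exact: self.
  by move=> x; exact: near1.
- by exists (Some y); split => //; [exact: self|exact: nearoo].
- by exists (Some y'); split => //; [exact: nearoo|exact: self].
- by exists None; split => //; exact: self.
Qed.

(** Among three points of one strand, one avoids [z1] and [z2]. A centre has to be avoided because
    it lies in no shell around itself. *)
Let pick_on_strand k z1 z2 : valid k -> exists y, [/\ L y, nb k y, y <> z1 & y <> z2].
Proof.
move=> vk.
have [u [u012 u01 u02 u12]] : exists u : nat -> V, [/\ forall n, L (u n) /\ nb k (u n), u 0%N <> u 1%N,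
    u 0%N <> u 2%N & u 1%N <> u 2%N].
  have gen (a : V) (I : set R) p q (c : nat -> R) : shell L a I p q -> (forall n, I (c n)) ->
      (forall n, nb k (a + p (c n))) -> c 0%N <> c 1%N -> c 0%N <> c 2%N -> c 1%N <> c 2%N ->
      exists u : nat -> V, [/\ forall n, L (u n) /\ nb k (u n), u 0%N <> u 1%N,
        u 0%N <> u 2%N & u 1%N <> u 2%N].
    move=> s Ic nc c01 c02 c12; exists (fun n => a + p (c n)).
    have pc n : dot (a + p (c n) - a) (a + p (c n) - a) = c n.
      by rewrite [a + _]addrC addrK (shell_norm1 s).
    have inj n m : a + p (c n) = a + p (c m) -> c n = c m by move=> e; rewrite -(pc n) e pc.
    split; [|by move/inj|by move/inj|by move/inj].
    by move=> n; split => //; rewrite (shell_in s) pc//; left.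
  case: k vk gen => [y|] /= vk gen.
  - have [d0 [p [q s]]] := dlP vk.
    have [m m0 mb] := qball_in_nbhs (nbhsx_ballx y _ (eta_gt0 vk)).
    pose r := Num.min m (dl y).
    have r0 : 0 < r by rewrite lt_min m0.
    have rd : r <= dl y by rewrite ge_min lexx orbT.
    have cI n : 0 < r / (n.+2)%:R < r.
      by rewrite divr_gt0// ltr_pdivrMr// ltr_pMr// ltr1n.
    apply: (gen y _ p q (fun n => r / (n.+2)%:R) (s r r0 rd)) => //.
    + move=> n; apply: mb; rewrite /qball /= [y + _]addrC addrK.
      rewrite (shell_norm1 (s r r0 rd)); last exact: cI.
      have /andP[_ h] := cI n; apply: lt_le_trans h _; by rewrite ge_min lexx.
    + by lra.
    + by lra.
    + by lra.
  - have [p [q s]] := shell_oo.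
    pose c (n : nat) : R := 3 * (R0 + 2) ^+ 2 + n.+1%:R.
    have cR n : R0 < c n.
      have : 0 <= R0 ^+ 2 by exact: sqr_ge0.
      have : (0 : R) < n.+1%:R by rewrite ltr0n.
      rewrite /c sqrrD !expr2 => h1 h2; have := R0_gt0; lra.
    apply: (gen 0 _ p q c s cR) => //; try (by rewrite /c => h; lra).
    move=> n; rewrite add0r ltNge; apply/negP => h.
    have := dot_le_norm (p (c n)); rewrite (shell_norm1 s (cR n)).
    have : `|p (c n)| ^+ 2 <= (R0 + 2) ^+ 2 by rewrite ler_pXn2r ?nnegrE ?normr_ge0//; have := R0_gt0; lra.
    have : (0 : R) < n.+1%:R by rewrite ltr0n.
    rewrite /c; lra.
have good n : u n <> z1 -> u n <> z2 -> exists y, [/\ L y, nb k y, y <> z1 & y <> z2].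
  by move=> h1 h2; exists (u n); have [] := u012 n.
have [e0|n0] := pselect (u 0%N = z1).
  have n1 : u 1%N <> z1 by move=> e; apply: u01; rewrite e0.
  have n2 : u 2%N <> z1 by move=> e; apply: u02; rewrite e0.
  have [e1|] := pselect (u 1%N = z2); last exact: (good 1%N).
  by apply: (good 2%N) => // e; apply: u12; rewrite e1.
have [e0|] := pselect (u 0%N = z2); last exact: (good 0%N).
have n1 : u 1%N <> z2 by move=> e; apply: u01; rewrite e0.
have n2 : u 2%N <> z2 by move=> e; apply: u02; rewrite e0.
have [e1|] := pselect (u 1%N = z1); last by move=> h; exact: (good 1%N).
by apply: (good 2%N) => // e; apply: u12; rewrite e1.
Qed.

Let locL := local_sections_off cF invF injF LP.

Let extend i y B s : valid i -> L y -> sh i y -> nbhs y B -> section_on F L B s ->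
  exists2 S, section_on F L (sh i) S &
    exists2 B' : set V, nbhs y B' & forall w, B' w -> ~ L w -> S w = s w.
Proof.
have gen (a : V) I p q : shell L a I p q -> L y -> shell_set a I y -> nbhs y B ->
    section_on F L B s -> exists2 S, section_on F L (shell_set a I) S &
    exists2 B' : set V, nbhs y B' & forall w, B' w -> ~ L w -> S w = s w.
  move=> hs Ly Iy nB sB; have := Ly; rewrite (shell_in hs)// => -[e|e].
  - by rewrite e in nB *; apply: (shell_section hV injF clL locL hs Iy nB sB).
  - by rewrite e in nB *; apply: (shell_section hV injF clL locL (shell_sym hs) Iy nB sB).
case: i => [z|] /= vi Ly yi nB sB.
- have [d0 [p [q s']]] := dlP vi.
  exact: (gen z _ p q (s' _ d0 (lexx _))).
- have [p [q s']] := shell_oo; exact: (gen 0 _ p q s').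
Qed.

Let cDL C : open C -> connected C -> connected (C `\` L).
Proof. by move=> oC cC; apply: compl_connected. Qed.

Let ball_connected (c : V) r : connected (ball c r).
Proof. by apply: is_convex_connected; exact: ball_is_convex. Qed.

Let ball_opn (c : V) r : open (ball c r). Proof. exact: ball_open. Qed.

Let sections_agree C s s' z : open C -> connected C -> section_on F L C s ->
  section_on F L C s' -> C z -> ~ L z -> s z = s' z -> forall w, C w -> ~ L w -> s w = s' w.
Proof.
move=> oC cC ls ls' Cz nLz e w Cw nLw.
apply: (lift_unique hV injF (cDL oC cC) _ _ _ (conj Cz nLz) e (conj Cw nLw)).
- by move=> v [Cv Lv]; have [] := ls v Cv Lv.
- by move=> v [Cv Lv]; have [] := ls' v Cv Lv.
- move=> v Cv; have oCL : open (C `\` L) by apply: openI => //; exact: closed_openC.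
  apply: (filterS _ (open_nbhs_nbhs (conj oCL Cv))) => u [Cu Lu].
  by have [_ ->] := ls u Cu Lu; have [_ ->] := ls' u Cu Lu.
Qed.

(* [trivial x i]: the sheet of [F] through [x] has degree one over the patch [i]. *)
Let trivial x i := [/\ valid i, nb i (F x), ~ L (F x) &
  exists2 S, section_on F L (sh i) S & S (F x) = x].

(** The germ of [s] at a point of [L] in [nb k], other than the centre of [j], spreads over the
    shell of [j]. The result agrees with [s] on all of [nb k] off [L], which is connected, hence
    also at [F x]. *)
Let trivial_from k j x s : valid k -> valid j -> nb k (F x) -> nb j (F x) -> ~ L (F x) ->
  nb k `<=` big j -> section_on F L (nb k) s -> s (F x) = x -> trivial x j.
Proof.
move=> vk vj kx jx nLx kj lk sx; split => //.
have [y [Ly ky yj _]] := pick_on_strand (center j) 0 vk.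
have [||S lS [B nB SB]] := @extend j y (nb k) s vj Ly _ _ lk.
- by apply: sh_big => //; exact: kj.
- by apply: open_nbhs_nbhs; split => //; exact: nb_open.
exists S => //; rewrite -[RHS]sx.
have oBk : open (interior B `&` nb k) by apply: openI; [exact: open_interior|exact: nb_open].
have [z [[Bz kz] nLz]] := @compl_nonempty _ _ shellL _ oBk (ex_intro _ y (conj nB ky)).
have lSk : section_on F L (nb k) S.
  move=> w kw nLw; apply: lS => //; apply: sh_big => //; first exact: kj.
  by apply: off_center => //; exact: kj.
have e := SB z (interior_subset Bz) nLz.
exact: (sections_agree (@nb_open k) (@nb_connected k) lSk lk kz nLz e kx nLx).
Qed.

Let trivial_change i j x : trivial x i -> valid j -> nb j (F x) -> trivial x j.
Proof.
move=> [vi ix nLx [S lS Sx]] vj jx.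
have [k [vk kx ki kj]] := overlap vi vj ix jx.
apply: (@trivial_from k j x S) => // w kw nLw; apply: lS => //.
by apply: sh_big => //; [exact: ki|apply: off_center => //; exact: ki].
Qed.

Let N : set V := \bigcup_(i in valid) nb i.

Let N_open : open N. Proof. by apply: bigcup_open => i _; exact: nb_open. Qed.

Let L_N y : L y -> N y.
Proof. by move=> Ly; exists (Some y) => //; apply: ballxx; exact: eta_gt0. Qed.

Hypothesis L_meets : exists x0, L (F x0).

Let N_connected : connected N.
Proof.
have [x0 Lx0] := L_meets.
have -> : N = \bigcup_(i in valid) (L `|` nb i).
  apply/seteqP; split => x [i vi ix]; first by exists i => //; right.
  by case: ix => [/L_N//|ix]; exists i.
apply: bigcup_connected; first by exists (F x0) => i _; left.
move=> i vi; have [y [Ly iy _ _]] := pick_on_strand 0 0 vi.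
exact: (connectedU (ex_intro _ y (conj Ly iy)) cL (@nb_connected i)).
Qed.

Let proper_compl : exists M, forall x, M < `|x| -> N (F x).
Proof.
have cN : compact (~` N).
  apply: (subclosed_compact (open_closedC N_open) (@compact_norm_ball R 3 0 (R0 + 2))).
  move=> x nNx; rewrite /= sub0r normrN leNgt; apply/negP => h; apply: nNx.
  by exists None.
have [M MP] := proper_compact LP cN (fun y nNy Ly => nNy (L_N Ly)).
exists M => x Mx; apply: contrapT => /MP; rewrite leNgt; exact/negP/negPn.
Qed.

(* A bounded piece of [F^-1(N)] would map onto [N], which is unbounded. *)
Let no_bounded_piece (O O' : set V) (M : R) : open O -> open O' ->
  (forall x, N (F x) -> O x \/ O' x) -> (forall x, O x -> O' x -> False) ->
  (forall x, O x -> N (F x)) -> (forall x, O x -> `|x| <= M) -> forall x, ~ O x.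
Proof.
move=> oO oO' cov dis ON OM x Ox.
have ccl : compact (closure O).
  apply: (subclosed_compact (@closed_closure _ O) (@compact_norm_ball R 3 0 M)).
  have h : closed [set w : V | `|0 - w| <= M] by exact: closed_norm_ball.
  rewrite [X in _ `<=` X](closure_id _).1//; apply: closure_subset => z Oz /=.
  by rewrite sub0r normrN; exact: OM.
have cK : compact (F @` closure O) by apply: continuous_compact => //; exact: continuous_subspaceT.
have oK : open (~` (F @` closure O)).
  by apply: closed_openC; apply: compact_closed => //; exact: hV.
have sub y : N y -> (F @` O) y.
  apply: (connected_open_split N_connected (open_image invF oO) oK).
  - move=> z Nz; have [[v clv vz]|] := pselect ((F @` closure O) z); last by right.
    left; exists v => //; rewrite -vz in Nz; case: (cov v Nz) => // O'v.
    have [u [Ou O'u]] := clv _ (open_nbhs_nbhs (conj oO' O'v)).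
    by case: (dis u).
  - by move=> z _ [v Ov vz]; apply; exists v => //; exact: subset_closure.
  - by exists (F x); [exact: ON|exists x].
have [B [_ BP]] := compact_bounded cK.
pose M2 := Num.max (B + 1) (R0 + 3).
pose z : V := const_mx M2.
have Mz : M2 <= `|z|.
  by apply: le_trans (coord_le_norm z 0); rewrite mxE ler_norm.
have Nz : N z.
  exists None => //=; apply: lt_le_trans Mz; rewrite lt_max; apply/orP; right; lra.
have [v Ov vz] := sub z Nz.
have : `|z| <= B + 2^-1.
  apply: BP; first lra.
  by exists v => //; exact: subset_closure.
have : B + 1 <= M2 by rewrite le_max lexx.
lra.
Qed.

Let section_eq_near S x A : section_on F L A S -> open A -> A (F x) -> ~ L (F x) ->
  S (F x) = x -> \forall z \near x, S (F z) = z.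
Proof.
move=> lS oA Ax nLx Sx; have [cS _] := lS _ Ax nLx.
have c1 : {for x, continuous (fun z => S (F z))} by exact: (cont_comp (@cF x) cS).
apply: (lift_agree_near injF c1 (cont_id x)); last by rewrite Sx.
have oAL : open (A `\` L) by apply: openI => //; exact: closed_openC.
have : \forall z \near x, (A `\` L) (F z) by apply: cF; exact: open_nbhs_nbhs.
by apply: filterS => z [Az nLz]; have [] := lS _ Az nLz.
Qed.

(** The points over [N] split into two open sets: [V1], over [L] or with trivial sheet, and [V2]. By
    [proper_compl] both together contain the exterior of a ball, which is connected, so one of them
    is bounded and hence empty. [V1] contains the points over [L], so [V2] is the empty one. *)
Let all_trivial x i : valid i -> nb i (F x) -> ~ L (F x) -> trivial x i.
Proof.
pose W1 : set V := [set x | exists i, trivial x i].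
pose V1 : set V := [set x | N (F x) /\ (L (F x) \/ W1 x)].
pose V2 : set V := [set x | [/\ N (F x), ~ L (F x) & ~ W1 x]].
(* At a point over [L] a local inverse of [F] is a section on a full ball, across [L]. Spread from a
   point of [L] other than [F z], it shows the sheet to be trivial in the whole shell about
   [F z]. *)
have near_L z : L (F z) -> \forall u \near z, V1 u.
  move=> Lz; have [d d0 [s ls]] := invF z; have [lls sz] := ls.
  have e0 := eta_gt0 Lz.
  pose m := Num.min d (eta (F z)).
  have m0 : 0 < m by rewrite lt_min d0.
  have h1 := section_near cF injF d0 ls.
  have h2 : \forall u \near z, ball (F z) m (F u) by apply: cF; exact: nbhsx_ballx.
  apply: filterS2 h1 h2 => u su mu.
  have nu : nb (Some (F z)) (F u).
    by rewrite /nb; apply: le_ball mu; rewrite ge_min lexx orbT.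
  split; first by exists (Some (F z)).
  have [Lu|nLu] := pselect (L (F u)); [by left|right; exists (Some (F z))].
  have lsm : section_on F L (ball (F z) m) s.
    by move=> w mw _; apply: lls; apply: le_ball mw; rewrite ge_min lexx.
  split => //.
  have [y [Ly ky]] : exists y, [/\ L y, ball (F z) m y & y <> F z].
    have [_ [p [q hs]]] := dlP Lz; have [d1 _] := dlP Lz.
    have [r r0 rb] := qball_in_nbhs (nbhsx_ballx (F z) _ m0).
    pose t := Num.min r (dl (F z)).
    have t0 : 0 < t by rewrite lt_min r0.
    have td : t <= dl (F z) by rewrite ge_min lexx orbT.
    have s' := hs t t0 td; have It : 0 < t / 2 < t by rewrite divr_gt0// ltr_pdivrMr// ltr_pMr// ltr1n.
    have pc : dot (F z + p (t / 2) - F z) (F z + p (t / 2) - F z) = t / 2.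
      by rewrite [F z + _]addrC addrK (shell_norm1 s').
    exists (F z + p (t / 2)); split.
    - by rewrite (shell_in s') pc//; left.
    - apply: rb; rewrite /qball /= pc; have /andP[_ h] := It.
      by apply: lt_le_trans h _; rewrite ge_min lexx.
    - by move=> e; move: pc; rewrite e subrr dot0l => h; case/andP: It; rewrite -h ltxx.
  move=> yz.
  have by_ : big (Some (F z)) y.
    rewrite /big; apply: (@dot_lt _ _ `|y - F z|) => //; apply: eta_dl => //.
    have : ball (F z) (eta (F z)) y by apply: le_ball ky; rewrite ge_min lexx orbT.
    by rewrite -ball_normE /ball_ /= distrC => h; lra.
  have [||S lS [B nB SB]] := @extend (Some (F z)) y (ball (F z) m) s Lz Ly _ _ lsm.
  - exact: sh_big.
  - by apply: open_nbhs_nbhs; split => //; exact: ball_open.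
  exists S => //; rewrite -[RHS]su.
  have oBk : open (interior B `&` ball (F z) m) by apply: openI; [exact: open_interior|exact: ball_open].
  have [v [[Bv kv] nLv]] := @compl_nonempty _ _ shellL _ oBk (ex_intro _ y (conj nB ky)).
  have lSm : section_on F L (ball (F z) m) S.
    move=> w mw nLw; apply: lS => //.
    have bw : big (Some (F z)) w.
      rewrite /big; apply: (@dot_lt _ _ `|w - F z|) => //; apply: eta_dl => //.
      have : ball (F z) (eta (F z)) w by apply: le_ball mw; rewrite ge_min lexx orbT.
      by rewrite -ball_normE /ball_ /= distrC => h; lra.
    by apply: sh_big => //; exact: off_center.
  have e := SB v (interior_subset Bv) nLv.
  exact: (sections_agree (@ball_opn _ _) (@ball_connected _ _) lSm lsm kv nLv e mu nLu).
have sh_open i' : valid i' -> open (sh i').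
  case: i' => [y|] vi /=; apply: shell_set_open.
    by have [d0 [p [q hs]]] := dlP vi; exact: (shell_open (hs _ d0 (lexx _))).
  by have [p [q hs]] := shell_oo; exact: (shell_open hs).
have sh_nb i' z : valid i' -> nb i' z -> ~ L z -> sh i' z.
  move=> vi iz nLz; have [k [vk kz ki _]] := overlap vi vi iz iz.
  by apply: sh_big => //; [exact: ki|apply: off_center => //; exact: ki].
have nb_off i' z : valid i' -> nb i' (F z) -> ~ L (F z) -> \forall u \near z, nb i' (F u) /\ ~ L (F u).
  move=> vi iz nLz; have h : nbhs (F z) (nb i' `\` L).
    apply: open_nbhs_nbhs; split => //.
    by apply: openI; [exact: nb_open|exact: closed_openC].
  exact: (@cF z _ h).
have oV1 : open V1.
  rewrite openE => z [Nz [Lz|[i' [vi iz nLz [S lS Sz]]]]]; first exact: near_L.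
  have h1 := section_eq_near lS (sh_open _ vi) (sh_nb _ _ vi iz nLz) nLz Sz.
  apply: filterS2 h1 (nb_off _ _ vi iz nLz) => u Su [iu nLu].
  by split; [exists i'|right; exists i'; split => //; exists S].
have oV2 : open V2.
  rewrite openE => z [Nz nLz nWz]; have [i' vi iz] := Nz.
  have [d d0 [s ls]] := invF z; have [lls sz] := ls.
  have h1 := section_near cF injF d0 ls.
  have [r r0 rP] : exists2 r, 0 < r & ball (F z) r `<=` ball (F z) d `&` (nb i' `\` L).
    have : nbhs (F z) (ball (F z) d `&` (nb i' `\` L)).
      apply: filterI; first exact: nbhsx_ballx.
      apply: open_nbhs_nbhs; split => //.
      by apply: openI; [exact: nb_open|exact: closed_openC].
    by move=> /nbhs_ballP[r /= r0 h]; exists r.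
  have h2 : \forall u \near z, ball (F z) r (F u) by apply: cF; exact: nbhsx_ballx.
  apply: filterS2 h1 h2 => u su ru; have [_ [iu nLu]] := rP _ ru.
  split => //; first by exists i'.
  move=> [j tj]; apply: nWz; exists i'.
  have [_ _ _ [S lS Su]] := trivial_change tj vi iu.
  split => //; exists S => //; rewrite -[RHS]sz.
  have lSr : section_on F L (ball (F z) r) S.
    by move=> w /rP[_ [iw _]] nLw; apply: lS => //; exact: sh_nb.
  have lsr : section_on F L (ball (F z) r) s by move=> w /rP[dw _] _; exact: lls.
  have e : S (F u) = s (F u) by rewrite Su su.
  exact: (sections_agree (@ball_opn _ _) (@ball_connected _ _) lSr lsr ru nLu e
    (ballxx _ r0) nLz).
have cov z : N (F z) -> V1 z \/ V2 z.
  move=> Nz; have [Lz|nLz] := pselect (L (F z)); first by left; split => //; left.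
  by have [Wz|nWz] := pselect (W1 z); [left; split => //; right|right].
have dis z : V1 z -> V2 z -> False by move=> [_ [Lz|Wz]] [_ nL nW].
move=> vi ix nLx; apply: contrapT => nt.
have V2x : V2 x.
  split => //; first by exists i.
  by move=> [j tj]; apply: nt; exact: trivial_change tj vi ix.
have [x0 Lx0] := L_meets; have V1x0 : V1 x0 by split; [exact: L_N|left].
have [M MN] := proper_compl.
have [[z Mz V1z]|nz] := pselect (exists2 z, M < `|z| & V1 z).
- apply: (@no_bounded_piece V2 V1 M) V2x => //.
  + by move=> w /cov[]; auto.
  + by move=> w ? ?; exact: (dis w).
  + by move=> w [].
  + move=> w V2w; rewrite leNgt; apply/negP => Mw.
    have : V1 w; last by move/(dis w); apply.
    apply: (connected_open_split (@outside_connected R M) oV1 oV2) Mw.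
    * by move=> u Mu; apply: cov; exact: MN.
    * by move=> u _; exact: dis.
    * by exists z.
- apply: (@no_bounded_piece V1 V2 M) V1x0 => //.
  + by move=> w [].
  + by move=> w V1w; rewrite leNgt; apply/negP => Mw; apply: nz; exists w.
Qed.

Theorem branched_case : False.
Proof.
have [x0 Lx0] := L_meets.
have oFL (O : set V) : open O -> O !=set0 -> exists2 z, O z & ~ L (F z).
  move=> oO [z Oz].
  have [w [[v Ov <-] nL]] := @compl_nonempty _ _ shellL _ (open_image invF oO) (ex_intro _ (F z) (ex_intro2 _ _ z Oz erefl)).
  by exists v.
have [xh _ nLxh] := oFL setT openT (ex_intro _ x0 I).
have [S lS Sx] : exists2 S, section_on F L setT S & S (F xh) = xh.
  apply: (lift_global hV injF clL) => //.
  - by move=> C oC /is_convex_connected; exact: cDL.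
  - by move=> C; exact: compl_nonempty.
  - move=> y; have [Ly|nLy] := pselect (L y); last first.
      have [d d0 dP] := locL nLy; exists d => // z x yz _ Fx; rewrite -Fx in yz.
      by have [s ls sx] := dP x yz; exists s; [move=> w yw _; exact: ls|rewrite -Fx].
    exists (eta y); first exact: eta_gt0.
    move=> z x yz nLz Fx; rewrite -Fx in yz nLz.
    have [_ _ _ [S lS Sx]] := @all_trivial x (Some y) Ly yz nLz.
    exists S; last by rewrite -Fx.
    move=> w yw nLw; apply: lS => //.
    have [k [vk kz ki _]] := @overlap (Some y) (Some y) w Ly Ly yw yw.
    by apply: sh_big => //; [exact: ki|apply: off_center => //; exact: ki].
(* The domain is connected and the preimage of [L] has no interior, so agreement at [xh] propagates:
   [F] is injective off the preimage of [L]. *)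
have SF x : ~ L (F x) -> S (F x) = x.
  pose V1 : set V := [set x | ~ L (F x) -> S (F x) = x].
  pose V2 : set V := [set x | ~ L (F x) -> S (F x) <> x].
  have key (z : V) : (\forall u \near z, V1 u) \/ (\forall u \near z, V2 u).
    have [d d0 [s ls]] := invF z; have [lls sz] := ls.
    have h1 := section_near cF injF d0 ls.
    have h2 : \forall u \near z, ball (F z) d (F u) by apply: cF; exact: nbhsx_ballx.
    have agree w w' : ball (F z) d w -> ball (F z) d w' -> ~ L w -> ~ L w' ->
        S w = s w -> S w' = s w'.
      move=> dw dw' nLw nLw' e.
      have lSd : section_on F L (ball (F z) d) S by move=> v _; exact: lS.
      have lsd : section_on F L (ball (F z) d) s by move=> v dv _; exact: lls.
      exact: (sections_agree (@ball_opn _ _) (@ball_connected _ _) lSd lsd dw nLw e dw' nLw').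
    have [[w [dw nLw] e]|ne] := pselect (exists2 w, ball (F z) d w /\ ~ L w & S w = s w).
    - left; apply: filterS2 h1 h2 => u su du nLu.
      by rewrite (agree w (F u)).
    - right; apply: filterS2 h1 h2 => u su du nLu e.
      by apply: ne; exists (F u) => //; rewrite e su.
  have V1all : forall z, interior V1 z.
    move=> z; apply: (@connected_open_split _ setT (interior V1) (interior V2)) => //.
    - by apply: is_convex_connected.
    - exact: open_interior.
    - exact: open_interior.
    - by move=> w _; exact: key.
    - move=> w _ i1 i2.
      have o12 : open (interior V1 `&` interior V2) by apply: openI; exact: open_interior.
      have [v [/interior_subset v1 /interior_subset v2] nLv] := oFL _ o12 (ex_intro _ w (conj i1 i2)).
      exact: v2 (v1 nLv).
    - exists xh => //; case: (key xh) => // /nbhs_singleton h.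
      by case: (h nLxh).
  exact: interior_subset (V1all x).
have [d d0 [s [ls sx0]]] := invF x0.
have : \forall x \near x0, ball (F x0) d (F x) /\ ball x0 1 x.
  have h1 : \forall x \near x0, ball (F x0) d (F x) by apply: cF; exact: nbhsx_ballx.
  by apply: filterI h1 _; exact: nbhsx_ballx.
move=> /nbhs_interior n0; set O := interior _ in n0.
have oO : open O by exact: open_interior.
have : nbhs (F x0) (F @` O).
  apply: open_nbhs_nbhs; split; first exact: open_image.
  by exists x0 => //; exact: nbhs_singleton n0.
move=> /nbhs_ballP[r /= r0 rO].
(* Non-properness gives a far point with value close to [F x0]. That value is also taken near [x0],
   and after a perturbation off [L] this violates injectivity. *)
have [x [Mx Fx]] := (LP (F x0)).1 Lx0 r (`|x0| + 1) r0.
have [z [Mz rz] nLz] : exists2 z, `|x0| + 1 < `|z| /\ ball (F x0) r (F z) & ~ L (F z).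
  apply: oFL.
    apply: (openI (@outside_open R (`|x0| + 1))).
    by apply: open_comp; [move=> u _; exact: cF|exact: ball_open].
  by exists x; split => //; rewrite /= -ball_normE /ball_ /= distrC.
have [u Ou Fu] := rO _ rz.
have uz : u = z by rewrite -(SF z nLz) -Fu SF// Fu.
have [_] := interior_subset Ou; rewrite uz -ball_normE /ball_ /= => h.
have : `|z| <= `|x0| + `|x0 - z|.
  by rewrite -{1}[z](subKr x0); exact: ler_normB.
lra.
Qed.

End BranchedCase.

(** * Polynomial curves in the set of non-properness *)

Section Nonproper.
Variables (R : realType) (F : 'rV[R]_3 -> 'rV[R]_3).
Let V := 'rV[R]_3.

Lemma nonproper_setP (y : V) : nonproper_set F y <->
  forall e M : R, 0 < e -> exists x : V, M < `|x| /\ `|F x - y| < e.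
Proof.
split=> [[x [ubx cvx]] e M e0|h].
  have : \forall k \near \oo, `|F (x k) - y| < e.
    by move: cvx => /cvgrPdist_lt /(_ e e0); apply: filterS => k /=; rewrite distrC.
  case=> N _ hN.
  have [k hk] := ubx (Num.max M (\big[Num.max/0]_(j < N) `|x j|)).
  exists (x k); move: hk; rewrite gt_max => /andP[-> hk]; split=> //.
  apply: hN; rewrite /= leqNgt; apply/negP => kN.
  have := le_bigmax 0 (fun j : 'I_N => `|x j|) (Ordinal kN).
  by rewrite leNgt /= hk.
have /choice[x hx] (k : nat) : exists x : V, k%:R < `|x| /\ `|F x - y| < k.+1%:R^-1.
  by apply: h; rewrite invr_gt0.
exists x; split=> [M|].
  have [k Mk] : exists k : nat, M < k%:R.
    by exists (Num.truncn M).+1; rewrite truncnS_gt.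
  by exists k; apply: lt_trans Mk _; have [] := hx k.
apply/cvgrPdist_lt => e e0.
have := near_infty_natSinv_lt (PosNum e0); apply: filterS => k /= ke.
by rewrite distrC; apply: lt_trans ke; have [] := hx k.
Qed.

End Nonproper.

Section Curve.
Variables (R : realType) (F : 'rV[R]_3 -> 'rV[R]_3).
Let V := 'rV[R]_3.
Let e0 : V := delta_mx 0 0.

(** One direction of lines suffices: local injectivity makes every restriction nonconstant. What
    matters is that [D] is the same for all lines. *)
Definition polynomial_on_lines (D : nat) := forall (x : V) (i : 'I_3), exists2 p : {poly R},
    (size p <= D.+1)%N & forall t, p.[t] = F (x + t *: e0) ord0 i.

Lemma polynomial_map_on_lines : polynomial_map3 F -> exists D, polynomial_on_lines D.
Proof.
move=> pF; have /choice[D hD] (i : 'I_3) : exists D : nat, forall x : V, exists2 p : {poly R},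
    (size p <= D.+1)%N & forall t, p.[t] = F (x + t *: e0) ord0 i.
  have [s hs] := pF i; exists (\max_(m <- s) m.2.1.1)%N => x.
  exists (\sum_(m <- s) (m.1 * (x ord0 1 ^+ m.2.1.2 * x ord0 2 ^+ m.2.2)) *:
    ('X + (x ord0 0)%:P) ^+ m.2.1.1).
    rewrite big_seq; apply: (leq_trans (size_sum _ _ _)); apply/bigmax_leqP_seq => m ms _.
    apply: leq_trans (size_scale_leq _ _) _.
    apply: leq_trans (size_poly_exp_leq _ _) _.
    by rewrite size_XaddC mul1n ltnS; apply: (@leq_bigmax_seq _ _ xpredT (fun m => m.2.1.1)).
  move=> t; rewrite horner_sum hs; apply: eq_bigr => m _.
  rewrite hornerZ horner_exp hornerD hornerX hornerC !mxE !eqxx /= !mulr0 !mulr1 !addr0.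
  move: (x ord0 1 ^+ _) (x ord0 2 ^+ _) => b c; rewrite (addrC t).
  by move: ((x ord0 0 + t) ^+ _) => a; ring.
exists (\max_i D i)%N => x i; have [p sp hp] := hD i x; exists p => //.
by apply: leq_trans sp _; rewrite ltnS; apply: (leq_bigmax i).
Qed.

Lemma cont_sum (T : topologicalType) (I : Type) (r : seq I) (f : I -> T -> R) (z : T) :
  (forall i, {for z, continuous (f i)}) -> {for z, continuous (fun x => \sum_(i <- r) f i x)}.
Proof.
move=> cf; elim: r => [|i r IH].
  rewrite (_ : (fun x => _) = fun=> 0); first exact: cont_cst.
  by apply: funext => x; rewrite big_nil.
rewrite (_ : (fun x => _) = fun x => f i x + \sum_(j <- r) f j x); first exact: (cont_add (cf i) IH).
by apply: funext => x; rewrite big_cons.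
Qed.

(** The sum is a polynomial in [lam] that vanishes at 0. With [c] the modulus of a leading
    coefficient of positive degree, it is at least [c * (1 + c^-1) >= 1] at [1 + c^-1]. *)
Lemma unit_weight (D : nat) (p : 'I_3 -> {poly R}) :
  (forall i, (size (p i) <= D.+1)%N) -> (exists i, (1 < size (p i))%N) ->
  exists2 lam : R, 0 < lam & \sum_i \sum_(m < D) `|(p i)`_m.+1 * lam ^+ m.+1| = 1.
Proof.
move=> sp [i si].
pose Q : {poly R} := \sum_j \sum_(m < D) (`|(p j)`_m.+1|%:P * 'X^(m.+1)).
have QE lam : 0 <= lam -> Q.[lam] = \sum_j \sum_(m < D) `|(p j)`_m.+1 * lam ^+ m.+1|.
  move=> lam0; rewrite horner_sum; apply: eq_bigr => j _; rewrite horner_sum; apply: eq_bigr => m _.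
  by rewrite hornerM hornerC hornerXn normrM (ger0_norm (exprn_ge0 _ lam0)).
pose c := `|lead_coef (p i)|.
have c0 : 0 < c by rewrite normr_gt0 lead_coef_eq0 -size_poly_gt0; apply: leq_trans si.
pose m1 := (size (p i)).-2.
have m1E : (m1.+1 = (size (p i)).-1)%N by rewrite /m1; case: (size _) si => [|[|]].
have m1D : (m1 < D)%N by rewrite m1E; have := sp i; case: (size _) si => [|[|]].
have lam1 : 1 <= 1 + c^-1 by rewrite lerDl invr_ge0 ltW.
have Q1 : 1 <= Q.[1 + c^-1].
  rewrite QE ?(le_trans ler01)// (bigD1 i)//= (bigD1 (Ordinal m1D))//= -addrA ler_wpDr//.
    by rewrite addr_ge0// sumr_ge0// => j _; rewrite sumr_ge0.
  rewrite m1E -lead_coefE normrM -/c ger0_norm; last by rewrite exprn_ge0// (le_trans ler01).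
  rewrite -m1E; apply: (@le_trans _ _ (c * (1 + c^-1))).
    by rewrite mulrDr divff ?gt_eqF// mulr1 lerDr ltW.
  by rewrite ler_pM2l// -[leLHS]expr1; apply: ler_weXn2l.
have Q0 : Q.[0] = 0.
  by rewrite QE// big1// => j _; rewrite big1// => m _; rewrite expr0n mulr0 normr0.
have [lam /andP[lam0 _]] : exists2 lam, 0 <= lam <= 1 + c^-1 & root (Q - 1) lam.
  apply: (@Num.Theory.poly_ivt R (Q - 1)); first exact: le_trans ler01 lam1.
  by rewrite !hornerE Q0 sub0r lerN10 subr_ge0.
rewrite /root !hornerE subr_eq0 => /eqP Ql; exists lam; last by rewrite -QE.
by rewrite lt_neqAle lam0 andbT; apply/eqP => l0; move: Ql; rewrite -l0 Q0 => /eqP; rewrite eq_sym oner_eq0.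
Qed.

Lemma lines_nonconstant (D : nat) : locally_injective F ->
  polynomial_on_lines D ->
  forall x : V, exists p : 'I_3 -> {poly R}, [/\ forall i, (size (p i) <= D.+1)%N,
    exists i, (1 < size (p i))%N & forall i t, (p i).[t] = F (x + t *: e0) ord0 i].
Proof.
move=> injF lines x.
have /choice[p hp] (i : 'I_3) : exists p : {poly R},
    (size p <= D.+1)%N /\ forall t, p.[t] = F (x + t *: e0) ord0 i.
  by have [p] := lines x i; exists p.
exists p; split=> [i||i]; [by have [] := hp i| |by have [] := hp i].
apply: contrapT => np; have cst t : F (x + t *: e0) = F x.
  apply/rowP => i; have [_ pE] := hp i; rewrite -pE.
  have /size1_polyC pc : (size (p i) <= 1)%N.
    by rewrite leqNgt; apply/negP => si; apply: np; exists i.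
  have := pE 0; rewrite scale0r addr0 => <-.
  by rewrite pc !hornerC.
have [U Ux injU] := injF x.
have cx : {for 0, continuous (fun t : R => x + t *: e0)}.
  exact: (cont_addv (cont_cst x (0:R)) (cont_scalev (cont_id (0:R)) (cont_cst e0 (0:R)))).
have : \forall t \near (0:R), U (x + t *: e0) by apply: cx; rewrite scale0r addr0.
move=> /nbhs_ballP[d /= d0 dU].
have Ud : U (x + (d / 2) *: e0).
  by apply: dU; rewrite /ball /= sub0r normrN gtr0_norm; lra.
have := injU _ _ (mem_set Ud) (mem_set (nbhs_singleton Ux)) (cst _).
move=> /(congr1 (fun v : V => v ord0 0)); rewrite !mxE eqxx /=; lra.
Qed.

(* Restrictions of [F] to lines through points [x k] tending to infinity, rescaled so that the
   nonconstant coefficients have total mass 1, accumulate.  Two parameters at which the limit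
   curve is outside the set would keep [x k] bounded. *)
Lemma curve_through (D : nat) (y : V) : locally_injective F -> closed (nonproper_set F) ->
  polynomial_on_lines D ->
  nonproper_set F y ->
  exists phi : 'I_3 -> {poly R}, [/\ forall i, (size (phi i) <= D.+1)%N,
    exists i, (1 < size (phi i))%N, \row_i (phi i).[0] = y &
    forall t, nonproper_set F (\row_i (phi i).[t])].
Proof.
move=> injF clS lines Sy.
pose W := 'rV[R]_(3 * D.+1).
pose ev (t : R) (w : W) : V :=
  \row_i \sum_(m < D.+1) w ord0 (mxvec_index i m) * t ^+ m.
pose mass (w : W) := \sum_i \sum_(m < D) `|w ord0 (mxvec_index i (lift ord0 m))|.
(* [w] collects the coefficients of the three coordinates after rescaling. The constant ones are
   those of [F x], which is within 1 of [y]; the others are at most the mass 1. So all these vectors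
   lie in one compact ball. *)
have step (k : nat) : exists2 w : W, `|0 - w| <= `|y| + 1 & exists (x : V) lam,
    [/\ k%:R < `|x|, `|F x - y| < k.+1%:R^-1, mass w = 1 &
    forall t, ev t w = F (x + (lam * t) *: e0)].
  have [x [kx xy]] := (nonproper_setP F y).1 Sy k.+1%:R^-1 k%:R ltac:(by rewrite invr_gt0).
  have [p [sp np pE]] := lines_nonconstant injF lines x.
  have [lam lam0 hl] := unit_weight sp np.
  pose A : 'M[R]_(3, D.+1) := \matrix_(i, m) ((p i)`_m * lam ^+ m).
  have wE i m : (mxvec A) ord0 (mxvec_index i m) = (p i)`_m * lam ^+ m.
    by rewrite mxvecE mxE.
  have ml : mass (mxvec A) = 1.
    by rewrite -hl; apply: eq_bigr => i _; apply: eq_bigr => m _; rewrite wE lift0.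
  have evE t : ev t (mxvec A) = F (x + (lam * t) *: e0).
    apply/rowP => i; rewrite mxE -pE (horner_coef_wide _ (sp i)).
    by apply: eq_bigr => m _; rewrite wE exprMn mulrA.
  exists (mxvec A); last by exists x, lam.
  have Fx1 : `|F x| <= `|y| + 1.
    rewrite -[F x](subrK y) addrC; apply: le_trans (ler_normD _ _) _; rewrite lerD2l.
    by apply: le_trans (ltW xy) _; rewrite invf_le1 ?ltr0n// ler1n.
  rewrite sub0r normrN [leLHS]/Num.norm /= mx_normrE; apply/bigmax_leP.
  split=> [|[i0 j] _ /=]; [by rewrite addr_ge0|rewrite (ord1 i0)]; case/mxvec_indexP: j => i m; rewrite wE.
  have [->|m0] := eqVneq m ord0.
    rewrite expr0 mulr1 -horner_coef0 pE scale0r addr0.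
    exact: le_trans (coord_le_norm _ _) Fx1.
  have m1 : (0 < m)%N by rewrite lt0n.
  have m1D : (m.-1 < D)%N by rewrite -ltnS prednK.
  apply: (@le_trans _ _ 1); last by rewrite lerDr.
  rewrite -hl (bigD1 i)//= (bigD1 (Ordinal m1D))//= prednK// -addrA lerDl.
  by rewrite addr_ge0// sumr_ge0// => j _; rewrite sumr_ge0.
have /choice[w hw] (k : nat) : exists w : W, `|0 - w| <= `|y| + 1 /\ exists (x : V) lam,
    [/\ k%:R < `|x|, `|F x - y| < k.+1%:R^-1, mass w = 1 &
    forall t, ev t w = F (x + (lam * t) *: e0)].
  by have [w] := step k; exists w.
have [w0 [_ w0c]] : [set u : W | `|0 - u| <= `|y| + 1] `&` cluster (w @ \oo) !=set0.
  by apply: compact_norm_ball; exists 0%N => // k _; have [] := hw k.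
have often (B : set W) k0 : nbhs w0 B -> exists k, (k0 <= k)%N /\ B (w k).
  move=> wB; have [|_ [[k /= kk <-] Bk]] := w0c (w @` [set k | (k0 <= k)%N]) B _ wB.
    by exists k0 => // k /= kk; exists k.
  by exists k.
have cev t : {for w0, continuous (ev t)}.
  apply: cont_row => i; rewrite (_ : (fun u => _) = fun u : W =>
    \sum_(m < D.+1) u ord0 (mxvec_index i m) * t ^+ m); last by apply: funext => u; rewrite mxE.
  by apply: cont_sum => m; exact: (cont_mul (cont_proj _ w0) (cont_cst (t ^+ m) w0)).
have cmass : {for w0, continuous mass}.
  apply: cont_sum => i; apply: cont_sum => m.
  exact: (cont_comp (cont_proj (mxvec_index i (lift ord0 m)) w0) (@norm_continuous _ R^o _)).
have nev t e : 0 < e -> nbhs w0 [set u | `|ev t w0 - ev t u| < e].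
  by move=> he; have /cvgrPdist_lt/(_ e he) := cev t.
have mass0 : mass w0 = 1.
  apply: contrapT => /eqP; rewrite -subr_eq0 -normr_gt0 => eps0.
  have /cvgrPdist_lt/(_ _ eps0) /(often _ 0%N)[k [_ /=]] := cmass.
  by have [_ [x [lam [_ _ -> _]]]] := hw k; rewrite ltxx.
have ev0 : ev 0 w0 = y.
  apply: contrapT => /eqP; rewrite -subr_eq0 -normr_gt0 => eps0.
  have e2 : 0 < `|ev 0 w0 - y| / 2 by lra.
  have [k0 hk0] : exists k0 : nat, forall k, (k0 <= k)%N -> k.+1%:R^-1 < `|ev 0 w0 - y| / 2.
    by have [N _ hN] := near_infty_natSinv_lt (PosNum e2); exists N => k; exact: hN.
  have [k [kk /= hk]] := often _ k0 (nev 0 _ e2).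
  have [_ [x [lam [_ xy _ evE]]]] := hw k; rewrite evE mulr0 scale0r addr0 in hk.
  have : `|ev 0 w0 - y| < `|ev 0 w0 - y|; last by rewrite ltxx.
  rewrite [ltRHS]splitr.
  exact: le_lt_trans (ler_distD (F x) _ _) (ltrD hk (lt_trans xy (hk0 _ kk))).
pose phi i : {poly R} := \poly_(m < D.+1) w0 ord0 (mxvec_index i (inord m)).
have phiE t : \row_i (phi i).[t] = ev t w0.
  apply/rowP => i; rewrite !mxE horner_poly; apply: eq_bigr => m _.
  by rewrite inord_val.
have bad t : ~ nonproper_set F (ev t w0) -> exists e M, 0 < e /\
    forall x, `|F x - ev t w0| < e -> `|x| <= M.
  move=> /nonproper_setP/existsNP[e] /existsNP[M] /not_implyP[ep0] /forallNP hx.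
  exists e, M; split=> // x Fx; rewrite leNgt; apply/negP => Mx.
  by apply: (hx x).
have onebad t1 t2 : t1 != t2 -> nonproper_set F (ev t1 w0) \/ nonproper_set F (ev t2 w0).
  move=> t12; apply: contrapT => /not_orP[/bad[e1 [M1 [e10 h1]]] /bad[e2 [M2 [e20 h2]]]].
  have d0 : 0 < `|t1 - t2| by rewrite normr_gt0 subr_eq0.
  pose B := M1 + (M1 + M2) / `|t1 - t2| * (`|t1| * `|e0|).
  have [K KB] : exists K : nat, B < K%:R by exists (Num.truncn B).+1; rewrite truncnS_gt.
  have [k [kK [/= a1 a2]]] := often _ K (filterI (nev t1 _ e10) (nev t2 _ e20)).
  have [_ [x [lam [kx _ _ evE]]]] := hw k; rewrite evE distrC in a1; rewrite evE distrC in a2.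
  have {}a1 := h1 _ a1; have {}a2 := h2 _ a2.
  have l1 : `|lam| <= (M1 + M2) / `|t1 - t2|.
    rewrite ler_pdivlMr// -normrM.
    apply: le_trans (lerD a1 a2); apply: le_trans (ler_normB _ _).
    apply: le_trans (coord_le_norm _ 0); rewrite !mxE eqxx /=.
    by rewrite le_eqVlt; apply/orP; left; apply/eqP; congr `|_|; ring.
  have : `|x| <= B.
    rewrite -[x](addrK ((lam * t1) *: e0)); apply: le_trans (ler_normB _ _) _.
    apply: lerD => //; rewrite (_ : `|_ *: _| = `|lam| * (`|t1| * `|e0|)); last first.
      by rewrite normrZ normrM mulrA.
    by apply: ler_wpM2r => //; rewrite mulr_ge0.
  have : (K%:R : R) <= k%:R by rewrite ler_nat.
  lra.
exists phi; split=> [i| | |t].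
- exact: size_poly.
- apply: contrapT => np; move: mass0; rewrite /mass big1.
    by move=> /eqP; rewrite eq_sym oner_eq0.
  move=> i _; rewrite big1// => m _.
  have : (phi i)`_m.+1 = 0.
    apply: nth_default; rewrite leqNgt; apply/negP => h; apply: np; exists i.
    by apply: leq_ltn_trans h.
  rewrite coef_poly ltnS ltn_ord => h.
  rewrite (_ : lift ord0 m = inord m.+1) ?h ?normr0//.
  by apply: ord_inj; rewrite lift0 inordK// ltnS.
- by rewrite phiE ev0.
(* By [onebad] at most one parameter leaves the set, but the set is closed, so the parameters
   leaving it form an open set. *)
- rewrite phiE; apply: contrapT => bt.
  have ct : {for t, continuous (ev^~ w0)}.
    rewrite (_ : ev^~ w0 = fun t => \row_i (phi i).[t]); last by apply: funext => u; rewrite phiE.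
    apply: cont_row => i; rewrite (_ : (fun u => _) = horner (phi i)); first exact: continuous_horner.
    by apply: funext => u; rewrite mxE.
  have /nbhs_ballP[d /= d0 hd] : \forall u \near t, (~` nonproper_set F) (ev u w0).
    by apply: ct; apply: open_nbhs_nbhs; split=> //; exact: closed_openC.
  have td : t != t + d / 2 by rewrite -subr_eq0 opprD addrA subrr sub0r oppr_eq0; lra.
  have [//|] := onebad _ _ td; apply: hd.
  by rewrite /ball /= opprD addrA subrr sub0r normrN gtr0_norm; lra.
Qed.

End Curve.

(** * Finiteness *)

Section Finiteness.
Variable R : realType.
Implicit Types (P : R -> Prop) (u v : seq R).

Lemma infinite_uniq P N : ~ (exists l : seq R, forall t, P t -> t \in l) ->
  exists u, [/\ uniq u, size u = N & forall t, t \in u -> P t].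
Proof.
move=> infP; elim: N => [|N [u [uu su hu]]]; first by exists [::].
have [t Pt tu] : exists2 t, P t & t \notin u.
  apply: contrapT => h; apply: infP; exists u => t Pt; apply: contrapT => /negP tu.
  by apply: h; exists t.
exists (t :: u); split=> [||s]; rewrite /= ?tu ?su// inE => /orP[/eqP->//|]; exact: hu.
Qed.

Lemma infinite_split P N : ~ (exists l : seq R, forall t, P t -> t \in l) ->
  exists s0 u v, [/\ uniq u, size u = N & forall t, t \in u -> P t /\ s0 <= t] /\
    [/\ uniq v, size v = N & forall t, t \in v -> P t /\ t <= s0].
Proof.
move=> /(infinite_uniq (N + N))[w0 [uw0 sw0 hw0]].
pose w := sort <=%O w0.
have uw : uniq w by rewrite sort_uniq.
have sw : size w = (N + N)%N by rewrite size_sort.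
have hw t : t \in w -> P t by rewrite mem_sort; exact: hw0.
have mono i j : (i <= j)%N -> (j < size w)%N -> w`_i <= w`_j.
  move=> ij jw; apply: (sorted_leq_nth le_trans le_refl 0 (sort_le_sorted w0)) => //.
  by rewrite inE (leq_ltn_trans ij).
exists w`_N, (drop N w), (take N w); split; split.
- exact: drop_uniq.
- by rewrite size_drop sw addnK.
- move=> t tw; split; first by apply: hw; exact: mem_drop tw.
  move: tw => /(nthP 0)[i]; rewrite size_drop => ilt <-; rewrite nth_drop.
  by apply: mono; [exact: leq_addr|rewrite -ltn_subRL].
- exact: take_uniq.
- by rewrite size_takel// sw leq_addr.
- move=> t tw; split; first by apply: hw; exact: mem_take tw.
  move: tw => /(nthP 0)[i]; rewrite size_takel ?sw ?leq_addr// => iN <-; rewrite nth_take//.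
  apply: mono; [exact: ltnW|rewrite sw].
  by rewrite -{1}(addn0 N) ltn_add2l (leq_ltn_trans (leq0n i)).
Qed.

Lemma sum3 (E : 'I_3 -> R) : \sum_i E i = E 0 + E 1 + E 2.
Proof.
rewrite !big_ord_recl big_ord0 addr0 addrA.
by congr (E _ + E _ + E _); apply: val_inj.
Qed.

Lemma poly_unbounded (p : {poly R}) (B : R) : (1 < size p)%N -> exists t, B < `|p.[t]|.
Proof.
wlog lp : p / 0 < lead_coef p.
  move=> h sp; have [lp|] := ltP 0 (lead_coef p); first exact: h.
  rewrite le_eqVlt lead_coef_eq0 => /orP[/eqP p0|lp]; first by rewrite p0 size_poly0 in sp.
  have [||t] := h (- p); rewrite ?lead_coefN ?oppr_gt0 ?size_polyN//.
  by rewrite hornerN normrN; exists t.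
move=> sp; have lB : lead_coef (p - B%:P) = lead_coef p.
  rewrite lead_coefDl// size_polyN; apply: leq_ltn_trans sp; exact: size_polyC_leq1.
have [n hn] : exists n : R, forall x, n <= x -> lead_coef (p - B%:P) <= (p - B%:P).[x].
  by apply: polyrcf.poly_pinfty_gt_lc; rewrite lB.
exists n; have := hn n (lexx n); rewrite lB !hornerE => h.
by apply: lt_le_trans (ler_norm _); lra.
Qed.

Definition local_extremum (rho : R -> R) (t : R) :=
  (\forall s \near t, rho s <= rho t) \/ (\forall s \near t, rho t <= rho s).

Lemma poly_extremum (Q : {poly R}) t : local_extremum (horner Q) t -> root Q^`() t.
Proof.
have der s : derivable (horner Q) s 1 by exact: ex_derive.
have E (h : is_derive t (1 : R) (horner Q) 0) : root Q^`() t.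
  have := @derive_val _ _ _ _ _ _ _ h.
  by rewrite (@derive_val _ _ _ _ _ _ _ (is_derive_poly Q t)) => /eqP.
case=> /nbhs_ballP[d /= d0 hd]; apply: E.
- apply: (@derive1_at_max _ _ (t - d) (t + d)) => //; first lra.
    by rewrite in_itv /=; apply/andP; split; lra.
  by move=> s; rewrite in_itv /= => hs; apply: hd; rewrite /ball /= distrC ltr_distl.
- apply: (@derive1_at_min _ _ (t - d) (t + d)) => //; first lra.
    by rewrite in_itv /=; apply/andP; split; lra.
  by move=> s; rewrite in_itv /= => hs; apply: hd; rewrite /ball /= distrC ltr_distl.
Qed.

End Finiteness.

(** * Polynomial curves against the parametrisation of the line *)

Section Line.
Variables (R : realType) (S : set 'rV[R]_3) (f : R -> 'rV[R]_3) (g : 'rV[R]_3 -> R) (D : nat).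
Local Notation V := 'rV[R]_3.
Implicit Types phi : 'I_3 -> {poly R}.

Definition curve phi (t : R) : V := \row_i (phi i).[t].

Hypotheses (cf : continuous f) (Sf : forall t, S (f t)) (fg : forall y, S y -> f (g y) = y).
Hypotheses (gf : forall t, g (f t) = t) (cg : {within S, continuous g}).
Hypothesis curves : forall y, S y -> exists phi, [/\ forall i, (size (phi i) <= D.+1)%N,
    exists i, (1 < size (phi i))%N, curve phi 0 = y & forall t, S (curve phi t)].

Lemma cont_curve phi t : {for t, continuous (curve phi)}.
Proof.
apply: cont_row => i; rewrite (_ : (fun u => _) = horner (phi i)); first exact: continuous_horner.
by apply: funext => u; rewrite mxE.
Qed.

Lemma param_continuous (T : topologicalType) (k : T -> V) (t : T) : {for t, continuous k} ->
  (forall u, S (k u)) -> {for t, continuous (g \o k)}.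
Proof.
move=> ck Sk B; move/subspace_continuousP: cg => /(_ _ (Sk t)) h /h /= kB.
have kB' : \forall u \near t, S (k u) -> B (g (k u)) := ck _ kB.
by apply: filterS kB' => u; apply; exact: Sk.
Qed.

(** The parameters reached by the curve through [f s0] form an interval around [s0]. If it missed
    values on both sides, the curve would stay in the compact image of a segment, but a nonconstant
    polynomial is unbounded. *)
Lemma half_line (s0 : R) : exists phi (h : R -> R),
  [/\ forall i, (size (phi i) <= D.+1)%N, exists i, (1 < size (phi i))%N,
    continuous h, forall t, f (h t) = curve phi t &
    (forall s, s0 <= s -> exists t, h t = s) \/ (forall s, s <= s0 -> exists t, h t = s)].
Proof.
have [phi [sphi [i si] phi0 Sphi]] := curves (Sf s0).
pose h t := g (curve phi t).
have ch : continuous h by move=> t; apply: param_continuous Sphi; exact: cont_curve.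
have fh t : f (h t) = curve phi t by rewrite fg.
have h0 : h 0 = s0 by rewrite /h phi0 gf.
exists phi, h; split => //; first by exists i.
apply: contrapT => /not_orP[/existsNP[b /not_implyP[sb nb]] /existsNP[a /not_implyP[sa na]]].
have hI t c : Num.min s0 (h t) <= c <= Num.max s0 (h t) -> exists u, h u = c.
  rewrite -h0 => hc; have [t0|t0] := leP 0 t.
    have [|u _ <-] := IVT t0 _ hc; last by exists u.
    exact: continuous_subspaceT.
  rewrite minC maxC in hc; have [|u _ <-] := IVT (ltW t0) _ hc; last by exists u.
  exact: continuous_subspaceT.
have hab t : h t \in `[a, b].
  rewrite in_itv /=; apply/andP; split; rewrite leNgt; apply/negP => ht.
  - by apply: na; apply: (hI t); rewrite ge_min le_max sa (ltW ht) orbT.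
  - by apply: nb; apply: (hI t); rewrite ge_min le_max sb (ltW ht) orbT.
have cK : compact (f @` `[a, b]).
  by apply: continuous_compact; [exact: continuous_subspaceT|exact: segment_compact].
have [M0 [_ hM]] := compact_bounded cK.
have [t] := poly_unbounded (M0 + 1) si; apply/negP; rewrite -leNgt.
have := hM (M0 + 1) ltac:(by rewrite ltrDl) (curve phi t).
rewrite -fh => /(_ (ex_intro2 _ _ (h t) (hab t) erefl)) le1.
by apply: le_trans le1; rewrite fh; apply: le_trans (coord_le_norm _ i); rewrite mxE.
Qed.

(* A median of [P] leaves many points of [P] on each side, one of which is covered by a curve. *)
Lemma half_line_preimages (P : R -> Prop) (N : nat) :
  (forall phi (h : R -> R), (forall i, (size (phi i) <= D.+1)%N) ->
    (exists i, (1 < size (phi i))%N) -> continuous h -> (forall t, f (h t) = curve phi t) ->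
    forall u, uniq u -> (forall t, t \in u -> P (h t)) -> (size u <= N)%N) ->
  exists l : seq R, forall t, P t -> t \in l.
Proof.
move=> bound; apply: contrapT => /(infinite_split N.+1).
move=> [s0 [u [v [[uu su hu] [uv sv hv]]]]].
have [phi [h [sphi nphi ch fh cov]]] := half_line s0.
have pull w : uniq w -> (forall s, s \in w -> P s /\ exists t, h t = s) -> (size w <= N)%N.
  move=> uw hw; have /choice[tau htau] (s : R) : exists t, s \in w -> h t = s.
    by have [/hw[_ [t ht]]|] := boolP (s \in w); [exists t|exists 0].
  rewrite -(size_map tau); apply: (bound phi h) => //.
    by rewrite map_inj_in_uniq// => s s' /htau e /htau e' ss'; rewrite -e ss' e'.
  by move=> t /mapP[s sw ->]; rewrite htau//; have [] := hw s sw.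
case: cov => cov.
- suff : (size u <= N)%N by rewrite su ltnn.
  apply: pull => // s /hu[Ps ss].
  by split=> //; exact: cov.
- suff : (size v <= N)%N by rewrite sv ltnn.
  apply: pull => // s /hv[Ps ss].
  by split=> //; exact: cov.
Qed.

(** As [h] is continuous, an extremum at [h t] gives one of the polynomial [Q] at [t], hence a root
    of its derivative. [Q] has degree at most [2 * D], and it is not constant because it dominates
    the square of an unbounded polynomial. *)
Lemma extrema_finite (a : V) : exists l : seq R, forall t,
  local_extremum (fun t => dot (f t - a) (f t - a)) t -> t \in l.
Proof.
apply: (@half_line_preimages _ D.*2) => phi h sphi [i si] ch fh u uu hu.
pose Q : {poly R} := \sum_j (phi j - (a ord0 j)%:P) ^+ 2.
have QE t : Q.[t] = dot (f (h t) - a) (f (h t) - a).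
  by rewrite fh /dot horner_sum sum3 !hornerE !mxE.
have sQ : (size Q <= D.*2.+1)%N.
    apply: leq_trans (size_sum _ _ _) _; apply/bigmax_leqP => j _.
    apply: leq_trans (size_poly_exp_leq _ _) _; rewrite ltnS -mul2n mulnC leq_mul2l /=.
    rewrite -subn1 leq_subLR add1n; apply: leq_trans (size_polyD _ _) _.
    by rewrite geq_max sphi size_polyN; apply: leq_trans (size_polyC_leq1 _) _.
have Q'0 : Q^`() != 0.
  rewrite -size_poly_eq0 polyorder.size_deriv -lt0n; apply: contrapT => /negP sQ0.
  have [c Qc] : exists c, Q = c%:P.
    by exists Q`_0; apply: size1_polyC; move: sQ0; case: (size Q) => [|[|n]].
  have [t ht] := poly_unbounded (`|a ord0 i| + `|c| + 1) si.
  have : ((phi i).[t] - a ord0 i) ^+ 2 <= c.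
    rewrite (_ : c = Q.[t]); last by rewrite Qc hornerC.
    rewrite horner_sum (bigD1 i)//= !hornerE lerDl sumr_ge0// => j _.
    by rewrite !hornerE sqr_ge0.
  have h1 : `|c| + 1 <= `|(phi i).[t] - a ord0 i|.
    by have := ler_normD ((phi i).[t] - a ord0 i) (a ord0 i); rewrite subrK; lra.
  rewrite -real_normK ?num_real// => h2; have := ler_norm c; have := normr_ge0 c.
  move=> y0 cy; have : (`|c| + 1) ^+ 2 <= `|c|.
    apply: le_trans (le_trans h2 cy); rewrite lerXn2r ?nnegrE//.
  by rewrite leNgt sqrrD1 => /negP; apply; move: (sqr_ge0 `|c|) y0; lra.
rewrite -ltnS; apply: leq_trans (max_poly_roots Q'0 _ uu) _.
  apply/allP => t tu; apply: poly_extremum.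
  case: (hu t tu) => ext; [left|right].
  - have ext' : \forall s \near t, dot (f (h s) - a) (f (h s) - a) <= _ := ch t _ ext.
    by apply: filterS ext' => s; rewrite !QE.
  - have ext' : \forall s \near t, _ <= dot (f (h s) - a) (f (h s) - a) := ch t _ ext.
    by apply: filterS ext' => s; rewrite !QE.
by rewrite polyorder.size_deriv; apply: leq_trans (leq_pred _) sQ.
Qed.

Lemma cross_axis (x : V) (i j : 'I_3) : cross x (delta_mx 0 i) = 0 -> j != i -> x ord0 j = 0.
Proof.
have E (n : 'I_3) : [\/ n = 0, n = 1 | n = 2].
  by case: n => -[|[|[|]]]//= ?; [constructor 1|constructor 2|constructor 3]; exact: val_inj.
move=> /rowP h; move: (h 0) (h 1) (h 2); rewrite !mxE /= => {h}.
case: (E i) => ->; case: (E j) => ->; rewrite ?eqxx //= => h0 h1 h2 _; lra.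
Qed.

Lemma median3 (s : 'I_3 -> R) : exists k i j, [/\ i != k, s i <= s k, j != k & s k <= s j].
Proof.
have [a|/ltW a] := leP (s 0) (s 1); have [b|/ltW b] := leP (s 1) (s 2); have [c|/ltW c] := leP (s 0) (s 2).
- by exists 1, 0, 2.
- by exists 1, 0, 2.
- by exists 2, 0, 1.
- by exists 0, 2, 1.
- by exists 0, 1, 2.
- by exists 2, 1, 0.
- by exists 1, 2, 0.
- by exists 1, 2, 0.
Qed.

(* At the middle one of the medians belonging to the three axes, the curve that covers a half
   line would be parallel to two axes. *)
Lemma axis_finite (a : V) : exists (e : V) (l : seq R), forall t,
  cross (f t - a) e = 0 -> t \in l.
Proof.
apply: contrapT => none.
have inf (i : 'I_3) : ~ exists l : seq R, forall t, cross (f t - a) (delta_mx 0 i) = 0 -> t \in l.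
  by move=> [l hl]; apply: none; exists (delta_mx 0 i), l.
have /choice[s hs] (i : 'I_3) := infinite_split D.+1 (@inf i).
(* An upward half line from [s k] contains [D.+1] points for the axis [k] and [D.+1] for [j]; a
   downward one, for [k] and [i]. In both cases they force every coordinate of the curve to be
   constant. *)
have [k [i [j [ik sik jk skj]]]] := median3 s.
have [phi [h [sphi [m sm] _ fh cov]]] := half_line (s k).
have pull n u : uniq u -> size u = D.+1 ->
    (forall t, t \in u -> cross (f t - a) (delta_mx 0 n) = 0 /\ exists t', h t' = t) ->
    forall n', n' != n -> phi n' = (a ord0 n')%:P.
  move=> uu su hu n' n'n; have /choice[tau htau] (t : R) : exists t', t \in u -> h t' = t.
    by have [/hu[_ [t' ht]]|] := boolP (t \in u); [exists t'|exists 0].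
  apply/eqP; rewrite -subr_eq0; apply: contrapT => /negP p0.
  have : (size (map tau u) < size (phi n' - (a ord0 n')%:P)%R)%N.
    apply: max_poly_roots => //.
      apply/allP => _ /mapP[t tu ->]; have [c0 _] := hu t tu.
      rewrite /root !hornerE; have := cross_axis c0 n'n; rewrite -{1}(htau t tu) fh !mxE => ->.
      by rewrite eqxx.
    by rewrite map_inj_in_uniq// => t t' /htau e /htau e' tt'; rewrite -e tt' e'.
  rewrite size_map su ltnNge => /negP; apply; apply: leq_trans (size_polyD _ _) _.
  by rewrite geq_max sphi size_polyN; apply: leq_trans (size_polyC_leq1 _) _.
have [n [n' [nn' hn hn']]] : exists n n', [/\ n != n', (forall x, x != n -> phi x = (a ord0 x)%:P) &
    (forall x, x != n' -> phi x = (a ord0 x)%:P)].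
  case: cov => cov.
  - exists k, j; split; first by rewrite eq_sym.
      have [u [v [[uu su hu] _]]] := hs k; apply: (pull k u) => // t /hu[Pt st].
      by split=> //; exact: cov.
    have [u [v [[uu su hu] _]]] := hs j; apply: (pull j u) => // t /hu[Pt st].
    by split=> //; apply: cov; exact: le_trans st.
  - exists k, i; split; first by rewrite eq_sym.
      have [u [v [_ [uv sv hv]]]] := hs k; apply: (pull k v) => // t /hv[Pt st].
      by split=> //; exact: cov.
    have [u [v [_ [uv sv hv]]]] := hs i; apply: (pull i v) => // t /hv[Pt st].
    by split=> //; apply: cov; exact: le_trans st _.
have : phi m = (a ord0 m)%:P.
  have [mn|/hn//] := eqVneq m n; apply: hn'; by rewrite mn.
by move=> e; move: sm; rewrite e ltnNge size_polyC_leq1.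
Qed.

End Line.

(** * Strands of the line *)

Section Inverse.
Variables (R : realType) (rho : R -> R) (J I : set R).
Hypotheses (crho : continuous rho) (openJ : open J) (openI : open I).
Hypothesis convJ : forall u v t, J u -> J v -> u <= t <= v -> J t.
Hypothesis noext : forall t, J t -> ~ local_extremum rho t.

(** Maximum and minimum over [[u, v]] cannot be interior, so both equal the common end value. Then
    [rho] is constant there and the midpoint is an extremum after all. *)
Lemma extremum_free_inj u v : J u -> J v -> rho u = rho v -> u = v.
Proof.
wlog uv : u v / u < v.
  move=> h Ju Jv e; have [uv|vu|//] := ltgtP u v; first exact: h.
  by apply/esym; apply: h.
move=> Ju Jv e; exfalso.
have int c : u < c < v -> \forall s \near c, s \in `[u, v].
  move=> /andP[uc cv]; near=> s; rewrite in_itv /=; apply/andP; split; apply: ltW.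
  - by near: s; exact: lt_nbhsr.
  - by near: s; exact: lt_nbhsl.
have inJ c : u < c < v -> J c.
  by move=> /andP[uc cv]; apply: (convJ Ju Jv); rewrite !ltW.
have cuv : {within `[u, v], continuous rho} by exact: continuous_subspaceT.
have [c + hc] := EVT_max (ltW uv) cuv; have [c' + hc'] := EVT_min (ltW uv) cuv.
have stop b : u < b < v -> (forall t, t \in `[u, v] -> rho t <= rho b) \/
    (forall t, t \in `[u, v] -> rho b <= rho t) -> False.
  move=> ub h; apply: (noext (inJ _ ub)); case: h => h; [left|right];
    by apply: filterS (int _ ub); exact: h.
have ends b : b \in `[u, v] -> ~ u < b < v -> rho b = rho u.
  rewrite in_itv /= !le_eqVlt => /andP[/orP[/eqP<-//|ub] /orP[/eqP->|bv]] nb; first by [].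
  by exfalso; apply: nb; rewrite ub.
move=> ic' ic.
have nc : ~ u < c < v by move=> h; apply: (stop _ h); left.
have nc' : ~ u < c' < v by move=> h; apply: (stop _ h); right.
apply: (stop ((u + v) / 2)); first by apply/andP; split; lra.
left=> t tuv; apply: (le_trans (hc _ tuv)); rewrite (ends _ ic nc) -(ends _ ic' nc').
by apply: hc'; rewrite in_itv /=; apply/andP; split; lra.
Unshelve. all: by end_near.
Qed.

(** Injectivity on an interval implies strict monotonicity. So [s] lies strictly between the values
    at [th s - r] and [th s + r], and nearby values are attained within [r] of [th s]. *)
Lemma strand_inverse : (forall s, I s -> exists2 t, J t & rho t = s) ->
  exists th : R -> R, forall s, I s -> [/\ J (th s), rho (th s) = s, {for s, continuous th} &
    forall t, J t -> rho t = s -> t = th s].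
Proof.
move=> sur; have /choice[th hth] (s : R) : exists t, I s -> J t /\ rho t = s.
  by have [/sur[t Jt e]|nI] := pselect (I s); [exists t|exists 0].
exists th => s Is; have [Jt e] := hth s Is; split => //; last first.
  by move=> t Jt' e'; apply: extremum_free_inj; rewrite // e.
apply/cvgrPdist_lt => eps eps0.
have /nbhs_ballP[d /= d0 dJ] : nbhs (th s) J by apply: open_nbhs_nbhs.
pose r := Num.min eps d / 2.
have r0 : 0 < r by rewrite divr_gt0// lt_min eps0.
have re : r < eps by rewrite /r ltr_pdivrMr// gt_min mulr_natr mulr2n ltrDl eps0.
have rd : r < d by rewrite /r ltr_pdivrMr// gt_min orbC mulr_natr mulr2n ltrDl d0.
have inJ c : c \in `[th s - r, th s + r] -> J c.
  rewrite in_itv /= => hc; apply: dJ; rewrite /ball /= distrC ltr_distl.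
  by apply/andP; split; lra.
have cr : {within `[th s - r, th s + r], continuous rho} by exact: continuous_subspaceT.
have lr : th s - r <= th s + r by lra.
have between : Num.min (rho (th s - r)) (rho (th s + r)) < rho (th s) <
    Num.max (rho (th s - r)) (rho (th s + r)).
  have i1 : th s - r \in `[th s - r, th s + r] by rewrite in_itv /= lexx lr.
  have i2 : th s + r \in `[th s - r, th s + r] by rewrite in_itv /= lexx lr.
  have i0 : th s \in `[th s - r, th s + r] by rewrite in_itv /=; apply/andP; split; lra.
  have l1 : th s - r < th s by lra.
  have l2 : th s < th s + r by lra.
  have [|mono|mono] := itv_continuous_inj_mono cr.
  - by move=> x y hx hy; apply: extremum_free_inj; exact: inJ.
  - by rewrite gt_min lt_max (mono _ _ i1 i0 l1) (mono _ _ i0 i2 l2) orbT.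
  - by rewrite gt_min lt_max (mono _ _ i0 i1 l1) (mono _ _ i2 i0 l2) orbT.
have nI : nbhs s I by apply: open_nbhs_nbhs.
rewrite e in between; near=> s'.
have Is' : I s' by near: s'; exact: nI.
have [|c hc ec] := IVT lr cr (v := s').
  apply/andP; split; apply: ltW; near: s'.
  - by apply: lt_nbhsr; case/andP: between.
  - by apply: lt_nbhsl; case/andP: between.
have [Jt' e'] := hth s' Is'.
have -> : th s' = c by apply: extremum_free_inj; rewrite ?e'//; exact: inJ.
apply: le_lt_trans re; rewrite ler_norml; move: hc; rewrite in_itv /= => hc.
by apply/andP; split; lra.
Unshelve. all: by end_near.
Qed.

End Inverse.

Section Strands.
Variables (R : realType) (S : set 'rV[R]_3) (f : R -> 'rV[R]_3) (g : 'rV[R]_3 -> R).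
Local Notation V := 'rV[R]_3.
Hypotheses (cf : continuous f) (clS : closed S) (Sf : forall t, S (f t)).
Hypotheses (fg : forall y, S y -> f (g y) = y) (gf : forall t, g (f t) = t).
Hypothesis cg : {within S, continuous g}.

Definition sqdist (a : V) (t : R) := dot (f t - a) (f t - a).

Hypothesis extrema_finite : forall a, exists l : seq R, forall t,
  local_extremum (sqdist a) t -> t \in l.
Hypothesis axis_finite : forall a, exists (e : V) (l : seq R), forall t,
  cross (f t - a) e = 0 -> t \in l.

(** [th1] and [th2] invert the squared distance on the two sides of the parameter [ta]. Around a
    point of the line [ta] is the parameter of that point; at infinity it is 0 and only separates
    the two ends. *)
Record strands (a : V) (ta : R) (I : set R) (th1 th2 : R -> R) (e : V) : Prop := Strands {
  strands_center : forall t, I (sqdist a t) -> t <> ta;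
  strands_right : forall s, I s -> [/\ ta < th1 s, sqdist a (th1 s) = s, {for s, continuous th1},
    (forall t, ta < t -> sqdist a t = s -> t = th1 s) & cross (f (th1 s) - a) e <> 0];
  strands_left : forall s, I s -> [/\ th2 s < ta, sqdist a (th2 s) = s, {for s, continuous th2},
    (forall t, t < ta -> sqdist a t = s -> t = th2 s) & cross (f (th2 s) - a) e <> 0] }.

Lemma strands_sub a ta (I I' : set R) th1 th2 e : (forall s, I' s -> I s) ->
  strands a ta I th1 th2 e -> strands a ta I' th1 th2 e.
Proof.
move=> II' [c r l]; split=> [t /II'|s /II'|s /II']; [exact: c|exact: r|exact: l].
Qed.

Lemma f_inj t u : f t = f u -> t = u.
Proof. by move=> e; rewrite -(gf t) e gf. Qed.

Lemma cont_sqdist a t : {for t, continuous (sqdist a)}.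
Proof.
have h := cont_addv (@cf t) (cont_oppv (cont_cst a t)).
exact: (cont_dot h h).
Qed.

Lemma shell_of_strands a ta (I : set R) th1 th2 e : open I -> (forall s, I s -> 0 < s) ->
  (exists rho lam : R -> R, [/\ continuous rho, forall t, I (rho t),
    forall s, I s -> {for s, continuous lam} & forall s, I s -> rho (lam s) = s]) ->
  strands a ta I th1 th2 e ->
  shell S a I (fun s => f (th1 s) - a) (fun s => f (th2 s) - a).
Proof.
move=> oI I0 ch st; apply: (Shell oI I0 ch).
- move=> s /(strands_right st)[_ _ c _ _].
  exact: (cont_addv (cont_comp c (@cf _)) (cont_oppv (cont_cst a s))).
- move=> s /(strands_left st)[_ _ c _ _].
  exact: (cont_addv (cont_comp c (@cf _)) (cont_oppv (cont_cst a s))).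
- by move=> s /(strands_right st)[].
- by move=> s /(strands_left st)[].
- move=> s Is /addIr/f_inj; have [h1 _ _ _ _] := strands_right st Is.
  by have [h2 _ _ _ _] := strands_left st Is; lra.
- by exists e => s Is; have [] := strands_right st Is; have [] := strands_left st Is.
- move=> x Ix; split=> [Sx|]; last by rewrite ![a + _]addrC !subrK => -[] ->.
  rewrite ![a + _]addrC !subrK; have xE : f (g x) = x by exact: fg.
  have Ig : I (sqdist a (g x)) by rewrite /sqdist xE.
  have [lt|lt|eq] := ltgtP (g x) ta; last by have := strands_center st Ig eq.
  + right; have [_ _ _ h _] := strands_left st Ig.
    by rewrite -{1}xE (h _ lt erefl) /sqdist xE.
  + left; have [_ _ _ h _] := strands_right st Ig.
    by rewrite -{1}xE (h _ lt erefl) /sqdist xE.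
Qed.

Lemma strands_of_arcs a ta (I J1 J2 : set R) e : open I -> open J1 -> open J2 ->
  (forall u v t, J1 u -> J1 v -> u <= t <= v -> J1 t) ->
  (forall u v t, J2 u -> J2 v -> u <= t <= v -> J2 t) ->
  (forall t, J1 t -> ta < t) -> (forall t, J2 t -> t < ta) ->
  (forall t, J1 t \/ J2 t -> ~ local_extremum (sqdist a) t /\ cross (f t - a) e <> 0) ->
  (forall s, I s -> exists2 t, J1 t & sqdist a t = s) ->
  (forall s, I s -> exists2 t, J2 t & sqdist a t = s) ->
  (forall t, I (sqdist a t) -> J1 t \/ J2 t) ->
  exists th1 th2, strands a ta I th1 th2 e.
Proof.
move=> oI o1 o2 v1 v2 J1t J2t nice s1 s2 cov.
have crho : continuous (sqdist a) by move=> t; exact: cont_sqdist.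
have [th1 h1] := strand_inverse crho o1 oI v1 (fun t h => (nice t (or_introl h)).1) s1.
have [th2 h2] := strand_inverse crho o2 oI v2 (fun t h => (nice t (or_intror h)).1) s2.
exists th1, th2; split=> [t|s Is|s Is].
- by move=> /cov[/J1t|/J2t] h e'; rewrite e' ltxx in h.
- have [Jt et ct u] := h1 s Is; split => //; first exact: J1t.
    move=> t tt e'; apply: (u t) => //; have [//|/J2t] := cov t ltac:(by rewrite e'); lra.
  by apply: (nice _ _).2; left.
- have [Jt et ct u] := h2 s Is; split => //; first exact: J2t.
    move=> t tt e'; apply: (u t) => //; have [/J1t|//] := cov t ltac:(by rewrite e'); lra.
  by apply: (nice _ _).2; right.
Qed.

Lemma seq_gap (l : seq R) (ta : R) : exists2 d, 0 < d &
  forall t, t \in l -> t <> ta -> d <= `|t - ta|.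
Proof.
elim: l => [|x l [d d0 hd]]; first by exists 1.
have [->|xta] := eqVneq x ta.
  by exists d => // t; rewrite inE => /orP[/eqP->//|]; exact: hd.
exists (Num.min d `|x - ta|); first by rewrite lt_min d0 normr_gt0 subr_eq0.
move=> t; rewrite inE => /orP[/eqP->|tl] tt; rewrite ge_min ?lexx ?orbT//.
by rewrite hd.
Qed.

Lemma seq_bound (l : seq R) : exists2 T, 0 < T & forall t, t \in l -> `|t| < T.
Proof.
elim: l => [|x l [T T0 hT]]; first by exists 1.
exists (Num.max T (`|x| + 1)); first by rewrite lt_max T0.
move=> t; rewrite inE => /orP[/eqP->|tl]; rewrite lt_max; last by rewrite hT.
by rewrite [X in _ || X]ltrDl ltr01 orbT.
Qed.

Lemma sqdist_gt0 ta t : t <> ta -> 0 < sqdist (f ta) t.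
Proof.
move=> h; apply: dot_gt0 => /eqP; rewrite subr_eq0 => /eqP /f_inj; exact: h.
Qed.

(** Continuity of [g]: a part of the line with distant parameter cannot return close to [f ta]. *)
Lemma near_center ta d : 0 < d -> exists2 r, 0 < r &
  forall t, sqdist (f ta) t < r -> `|t - ta| < d.
Proof.
move=> d0; move/subspace_continuousP: cg => /(_ _ (Sf ta)) /cvgrPdist_lt/(_ _ d0).
move=> /nbhs_ballP[e /= e0 he]; exists (e ^+ 2); first by rewrite exprn_gt0.
move=> t ht; rewrite distrC -{1}(gf ta) -{1}(gf t); apply: he; last exact: Sf.
rewrite -ball_normE /= distrC -(@ltr_pXn2r _ 2) ?nnegrE ?(ltW e0)//.
exact: le_lt_trans (norm_le_dot _) ht.
Qed.

Lemma local_strands ta : exists2 d, 0 < d & exists th1 th2 e,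
  strands (f ta) ta [set s | 0 < s < d] th1 th2 e.
Proof.
have [l1 hl1] := extrema_finite (f ta); have [e [l2 hl2]] := axis_finite (f ta).
have [d d0 hd] := seq_gap (l1 ++ l2) ta.
have [r r0 hr] := near_center ta d0.
have c0 : sqdist (f ta) ta = 0 by rewrite /sqdist subrr dot0l.
have h1 : 0 < sqdist (f ta) (ta + d / 2) by apply: sqdist_gt0 => h; lra.
have h2 : 0 < sqdist (f ta) (ta - d / 2) by apply: sqdist_gt0 => h; lra.
(* Below [r] only parameters within [d] of [ta] occur, where there is no extremum except possibly
   [ta]. Below the other two numbers the intermediate value theorem finds a point on either side. *)
pose D := Num.min r (Num.min (sqdist (f ta) (ta + d / 2)) (sqdist (f ta) (ta - d / 2))).
have crho : continuous (sqdist (f ta)) by move=> t; exact: cont_sqdist.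
exists D; first by rewrite !lt_min r0 h1.
suff [th1 [th2 st]] : exists th1 th2, strands (f ta) ta [set s | 0 < s < D] th1 th2 e.
  by exists th1, th2, e.
apply: (@strands_of_arcs _ _ _ [set t | ta < t < ta + d] [set t | ta - d < t < ta]).
- by rewrite (_ : mkset _ = `]0, D[%classic)//; apply: funext => s; rewrite /= in_itv.
- by rewrite (_ : mkset _ = `]ta, ta + d[%classic)//; apply: funext => s; rewrite /= in_itv.
- by rewrite (_ : mkset _ = `]ta - d, ta[%classic)//; apply: funext => s; rewrite /= in_itv.
- by move=> u v t /= ? ? ?; apply/andP; split; lra.
- by move=> u v t /= ? ? ?; apply/andP; split; lra.
- by move=> t /= /andP[].
- by move=> t /= /andP[].
- move=> t Jt; have tta : t <> ta by case: Jt => /= h h'; lra.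
  have td : `|t - ta| < d by rewrite ltr_distl; case: Jt => /= h; apply/andP; split; lra.
  have tl : t \notin l1 ++ l2 by apply/negP => /hd/(_ tta); rewrite leNgt td.
  move: tl; rewrite mem_cat negb_or => /andP[/negP n1 /negP n2].
  by split=> [/hl1|/hl2].
- move=> s /= /andP[s0]; rewrite !lt_min => /and3P[_ s1 _].
  have [|||c ic ec] := @IVT _ (sqdist (f ta)) ta (ta + d / 2) s; first lra.
  + exact: continuous_subspaceT.
  + by rewrite c0 min_l ?max_r ?(ltW h1)// !ltW.
  exists c => //; move: ic; rewrite in_itv /= => /andP[ic1 ic2].
  rewrite lt_neqAle ic1 (_ : c < _) ?andbT; last by lra.
  by apply/eqP => e'; move: s0; rewrite -ec -e' c0 ltxx.
- move=> s /= /andP[s0]; rewrite !lt_min => /and3P[_ _ s1].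
  have [|||c ic ec] := @IVT _ (sqdist (f ta)) (ta - d / 2) ta s; first lra.
  + exact: continuous_subspaceT.
  + by rewrite c0 min_r ?max_l ?(ltW h2)// !ltW.
  exists c => //; move: ic; rewrite in_itv /= => /andP[ic1 ic2].
  rewrite [c < _]lt_neqAle ic2 (_ : _ < c) ?andbT; last by lra.
  by apply/eqP => e'; move: s0; rewrite -ec e' c0 ltxx.
- move=> t /= /andP[s0]; rewrite lt_min => /andP[/hr + _]; rewrite ltr_distl => /andP[a1 a2].
  have [lt|lt|eq] := ltgtP t ta; [by right; apply/andP|by left; apply/andP|].
  by move: s0; rewrite eq c0 ltxx.
Qed.

Lemma f_far M : exists T : R, forall t, T <= `|t| -> M < `|f t|.
Proof.
pose K := [set y : V | `|0 - y| <= M] `&` S.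
have cK : compact K.
  exact: (subclosed_compact (closedI (@closed_norm_ball _ _ _ _) clS) (@compact_norm_ball _ _ 0 M) (@subIsetl _ _ _)).
have cgK : compact (g @` K).
  by apply: continuous_compact cK; apply: continuous_subspaceW cg; exact: subIsetr.
have [M0 [_ hM]] := compact_bounded cgK.
exists (M0 + 2) => t tT; rewrite ltNge; apply/negP => fM.
have : `|t| <= M0 + 1.
  apply: (hM (M0 + 1)); first by rewrite ltrDl.
  by exists (f t); rewrite ?gf// /K; split; [rewrite /= sub0r normrN|exact: Sf].
lra.
Qed.

(** All extrema and axis points have parameters in [[- T, T]]. Spheres whose squared radius exceeds
    the maximum over this segment are met only beyond it, once at each end since the line is
    properly embedded. *)
Lemma infinite_strands a : exists2 R0, 0 < R0 & exists th1 th2 e,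
  strands a 0 [set s | R0 < s] th1 th2 e.
Proof.
have [l1 hl1] := extrema_finite a; have [e [l2 hl2]] := axis_finite a.
have [T T0 hT] := seq_bound (l1 ++ l2).
have crho : continuous (sqdist a) by move=> t; exact: cont_sqdist.
have NTT : - T <= T by lra.
have [c _ hc] := EVT_max NTT (continuous_subspaceT crho).
have far s : exists2 T', T < T' & forall t, T' <= `|t| -> s < sqdist a t.
  have [T' h] := f_far (`|a| + (Num.max s 0 + 1)).
  exists (Num.max T' (T + 1)); first by rewrite lt_max orbC ltrDl ltr01.
  move=> t; rewrite ge_max => /andP[/h + _]; have := ler_normD (f t - a) a; rewrite subrK => h1 h2.
  have m1 : Num.max s 0 + 1 < `|f t - a| by lra.
  have s1 : s <= Num.max s 0 by rewrite le_max lexx.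
  have s2 : 0 <= Num.max s 0 by rewrite le_max lexx orbT.
  by apply: lt_le_trans (norm_le_dot _); nra.
exists (1 + sqdist a c); first by rewrite ltr_pwDl// dot_ge0.
suff [th1 [th2 st]] : exists th1 th2, strands a 0 [set s | 1 + sqdist a c < s] th1 th2 e.
  by exists th1, th2, e.
have aT : sqdist a T <= sqdist a c by apply: hc; rewrite in_itv /= NTT lexx.
have aNT : sqdist a (- T) <= sqdist a c by apply: hc; rewrite in_itv /= NTT lexx.
apply: (@strands_of_arcs _ _ _ [set t | T < t] [set t | t < - T]).
- exact: open_gt.
- exact: open_gt.
- exact: open_lt.
- by move=> u v t /= ? ? ?; lra.
- by move=> u v t /= ? ? ?; lra.
- by move=> t /= ?; lra.
- by move=> t /= ?; lra.
- move=> t Jt; have tT : T <= `|t|.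
    case: Jt => /= h; first by rewrite (le_trans (ltW h))// ler_norm.
    by rewrite -normrN; apply: le_trans (ler_norm _); lra.
  have tl : t \notin l1 ++ l2 by apply/negP => /hT; rewrite ltNge tT.
  move: tl; rewrite mem_cat negb_or => /andP[/negP n1 /negP n2].
  by split=> [/hl1|/hl2].
- move=> s /= s1; have [T' TT' hT'] := far s.
  have sT' : s < sqdist a T' by apply: hT'; exact: ler_norm.
  have lts : sqdist a T < s by lra.
  have [||u iu eu] := @IVT _ (sqdist a) T T' s (ltW TT').
  + exact: continuous_subspaceT.
  + by rewrite min_l ?max_r ?(ltW (lt_trans lts sT'))// !ltW.
  exists u => //; move: iu; rewrite in_itv /= => /andP[iu1 iu2].
  by rewrite lt_neqAle iu1 andbT; apply/eqP => e'; move: lts; rewrite e' eu ltxx.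
- move=> s /= s1; have [T' TT' hT'] := far s.
  have sT' : s < sqdist a (- T') by apply: hT'; rewrite normrN; exact: ler_norm.
  have lts : sqdist a (- T) < s by lra.
  have [|||u iu eu] := @IVT _ (sqdist a) (- T') (- T) s; first lra.
  + exact: continuous_subspaceT.
  + by rewrite min_r ?max_l ?(ltW (lt_trans lts sT'))// !ltW.
  exists u => //; move: iu; rewrite in_itv /= => /andP[iu1 iu2].
  by rewrite lt_neqAle iu2 andbT; apply/eqP => e'; move: lts; rewrite -e' eu ltxx.
- move=> t /= h; have [lt|tT] := ltP T t; first by left.
  have [lt|Tt] := ltP t (- T); first by right.
  by have := hc t ltac:(by rewrite in_itv /= Tt tT); lra.
Qed.

End Strands.

(** * The case where the preimage of the line is empty *)

Section Winding.
Variable R : realType.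
Local Notation V := 'rV[R]_3.

Lemma hausdorff_row : hausdorff_space V.
Proof. exact: norm_hausdorff. Qed.

(** Angles in a sup-norm ball of radius 1 differ by less than 2, while [polar] identifies only
    multiples of [2 * pi >= 4]. *)
Lemma polar_locally_injective (x : V) :
  exists2 U : set V, nbhs x U & {in U &, injective (@polar R)}.
Proof.
exists (ball x 1); first exact: nbhsx_ballx.
move=> u v /set_mem xu /set_mem xv /polar_eq[n e].
have h : `|u ord0 0 - v ord0 0| < 2.
  have := coord_le_norm (u - v) 0; rewrite !mxE => /le_lt_trans; apply.
  have -> : u - v = (u - x) + (x - v) by rewrite addrA subrK.
  apply: (le_lt_trans (ler_normD _ _)).
  by move: xu xv; rewrite -!ball_normE /ball_ /= (distrC x u) => h1 h2; lra.
suff n0 : n = 0%N.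
  by case: e => ->; rewrite n0 mulr0n addr0; apply: row3P; rewrite !vec3E.
apply/eqP; rewrite -leqn0 leqNgt; apply/negP => n1.
have : `|u ord0 0 - v ord0 0| = pi *+ 2 *+ n.
  have p0 : 0 <= pi *+ 2 *+ n :> R by apply: mulrn_wge0; apply: mulrn_wge0; exact: pi_ge0.
  case: e => ->; rewrite vec3E.
  - by rewrite opprD addrA subrr sub0r normrN ger0_norm.
  - by rewrite [_ + _ *+ _]addrC addrK ger0_norm.
have p2 : 2 <= pi :> R by exact: pi_ge2.
have : (1 : R) <= n%:R by rewrite ler1n.
rewrite -mulr_natl -mulr_natl => h1 h2.
have : 1 * (2 * 2) <= n%:R * (2%:R * pi) :> R by apply: ler_pM => //; lra.
lra.
Qed.

Lemma polar_lift (H : V -> V) : continuous H -> (forall u, 0 < H u ord0 0 ^+ 2 + H u ord0 1 ^+ 2) ->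
  exists G : V -> V, continuous G /\ forall u, polar (G u) = H u.
Proof.
move=> cH H0; have [x0 x0E] := polar_surj (H0 0).
have [s ls _] : exists2 s : V -> V, lift_on (@polar R) set0 H setT s & s 0 = x0.
  apply: (lift_global hausdorff_row polar_locally_injective) => //.
  - exact: closed0.
  - by move=> C _ /is_convex_connected; rewrite setD0.
  - by move=> C; rewrite setD0.
  move=> y; have [xy xyE] := polar_surj (H0 y).
  have [br [_ brP]] := polar_branch xy; rewrite xyE in brP.
  have := @cH y _ brP => /nbhs_ballP[d /= d0 dP].
  exists d => // z x yz _ xE.
  have [_ brz] := dP z yz; rewrite /= -xE in brz.
  have [n nE] := polar_eq brz.
  pose sft (c : R) (u : V) : V := vec3 (u ord0 0 + c) (u ord0 1) (u ord0 2).
  have csft c u : {for u, continuous (sft c)}.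
    exact: (cont_vec3 (cont_add (cont_proj (0 : 'I_3) u) (cont_cst _ u))
      (cont_proj (1 : 'I_3) u) (cont_proj (2 : 'I_3) u)).
  have [c [cx cp]] : exists c, x = sft c (br (H z)) /\ forall u, polar (sft c u) = polar u.
    case: nE => [e|e].
      exists (pi *+ 2 *+ n); rewrite /sft -xE; split => // u; exact: polar_shift.
    exists (- (pi *+ 2 *+ n)); rewrite -xE e /sft !vec3E addrK; split.
      by apply: row3P; rewrite !vec3E.
    by move=> u; rewrite -[LHS](polar_shift _ n) !vec3E subrK; congr polar; apply: row3P; rewrite !vec3E.
  exists (fun w => sft c (br (H w))); last by rewrite -cx.
  move=> w yw _; have [cbr brw] := dP w yw.
  split; last by rewrite cp.
  exact: (cont_comp (cont_comp (@cH w) cbr) (csft c _)).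
by exists s; split => u; have [] := ls u I (fun f => f).
Qed.

(** Homotopy invariance of the winding number: [H] deforms the loop at [t1] into the constant loop
    at [t0] within the punctured plane. The lift through [polar] closes up at [t0], hence by
    uniqueness at every [t]. *)
Lemma no_winding (H : V -> V) (Phi t0 t1 : R) : continuous H ->
  (forall u, 0 < H u ord0 0 ^+ 2 + H u ord0 1 ^+ 2) ->
  (forall t, H (vec3 Phi t 0) = H (vec3 0 t 0)) ->
  (forall phi, H (vec3 phi t0 0) = H (vec3 0 t0 0)) ->
  exists A r : R -> R, [/\ continuous A, A Phi = A 0, forall phi, 0 < r phi &
    forall phi, H (vec3 phi t1 0) ord0 0 = r phi * cos (A phi) /\
      H (vec3 phi t1 0) ord0 1 = r phi * sin (A phi)].
Proof.
move=> cH H0 Hper Hcst; have [G [cG GE]] := polar_lift cH H0.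
have cR : connected [set: R] by apply: (@is_convex_connected R R^o).
have uniq (a b : R -> V) : continuous a -> continuous b ->
    (forall t, polar (a t) = polar (b t)) -> forall t t', a t = b t -> a t' = b t'.
  move=> ca cb ab t t' e.
  have ab' (z : R) : \forall w \near z, polar (a w) = polar (b w).
    exact: (@filterE _ (nbhs z) (nbhs_filter z)).
  exact: (lift_unique hausdorff_row polar_locally_injective cR (fun z _ => ca z)
    (fun z _ => cb z) (fun z _ => ab' z) (I : setT t) e (I : setT t')).
have cv1 (t : R) : continuous (fun p : R => vec3 p t 0 : V).
  by move=> p; exact: (cont_vec3 (cont_id p) (cont_cst t p) (cont_cst 0 p)).
have cv2 (p : R) : continuous (fun t : R => vec3 p t 0 : V).
  by move=> t; exact: (cont_vec3 (cont_cst p t) (cont_id t) (cont_cst 0 t)).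
have cG1 t : continuous (fun p : R => G (vec3 p t 0)).
  by move=> p; exact: (cont_comp (@cv1 t p) (@cG _)).
have cG2 p : continuous (fun t : R => G (vec3 p t 0)).
  by move=> t; exact: (cont_comp (@cv2 p t) (@cG _)).
have e0 : G (vec3 Phi t0 0) = G (vec3 0 t0 0).
  apply: (uniq (fun p => G (vec3 p t0 0)) (fun=> G (vec3 0 t0 0)) (cG1 t0) _ _ 0 Phi) => //.
    by move=> p; exact: cont_cst.
  by move=> p; rewrite !GE.
have e1 : G (vec3 Phi t1 0) = G (vec3 0 t1 0).
  apply: (uniq (fun t => G (vec3 Phi t 0)) (fun t => G (vec3 0 t 0)) (cG2 _) (cG2 _) _ t0 t1) => //.
  by move=> t; rewrite !GE.
exists (fun p => G (vec3 p t1 0) ord0 0), (fun p => expR (G (vec3 p t1 0) ord0 1)); split.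
- by move=> p; exact: (cont_coord (@cG1 t1 p)).
- by rewrite e1.
- by move=> p; exact: expR_gt0.
- by move=> p; rewrite -GE /polar !vec3E.
Qed.

End Winding.

(** * Moving the centre of a field of perpendicular vectors *)

Section Transport.
Variable R : realType.
Local Notation V := 'rV[R]_3.

Lemma orthogonal_exists (u : V) : exists2 v : V, v <> 0 & dot u v = 0.
Proof.
have [[u0 u1]|n01] := pselect (u ord0 0 = 0 /\ u ord0 1 = 0).
- exists (vec3 1 0 0); last by rewrite /dot !vec3E u0; ring.
  by move=> /(congr1 (fun w : V => w ord0 0)); rewrite vec3E mxE => /eqP; rewrite oner_eq0.
- exists (vec3 (u ord0 1) (- u ord0 0) 0); last by rewrite /dot !vec3E; ring.
  move=> e; apply: n01; split.
    have := congr1 (fun w : V => w ord0 1) e; rewrite /= vec3E mxE => /eqP.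
    by rewrite oppr_eq0 => /eqP.
  by have := congr1 (fun w : V => w ord0 0) e; rewrite /= vec3E mxE.
Qed.

Lemma dot_cross_cross (v d u : V) :
  dot (cross v d) (cross v u) = dot v v * dot d u - dot v u * dot d v.
Proof. by rewrite /dot /cross !vec3E; ring. Qed.

Variable K : set V.

Definition perp_field (c : V) (w : V -> V) := forall x, K x ->
  [/\ {for x, continuous w}, w x <> 0 & dot (w x) (x - c) = 0].

Hypothesis cK : compact K.

(** The projection vanishes only where [w x] is parallel to [x - c']. This is excluded, as [w x] is
    perpendicular to [x - c], which makes an acute angle with [x - c']. *)
Lemma perp_field_step c c' w : (forall x, K x -> 0 < dot (x - c) (x - c')) ->
  perp_field c w -> exists w', perp_field c' w'.
Proof.
move=> h pw; pose D x : V := x - c'.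
exists (fun x => w x - (dot (w x) (D x) / dot (D x) (D x)) *: D x) => x Kx.
have [cw w0 wc] := pw x Kx.
have cD : {for x, continuous D} by exact: (cont_addv (cont_id x) (cont_cst (- c') x)).
have D0 : dot (D x) (D x) != 0.
  apply/eqP => /dot_eq0 e; have := h x Kx; rewrite -/(D x) e.
  by rewrite dotC dot0l ltxx.
split.
- exact: (cont_addv cw (cont_oppv (cont_scalev (cont_mul (cont_dot cw cD)
    (cont_inv (cont_dot cD cD) D0)) cD))).
- move=> e; have {}e : w x = (dot (w x) (D x) / dot (D x) (D x)) *: D x by exact: subr0_eq.
  have hx : dot (D x) (x - c) != 0 by rewrite dotC gt_eqF//; exact: h.
  move: wc; rewrite e dotZl => /eqP; rewrite mulf_eq0 (negbTE hx) orbF => /eqP l0.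
  by apply: w0; rewrite e l0 scale0r.
- by rewrite -/(D x) dotDl dotNl dotZl divfK// subrr.
Qed.

(** For [v] perpendicular to [c], the field [cross v (x - c)] could vanish only if [x - c] were
    parallel to [v], but [dot (x - c) c] is negative. *)
Lemma perp_field_far (c : V) : (forall x, K x -> dot x c < dot c c) -> exists w, perp_field c w.
Proof.
move=> h; have [v v0 cv] := orthogonal_exists c.
exists (fun x => cross v (x - c)) => x Kx; split.
- exact: (cont_cross (cont_cst v x) (cont_addv (cont_id x) (cont_cst (- c) x))).
- move=> e; have := dot_cross_cross v (x - c) c; rewrite e dot0l (dotC v c) cv mul0r subr0.
  move=> /esym/eqP; rewrite mulf_eq0 gt_eqF ?dot_gt0//= dotDl dotNl => /eqP.
  by have := h x Kx; lra.
- by rewrite dotC dot_crossr.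
Qed.

(* As [t] decreases from a large value to [0], the field perpendicular to [x - f t] is
   repeatedly projected; this is possible because [f t] stays off the compact [K]. *)
Lemma perp_field_transport (f : R -> V) : continuous f ->
  (forall x t, K x -> 0 <= t -> x <> f t) ->
  (forall M, exists2 t, 0 <= t & forall x, `|x| <= M -> dot x (f t) < dot (f t) (f t)) ->
  exists w, perp_field (f 0) w.
Proof.
move=> cf Kf far.
have [B [_ BP]] := compact_bounded cK.
have [T T0 TP] := far (B + 1).
have [w0 pw0] : exists w, perp_field (f T) w.
  by apply: perp_field_far => x Kx; apply: TP; apply: BP => //; lra.
have [[x0 Kx0]|K0] := pselect (K !=set0); last first.
  by exists w0 => x Kx; case: K0; exists x.
pose U : set R := [set t | exists w, perp_field (f t) w].
have key (t : R) : 0 <= t -> (\forall s \near t, U s) \/ (\forall s \near t, ~ U s).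
  move=> t0; pose q (x : V) := dot (x - f t) (x - f t).
  have cq : continuous q.
    move=> x; have cz := cont_addv (cont_id x) (cont_cst (- f t) x); exact: (cont_dot cz cz).
  have [m /set_mem Km mP] := compact_EVT_min (ex_intro _ x0 Kx0) cK (continuous_subspaceT cq).
  have qm : 0 < q m by apply: dot_gt0 => /subr0_eq; exact: Kf.
  (* With [b] and [c] shorter than a quarter of [a], the vectors [a - b] and [a - c] make an acute
     angle, as [perp_field_step] requires. *)
  have near_small : \forall s \near t, dot (f s - f t) (f s - f t) < q m / 16.
    have cc : {for t, continuous (fun s : R => dot (f s - f t) (f s - f t))}.
      have cz := cont_addv (cf t) (cont_cst (- f t) t); exact: (cont_dot cz cz).
    have : \forall s \near t, ball (dot (f t - f t) (f t - f t)) (q m / 16) (dot (f s - f t) (f s - f t)).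
      by apply: cc; apply: nbhsx_ballx; rewrite divr_gt0.
    apply: filterS => s; rewrite subrr dot0l -ball_normE /ball_ /= sub0r normrN.
    by rewrite ger0_norm// dot_ge0.
  have step s s' : dot (f s - f t) (f s - f t) < q m / 16 ->
      dot (f s' - f t) (f s' - f t) < q m / 16 -> U s -> U s'.
    move=> hs hs' [w pw]; apply: (perp_field_step _ pw) => x Kx.
    have qx : q m <= q x by apply: mP; rewrite inE.
    have -> : x - f s = (x - f t) + (- 1) *: (f s - f t).
      by rewrite scaleN1r opprB addrA subrK.
    have -> : x - f s' = (x - f t) + (- 1) *: (f s' - f t).
      by rewrite scaleN1r opprB addrA subrK.
    move: hs hs' qx; rewrite /q; set a := x - f t; set b := f s - f t; set c := f s' - f t.
    move=> hb hc ha.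
    have -> : dot (a + (-1) *: b) (a + (-1) *: c) = dot a a - dot a b - dot a c + dot b c.
      by rewrite /dot !mxE; ring.
    have cs u : 0 <= dot a a - 8 * dot a u + 16 * dot u u.
      have -> : dot a a - 8 * dot a u + 16 * dot u u = dot (a + (-4) *: u) (a + (-4) *: u).
        by rewrite dot_comb; ring.
      exact: dot_ge0.
    have h1 := cs b; have h2 := cs c; have h3 := dot_ge0 (b + c).
    have h5 := dot_ge0 b; have h6 := dot_ge0 c.
    have h4 : dot (b + c) (b + c) = dot b b + dot b c *+ 2 + dot c c.
      by rewrite /dot !mxE; ring.
    rewrite h4 in h3.
    clearbody a b c; lra.
  have [Us|nUs] := pselect (exists2 s, dot (f s - f t) (f s - f t) < q m / 16 & U s).
    by left; case: Us => s hs Us; apply: filterS near_small => s' hs'; exact: step Us.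
  by right; apply: filterS near_small => s hs Us; apply: nUs; exists s.
have conv : connected [set t : R | 0 <= t].
  apply: (@is_convex_connected R R^o) => x y t x0' y0' t0 t1 /=.
  have h1 : 0 <= (1 - t) * x by rewrite mulr_ge0// subr_ge0.
  have h2 : 0 <= t * y by rewrite mulr_ge0.
  by rewrite /GRing.scale /=; lra.
suff : interior U 0 by move/interior_subset.
apply: (connected_open_split conv (@open_interior _ U) (@open_interior _ (~` U))) => //.
- by move=> t _ /interior_subset Ut /interior_subset.
- by exists T => //; case: (key T T0) => // /nbhs_singleton []; exists w0.
- by rewrite /= lexx.
Qed.

End Transport.

Section TripleProduct.
Variable R : realType.
Local Notation V := 'rV[R]_3.
Implicit Types u a b c : V.

(** Let the plane perpendicular to a unit vector [u] be the complex line. Then [dot a b] and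
    [triple u a b] are the real and imaginary parts of the conjugate of [a] times [b]. *)
Definition triple u a b := dot u (cross a b).

Lemma triple_sqr u a b : dot u a = 0 -> dot u b = 0 ->
  triple u a b ^+ 2 = dot u u * (dot a a * dot b b - dot a b ^+ 2).
Proof.
move=> ua ub.
have -> : triple u a b ^+ 2 = dot u u * (dot a a * dot b b - dot a b ^+ 2)
    - dot u a * (dot u a * dot b b - dot a b * dot u b)
    + dot u b * (dot u a * dot a b - dot a a * dot u b).
  by rewrite /triple /dot /cross !vec3E; ring.
by rewrite ua ub; ring.
Qed.

(** With [triple_im], the complex identity that composes the angle from [a] to [b] with the angle
    from [b] to [c]. *)
Lemma triple_re u a b c : dot u u = 1 -> dot u a = 0 -> dot u b = 0 -> dot u c = 0 ->
  dot b b * dot a c = dot a b * dot b c - triple u a b * triple u b c.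
Proof.
move=> uu ua ub uc.
have -> : triple u a b * triple u b c = dot u u * (dot a b * dot b c - dot a c * dot b b)
    - dot u b * (dot u a * dot b c - dot a c * dot u b)
    + dot u c * (dot u a * dot b b - dot a b * dot u b).
  by rewrite /triple /dot /cross !vec3E; ring.
by rewrite uu ub uc; ring.
Qed.

Lemma triple_im u a b c : dot u b = 0 ->
  dot b b * triple u a c = dot a b * triple u b c + triple u a b * dot b c.
Proof.
move=> ub.
have -> : dot b b * triple u a c = dot a b * triple u b c + triple u a b * dot b c
    - triple a b c * dot u b.
  by rewrite /triple /dot /cross !vec3E; ring.
by rewrite ub; ring.
Qed.

End TripleProduct.

Section Unbranched.
Variable R : realType.
Local Notation V := 'rV[R]_3.

Lemma cos_le (x y : R) : 0 <= x -> x <= y -> y <= pi -> cos y <= cos x.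
Proof.
move=> x0 xy ypi; have [->//|nxy] := eqVneq x y.
apply: ltW; rewrite ltr_cos ?in_itv /= ?x0 ?ypi ?(le_trans xy ypi) ?(le_trans x0 xy)//.
by rewrite lt_neqAle nxy.
Qed.

(* Pullbacks of the constant field [e] under the stereographic projections from [N] and [-N]. *)
Lemma stereographic_fields (d N e : V) (q := (1 - dot d N) *: e + (- dot d e) *: (d - N))
  (p := (1 + dot d N) *: e + (- dot d e) *: (d + N)) :
  dot d d = 1 -> dot N N = 1 -> dot e e = 1 -> dot N e = 0 ->
  [/\ dot q q = (1 - dot d N) ^+ 2, dot p p = (1 + dot d N) ^+ 2, dot d q = 0 /\ dot d p = 0,
    dot q p = 1 - dot d N ^+ 2 - 2 * dot d e ^+ 2 &
    triple d q p = 2 * dot d e * dot d (cross N e)].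
Proof.
move=> dd NN ee Ne.
have eN : dot e N = 0 by rewrite dotC.
split; last by rewrite /q /p /triple /dot /cross !vec3E !mxE; ring.
- by rewrite /q dot_comb2 !dotDl !dotDr !dotNl !dotNr dd NN ee (dotC N d) (dotC e d) eN; ring.
- by rewrite /p dot_comb2 !dotDl !dotDr dd NN ee (dotC N d) (dotC e d) eN; ring.
- by rewrite /q /p !(dotDr, dotZr, dotNr) dd; split; ring.
- rewrite /q /p !(dotDl, dotZl, dotNl) !(dotDr, dotZr, dotNr) dd NN ee Ne (dotC N d) (dotC e d) eN.
  by ring.
Qed.

Lemma angle_addition (x y x' y' A A' r r' : R) : x = r * cos A -> y = r * sin A ->
  x' = r' * cos A' -> y' = r' * sin A' ->
  x * x' - y * y' = r * r' * cos (A + A') /\ x * y' + y * x' = r * r' * sin (A + A').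
Proof. by move=> -> -> -> ->; rewrite cosD sinD; split; ring. Qed.

(** [no_winding] for the complex number comparing two tangent fields along [g]. The side [t = t0] of
    the rectangle collapses to a point, so the relative angle along the side [t = t1] returns to its
    initial value. *)
Lemma field_angle (y0 : V) (r Phi a b t0 t1 : R) (g w w' : V -> V) :
  0 < r -> 0 <= Phi -> a <= t0 <= b -> a <= t1 <= b -> continuous g ->
  (forall phi t, 0 <= phi <= Phi -> a <= t <= b -> let x := g (vec3 phi t 0) in
    [/\ {for x, continuous w} /\ {for x, continuous w'}, w x <> 0 /\ w' x <> 0, x <> y0 &
        dot (x - y0) (w x) = 0 /\ dot (x - y0) (w' x) = 0]) ->
  (forall t, a <= t <= b -> g (vec3 Phi t 0) = g (vec3 0 t 0)) ->
  (forall phi, 0 <= phi <= Phi -> g (vec3 phi t0 0) = g (vec3 0 t0 0)) ->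
  exists A rho : R -> R, [/\ continuous A, A Phi = A 0, forall phi, 0 < rho phi &
    forall phi, 0 <= phi <= Phi -> let x := g (vec3 phi t1 0) in
      dot (w x) (w' x) = rho phi * cos (A phi) /\
      triple (r^-1 *: (x - y0)) (w x) (w' x) = rho phi * sin (A phi)].
Proof.
move=> r0 Phi0 t0ab t1ab cg hw gper gcst.
(* Clamping extends the data from the rectangle to the whole space, on which [no_winding] is
   stated. *)
pose cl (lo hi x : R) := Num.max lo (Num.min hi x).
have clI lo hi x : lo <= hi -> lo <= cl lo hi x <= hi.
  by move=> lh; rewrite /cl le_max lexx /= ge_max lh /= ge_min lexx.
have clE lo hi x : lo <= x <= hi -> cl lo hi x = x.
  by move=> /andP[lx xh]; rewrite /cl min_r// max_r.
have ccl lo hi x : {for x, continuous (cl lo hi)}.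
  by apply: (continuous_max (f := fun=> lo)); [exact: cvg_cst|
    apply: (continuous_min (f := fun=> hi)); [exact: cvg_cst|exact: cvg_id]].
have ab : a <= b by case/andP: t0ab => /le_trans; apply.
pose C (u : V) : V := vec3 (cl 0 Phi (u ord0 0)) (cl a b (u ord0 1)) 0.
have cC u : {for u, continuous C}.
  exact: (cont_vec3 (cont_comp (cont_proj (0 : 'I_3) u) (ccl _ _ _))
    (cont_comp (cont_proj (1 : 'I_3) u) (ccl _ _ _)) (cont_cst 0 u)).
pose X u := g (C u).
have cX u : {for u, continuous X} by exact: (cont_comp (cC u) (@cg _)).
have hX u : let x := X u in
    [/\ {for x, continuous w} /\ {for x, continuous w'}, w x <> 0 /\ w' x <> 0, x <> y0 &
        dot (x - y0) (w x) = 0 /\ dot (x - y0) (w' x) = 0] by apply: hw; exact: clI.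
pose H u : V := vec3 (dot (w (X u)) (w' (X u))) (triple (r^-1 *: (X u - y0)) (w (X u)) (w' (X u))) 0.
have cH : continuous H.
  move=> u; have [[cw cw'] _ _ _] := hX u.
  have cwX := cont_comp (cX u) cw; have cwX' := cont_comp (cX u) cw'.
  have cd := cont_scalev (cont_cst r^-1 u) (cont_addv (cX u) (cont_cst (- y0) u)).
  exact: (cont_vec3 (cont_dot cwX cwX') (cont_dot cd (cont_cross cwX cwX')) (cont_cst 0 u)).
have H0 u : 0 < H u ord0 0 ^+ 2 + H u ord0 1 ^+ 2.
  have [_ [w0 w0'] xy [d1 d2]] := hX u.
  rewrite /H !vec3E triple_sqr ?dotZl ?d1 ?d2 ?mulr0//.
  have D0 : 0 < dot (X u - y0) (X u - y0) by apply: dot_gt0 => /subr0_eq.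
  have p1 := dot_gt0 w0; have p2 := dot_gt0 w0'.
  set q := dot (w (X u)) (w' (X u)).
  have rr : 0 < r^-1 * dot (X u - y0) (r^-1 *: (X u - y0)).
    by rewrite dotZr !mulr_gt0// invr_gt0.
  have [q0|q0] := eqVneq q 0.
    by rewrite q0 expr0n/= add0r subr0 mulr_gt0// mulr_gt0.
  have := triple_sqr d1 d2; rewrite -/q => e.
  have h : 0 <= dot (w (X u)) (w (X u)) * dot (w' (X u)) (w' (X u)) - q ^+ 2.
    by rewrite -(pmulr_rge0 _ D0) -e sqr_ge0.
  by rewrite ltr_pwDl ?exprn_even_gt0// mulr_ge0// ltW.
have H1 t : H (vec3 Phi t 0) = H (vec3 0 t 0).
  suff e : X (vec3 Phi t 0) = X (vec3 0 t 0) by rewrite /H e.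
  rewrite /X /C !vec3E (clE 0 Phi Phi) ?lexx ?Phi0// (clE 0 Phi 0) ?lexx ?Phi0//.
  by apply: gper; exact: clI.
have H2 p : H (vec3 p t0 0) = H (vec3 0 t0 0).
  suff e : X (vec3 p t0 0) = X (vec3 0 t0 0) by rewrite /H e.
  rewrite /X /C !vec3E (clE a b t0)// (clE 0 Phi 0) ?lexx ?Phi0//.
  by apply: gcst; exact: clI.
have [A [rho [cA A0 rho0 AE]]] := @no_winding R H Phi t0 t1 cH H0 H1 H2.
exists A, rho; split => // phi hphi.
have e : X (vec3 phi t1 0) = g (vec3 phi t1 0).
  by rewrite /X /C !vec3E !clE.
by rewrite /= -e; have := AE phi; rewrite /H !vec3E.
Qed.

(** [dot x c] is at most the mean of [dot x x] and [dot c c], and [dot x x <= 3 * M ^+ 2 <= (2 * M)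
    ^+ 2 < dot c c]. *)
Lemma dot_lt_far (x c : V) (M : R) : `|x| <= M -> 2 * M < `|c| -> dot x c < dot c c.
Proof.
move=> xM Mc; have M0 : 0 <= M by exact: le_trans (normr_ge0 _) xM.
have h1 : `|x| ^+ 2 <= M ^+ 2 by rewrite ler_pXn2r ?nnegrE.
have h2 : (2 * M) ^+ 2 < `|c| ^+ 2 by rewrite ltr_pXn2r ?nnegrE ?mulr_ge0.
rewrite exprMn in h2.
have h3 := dot_le_norm x; have h4 := norm_le_dot c.
have h5 := dot_ge0 (x + (-1) *: c); rewrite dot_comb in h5.
have h6 := sqr_ge0 M.
have e1 : (-1 : R) ^+ 2 = 1 by ring.
have e2 : (2 : R) ^+ 2 = 4 by ring.
rewrite e1 in h5; rewrite e2 in h2; lra.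
Qed.

Lemma unit_orthogonal (N : V) : exists e : V, dot e e = 1 /\ dot N e = 0.
Proof.
have [v v0 Nv] := orthogonal_exists N; have vp := dot_gt0 v0.
exists ((Num.sqrt (dot v v))^-1 *: v); split; last by rewrite dotZr Nv mulr0.
rewrite dotZl dotZr mulrA -invfM -expr2 sqr_sqrtr ?ltW// mulVf// gt_eqF//.
Qed.

Variables (F : V -> V) (L : set V).
Hypotheses (cF : continuous F) (invF : locally_invertible F) (injF : locally_injective F).
Hypothesis cLc : connected (~` L).
Hypothesis LP : forall y, L y <-> forall e M : R, 0 < e -> exists x, M < `|x| /\ `|F x - y| < e.
Hypothesis FL : forall x, ~ L (F x).
Variable f : R -> V.
Hypotheses (cf : continuous f) (Lf : forall t, L (f t)) (fL : forall y, L y -> exists t, f t = y).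
Hypothesis far : forall M, exists T, forall t, T <= `|t| -> M < `|f t|.
Variables (r : R) (P Q : V).
Hypotheses (r0 : 0 < r) (PP : dot P P = r ^+ 2) (QQ : dot Q Q = r ^+ 2) (PQ : P <> Q).
Hypothesis f_right : forall t, 0 <= t -> dot (f t - f 0) (f t - f 0) = r ^+ 2 -> f t = f 0 + P.
Hypothesis f_left : forall t, t <= 0 -> dot (f t - f 0) (f t - f 0) = r ^+ 2 -> f t = f 0 + Q.

Let locL := local_sections_off cF invF injF LP.

Lemma surjective_off y : ~ L y -> exists x, F x = y.
Proof.
move=> nLy.
have oT : open (F @` setT) by exact: (open_image invF openT).
have oC : open (interior (~` (F @` setT))) by exact: open_interior.
have [|||x _ <-] := connected_open_split cLc oT oC _ _ _ nLy; last by exists x.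
- move=> z nLz; have [d d0 dP] := locL nLz.
  have [[w [v _ vw] zw]|nw] := pselect (exists2 w, (F @` setT) w & ball z d w).
    left; rewrite -vw in zw; have [s ls _] := dP v zw.
    by have [_ e] := ls z (ballxx _ d0); exists (s z).
  right; apply/nbhs_ballP; exists d => // w zw Fw; apply: nw; exists w => //.
- by move=> z _ Fz /interior_subset; apply.
- by exists (F 0); [exact: FL|exists 0].
Qed.

(** The points [u n] over [mu 0] stay in a compact ball. Two of them enter a neighbourhood on which
    [F] is injective, so they coincide, and the lift restarted at the earlier one closes up. *)
Lemma loop_lift_periodic (mu : R -> V) : continuous mu -> (forall t, ~ L (mu t)) ->
  (forall t, mu (t + pi *+ 2) = mu t) ->
  exists (c : R -> V) n, [/\ continuous c, forall t, F (c t) = mu t, (0 < n)%N &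
    c (pi *+ 2 *+ n) = c 0].
Proof.
move=> cmu muL mup; have [x0 Fx0] := surjective_off (muL 0).
have chmu : continuous (fun u : V => mu (u ord0 0)).
  by move=> u; exact: (cont_comp (cont_proj (0 : 'I_3) u) (@cmu _)).
have Fx0' : F x0 = mu ((0 : V) ord0 0) by rewrite mxE.
have [s sP s0] := lift_off (@hausdorff_row R) injF locL chmu (fun u => muL _) Fx0'.
pose c t := s (vec3 t 0 0).
have cc : continuous c.
  move=> t; have cv := cont_vec3 (cont_id t) (cont_cst (0 : R) t) (cont_cst (0 : R) t).
  exact: (cont_comp cv (sP _).1).
have Fc t : F (c t) = mu t by rewrite (sP _).2 vec3E.
have muper n t : mu (t + pi *+ 2 *+ n) = mu t by exact: (periodicn mup).
pose u n := c (pi *+ 2 *+ n).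
have Fu n : F (u n) = mu 0 by rewrite Fc -[pi *+ 2 *+ n]add0r muper.
have [M MP] := proper_compact LP (@compact_set1 _ (mu 0)) (fun y e => eq_ind_r (fun z => ~ L z) (muL 0) e).
have [n [m [nm unm]]] : exists n m, (n < m)%N /\ u n = u m.
  have cK := @compact_norm_ball R 3 0 M.
  have uK : (u @ \oo) [set w | `|0 - w| <= M].
    by exists 0%N => // n _ /=; rewrite sub0r normrN; apply: MP; rewrite Fu.
  have [x [_ clx]] := cK _ _ uK.
  have [U nU iU] := injF x.
  have tail k : (u @ \oo) (u @` [set n | (k <= n)%N]).
    by exists k => // n /= kn; exists n.
  have [_ [[n _ <-] Un]] := clx _ _ (tail 0%N) nU.
  have [_ [[m /= nm <-] Um]] := clx _ _ (tail n.+1) nU.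
  by exists n, m; split => //; apply: iU; rewrite ?inE ?Fu.
exists (fun t => c (t + pi *+ 2 *+ n)), (m - n)%N; split.
- by move=> t; exact: (cont_comp (cont_add (cont_id t) (cont_cst _ t)) (@cc _)).
- by move=> t; rewrite Fc muper.
- by rewrite subn_gt0.
- have e : pi *+ 2 *+ (m - n) + pi *+ 2 *+ n = pi *+ 2 *+ m :> R.
    by rewrite -mulrnDr; congr (_ *+ _); rewrite subnK// ltnW.
  by rewrite e add0r; exact: esym unm.
Qed.

(* Around the strand of [L] through [f 0], a lifted loop closes up after [n] turns and can be
   contracted in the complement of [F^-1(L)], i.e. in the whole space.  Comparing two tangent
   fields that exist off the half lines [f t], t >= 0 and t <= 0, the winding number along the
   loop is 0 because of the contraction and 2n because of the Euler number of the sphere. *)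
Theorem unbranched_case : False.
Proof.
pose y0 := f 0; pose N := r^-1 *: P.
have rn : r != 0 by rewrite gt_eqF.
have NN : dot N N = 1 by rewrite /N dotZl dotZr PP; field.
have PN : P = r *: N by rewrite /N scalerA divff// scale1r.
have [e1 [e11 Ne1]] := unit_orthogonal N.
pose e2 := cross N e1.
have Ne2 : dot N e2 = 0 by exact: dot_crossl.
have e1e2 : dot e1 e2 = 0 by exact: dot_crossr.
have e22 : dot e2 e2 = 1 by rewrite /e2 dot_cross NN e11 Ne1; ring.
pose cq := dot (r^-1 *: Q) N.
have cq1 : cq < 1.
  have D0 : 0 < dot (Q - P) (Q - P) by apply: dot_gt0 => /subr0_eq/esym.
  have : dot (Q - P) (Q - P) = r ^+ 2 * (2 - 2 * cq).
    rewrite !dotDl !dotDr !dotNl !dotNr QQ PP (dotC P Q) /cq /N dotZl dotZr; field.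
    exact: rn.
  by move=> e; rewrite e pmulr_rgt0 ?exprn_gt0// in D0; lra.
have cqN1 : -1 <= cq.
  have D0 := dot_ge0 (Q + P).
  have : dot (Q + P) (Q + P) = r ^+ 2 * (2 + 2 * cq).
    rewrite !dotDl !dotDr QQ PP (dotC P Q) /cq /N dotZl dotZr; field.
    exact: rn.
  by move=> e; rewrite e pmulr_rge0 ?exprn_gt0// in D0; lra.
have cqE : dot (r^-1 *: Q) N = cq by [].
(* The cosine of [psi] is midway between 1, belonging to [P], and [cq], belonging to [Q], so the
   circle of colatitude [psi] separates the two strands. It is nonnegative, which keeps [hp] nonzero
   on the cap about [N]. *)
clearbody cq N; pose psi := acos ((1 + cq) / 2).
have hc : -1 <= (1 + cq) / 2 <= 1 by apply/andP; split; lra.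
have cpsi : cos psi = (1 + cq) / 2 by rewrite /psi acosK// in_itv.
have cpsi1 : cos psi < 1 by rewrite cpsi; lra.
have cpsiq : cq < cos psi by rewrite cpsi; lra.
have cpsi0 : 0 <= cos psi by rewrite cpsi; lra.
have psi0 : 0 <= psi by rewrite acos_ge0.
have psipi : psi <= pi by rewrite acos_lepi.
have spsi : 0 < sin psi ^+ 2.
  have := cos2Dsin2 psi; rewrite cpsi => h.
  have : ((1 + cq) / 2) ^+ 2 < 1.
    rewrite expr2; have h1 : 0 <= (1 + cq) / 2 by lra.
    have h2 : (1 + cq) / 2 < 1 by lra.
    apply: le_lt_trans h2; rewrite -[leRHS]mulr1; apply: ler_wpM2l => //; lra.
  lra.
pose dir (u : V) : V := cos (u ord0 1) *: N + ((sin (u ord0 1) * cos (u ord0 0)) *: e1 +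
  (sin (u ord0 1) * sin (u ord0 0)) *: e2).
pose sph u := y0 + r *: dir u.
have cdir u : {for u, continuous dir}.
  have c0 := cont_proj (0 : 'I_3) u; have c1 := cont_proj (1 : 'I_3) u.
  have cc0 := cont_comp (g := @cos R) c0 (@continuous_cos R _).
  have cs0 := cont_comp (g := @sin R) c0 (@continuous_sin R _).
  have cc1 := cont_comp (g := @cos R) c1 (@continuous_cos R _).
  have cs1 := cont_comp (g := @sin R) c1 (@continuous_sin R _).
  exact: (cont_addv (cont_scalev cc1 (cont_cst N u)) (cont_addv
    (cont_scalev (cont_mul cs1 cc0) (cont_cst e1 u))
    (cont_scalev (cont_mul cs1 cs0) (cont_cst e2 u)))).
have csph : continuous sph.
  by move=> u; exact: (cont_addv (cont_cst y0 u) (cont_scalev (cont_cst r u) (cdir u))).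
have sphE u : sph u - y0 = r *: dir u by rewrite /sph addrC addKr.
have dirN u : dot (dir u) N = cos (u ord0 1).
  by rewrite /dir !dotDl !dotZl NN (dotC e1) (dotC e2) Ne1 Ne2; ring.
have dire1 u : dot (dir u) e1 = sin (u ord0 1) * cos (u ord0 0).
  by rewrite /dir !dotDl !dotZl Ne1 e11 (dotC e2) e1e2; ring.
have dire2 u : dot (dir u) e2 = sin (u ord0 1) * sin (u ord0 0).
  by rewrite /dir !dotDl !dotZl Ne2 e22 e1e2; ring.
have dirdir u : dot (dir u) (dir u) = 1.
  rewrite {2}/dir !dotDr !dotZr dirN dire1 dire2.
  transitivity (cos (u ord0 1) ^+ 2 + sin (u ord0 1) ^+ 2 * (cos (u ord0 0) ^+ 2 + sin (u ord0 0) ^+ 2)).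
    by ring.
  by rewrite cos2Dsin2 mulr1 cos2Dsin2.
have sphr u : dot (sph u - y0) (sph u - y0) = r ^+ 2.
  by rewrite sphE dotZl dotZr dirdir; ring.
have sph_right u t : 0 <= t -> sph u = f t -> cos (u ord0 1) = 1.
  move=> t0 e; have := sphr u; rewrite {1 2}e => /(f_right t0).
  rewrite -e /sph => /addrI; rewrite PN => /(congr1 (fun v : V => r^-1 *: v)).
  by rewrite !scalerA mulVf// !scale1r => e'; rewrite -dirN e' NN.
have sph_left u t : t <= 0 -> sph u = f t -> cos (u ord0 1) = cq.
  move=> t0 e; have := sphr u; rewrite {1 2}e => /(f_left t0).
  rewrite -e /sph => /addrI => /(congr1 (fun v : V => r^-1 *: v)).
  by rewrite !scalerA mulVf// !scale1r => e'; rewrite -dirN e' cqE.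
pose mu phi := sph (vec3 phi psi 0).
have cmu : continuous mu.
  move=> p; exact: (cont_comp (cont_vec3 (cont_id p) (cont_cst psi p) (cont_cst 0 p)) (@csph _)).
have muL p : ~ L (mu p).
  move=> /fL[t e]; have [t0|/ltW t0] := leP 0 t.
  - by have := sph_right _ _ t0 (esym e); rewrite vec3E => c1; rewrite c1 ltxx in cpsi1.
  - by have := sph_left _ _ t0 (esym e); rewrite vec3E => c1; rewrite c1 ltxx in cpsiq.
have mup p : mu (p + pi *+ 2) = mu p.
  by rewrite /mu /sph /dir !vec3E cosD2pi sinD2pi.
have [c [n [cc Fc n0 cper]]] := loop_lift_periodic cmu muL mup.
pose Phi : R := pi *+ 2 *+ n.
have Phi0 : 0 < Phi by rewrite /Phi pmulrn_lgt0// pmulrn_lgt0// pi_gt0.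
(* The lifted loop shrinks to 0 along straight segments; the image of this contraction under [F]
   avoids [L]. *)
pose k (u : V) := F (u ord0 1 *: c (u ord0 0)).
have ck : continuous k.
  move=> u; have c1 := cont_comp (cont_proj (0 : 'I_3) u) (@cc _).
  exact: (cont_comp (cont_scalev (cont_proj (1 : 'I_3) u) c1) (@cF _)).
have crect (g : V -> V) (a b : R) : continuous g ->
    compact [set x | exists phi t, [/\ 0 <= phi <= Phi, a <= t <= b & x = g (vec3 phi t 0)]].
  move=> cg; pose G (z : R * R) := g (vec3 z.1 z.2 0).
  have -> : [set x | exists phi t, [/\ 0 <= phi <= Phi, a <= t <= b & x = g (vec3 phi t 0)]] =
      G @` (`[0, Phi]%classic `*` `[a, b]%classic).
    apply/seteqP; split => x /=.
      by move=> [phi [t [h1 h2 ->]]]; exists (phi, t); rewrite //= !in_itv.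
    by move=> [[phi t] /=]; rewrite !in_itv /= => -[h1 h2] <-; exists phi, t.
  apply: continuous_compact; last by apply: compact_setX; exact: segment_compact.
  apply: continuous_subspaceT => z.
  have c1 : {for z, continuous (fun z : R * R => z.1)} by exact: cvg_fst.
  have c2 : {for z, continuous (fun z : R * R => z.2)} by exact: cvg_snd.
  exact: (cont_comp (cont_vec3 c1 c2 (cont_cst 0 z)) (@cg _)).
pose rect (g : V -> V) (a b : R) : set V :=
  [set x | exists phi t, [/\ 0 <= phi <= Phi, a <= t <= b & x = g (vec3 phi t 0)]].
have farT (h : R -> V) : (forall M, exists T, forall t, T <= `|t| -> M < `|h t|) ->
    forall M, exists2 t, 0 <= t & forall x, `|x| <= M -> dot x (h t) < dot (h t) (h t).
  move=> fh M; have [T TP] := fh (2 * M); exists `|T| => // x xM.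
  by apply: (dot_lt_far xM); apply: TP; rewrite normr_id ler_norm.
have cK1 : compact (rect k 0 1 `|` rect sph psi pi) by apply: compactU; exact: crect.
(* The half line of parameters [t >= 0] meets the sphere only at [P], so [wp] lives on the cap
   beyond [psi] as well as on the contraction. Symmetrically [wq], from the other half line, lives
   on the cap about [N]. *)
have [wp wpP] : exists w, perp_field (rect k 0 1 `|` rect sph psi pi) y0 w.
  apply: (perp_field_transport cK1 cf); last exact: farT.
  move=> x t [] [phi [s [hphi hs ->]]] t0 e.
  - by apply: (@FL (s *: c phi)); have := Lf t; rewrite -e /k !vec3E.
  - have := sph_right _ _ t0 e; rewrite vec3E => c1.
    have /andP[s1 s2] := hs.
    have : cos s <= cos psi by apply: cos_le.
    by rewrite c1 leNgt cpsi1.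
have cK2 : compact (rect k 0 1 `|` rect sph 0 psi) by apply: compactU; exact: crect.
have [wq wqP] : exists w, perp_field (rect k 0 1 `|` rect sph 0 psi) y0 w.
  pose f' t := f (- t).
  have cf' : continuous f' by move=> t; exact: (cont_comp (cont_opp (cont_id t)) (@cf _)).
  have -> : y0 = f' 0 by rewrite /f' oppr0.
  apply: (perp_field_transport cK2 cf'); last first.
    apply: farT => M; have [T TP] := far M; exists T => t hT.
    by apply: TP; rewrite normrN.
  move=> x t [] [phi [s [hphi hs ->]]] t0 e.
  - by apply: (@FL (s *: c phi)); have := Lf (- t); rewrite -/(f' t) -e /k !vec3E.
  - have t0' : - t <= 0 by rewrite oppr_le0.
    have := sph_left _ _ t0' e; rewrite vec3E => c1.
    have /andP[s1 s2] := hs.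
    have : cos psi <= cos s by apply: cos_le.
    by rewrite c1 leNgt cpsiq.
pose uu (x : V) : V := r^-1 *: (x - y0).
have cuu x : {for x, continuous uu}.
  exact: (cont_scalev (cont_cst r^-1 x) (cont_addv (cont_id x) (cont_cst (- y0) x))).
have uusph u : uu (sph u) = dir u by rewrite /uu sphE scalerA mulVf// scale1r.
pose hq (x : V) : V := (1 - dot (uu x) N) *: e1 + (- dot (uu x) e1) *: (uu x - N).
pose hp (x : V) : V := (1 + dot (uu x) N) *: e1 + (- dot (uu x) e1) *: (uu x + N).
have chq x : {for x, continuous hq}.
  have c1 := cont_dot (cuu x) (cont_cst N x); have c2 := cont_dot (cuu x) (cont_cst e1 x).
  exact: (cont_addv (cont_scalev (cont_add (cont_cst (1 : R) x) (cont_opp c1)) (cont_cst e1 x))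
    (cont_scalev (cont_opp c2) (cont_addv (cuu x) (cont_cst (- N) x)))).
have chp x : {for x, continuous hp}.
  have c1 := cont_dot (cuu x) (cont_cst N x); have c2 := cont_dot (cuu x) (cont_cst e1 x).
  exact: (cont_addv (cont_scalev (cont_add (cont_cst (1 : R) x) c1) (cont_cst e1 x))
    (cont_scalev (cont_opp c2) (cont_addv (cuu x) (cont_cst N x)))).
have fields u : [/\ dot (hq (sph u)) (hq (sph u)) = (1 - cos (u ord0 1)) ^+ 2,
    dot (hp (sph u)) (hp (sph u)) = (1 + cos (u ord0 1)) ^+ 2,
    dot (dir u) (hq (sph u)) = 0 /\ dot (dir u) (hp (sph u)) = 0,
    dot (hq (sph u)) (hp (sph u)) =
      sin (u ord0 1) ^+ 2 * (sin (u ord0 0) ^+ 2 - cos (u ord0 0) ^+ 2) &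
    triple (dir u) (hq (sph u)) (hp (sph u)) =
      sin (u ord0 1) ^+ 2 * (2 * sin (u ord0 0) * cos (u ord0 0))].
  have := stereographic_fields (dirdir u) NN e11 Ne1.
  rewrite -/e2 -(uusph u) -/(hq (sph u)) -/(hp (sph u)) uusph dirN dire1 dire2.
  move=> [-> -> h -> ->]; split => //; last by ring.
  have sE : sin (u ord0 1) ^+ 2 = 1 - cos (u ord0 1) ^+ 2.
    by rewrite -(cos2Dsin2 (u ord0 1)); ring.
  have sE0 : sin (u ord0 0) ^+ 2 = 1 - cos (u ord0 0) ^+ 2.
    by rewrite -(cos2Dsin2 (u ord0 0)); ring.
  by rewrite exprMn sE sE0; ring.
have hqq u : dot (hq (sph u)) (hq (sph u)) = (1 - cos (u ord0 1)) ^+ 2 by have [] := fields u.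
have hpp u : dot (hp (sph u)) (hp (sph u)) = (1 + cos (u ord0 1)) ^+ 2 by have [] := fields u.
have uhq u : dot (dir u) (hq (sph u)) = 0 by have [_ _ []] := fields u.
have uhp u : dot (dir u) (hp (sph u)) = 0 by have [_ _ []] := fields u.
have sphy u : sph u <> y0.
  move=> e; have := sphr u; rewrite e subrr dot0l => /esym/eqP.
  by rewrite sqrf_eq0 (negbTE rn).
have ky u : k u <> y0 by move=> e; apply: (FL (x := u ord0 1 *: c (u ord0 0))); rewrite -/(k u) e; exact: Lf.
have i01 : 0 <= (0 : R) <= 1 by rewrite lexx /= ler01.
have i01' : 0 <= (1 : R) <= 1 by rewrite lexx ler01.
(* Three relative angles that return along the loop: from [wp] to [wq] by the contraction [k], from
   [wp] to [hq] by shrinking to the pole [- N], and from [hp] to [wq] by shrinking to the pole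
   [N]. *)
have [A1 [q1 [cA1 A10 q10 A1E]]] : exists A rho : R -> R, [/\ continuous A, A Phi = A 0,
    forall phi, 0 < rho phi & forall phi, 0 <= phi <= Phi -> let x := k (vec3 phi 1 0) in
      dot (wp x) (wq x) = rho phi * cos (A phi) /\
      triple (r^-1 *: (x - y0)) (wp x) (wq x) = rho phi * sin (A phi)].
  apply: (@field_angle y0 r Phi 0 1 0 1 k wp wq r0 (ltW Phi0) i01 i01' ck).
  - move=> phi t hphi ht x.
    have [c1 c2 c3] : [/\ {for x, continuous wp}, wp x <> 0 & dot (wp x) (x - y0) = 0].
      by apply: wpP; left; exists phi, t.
    have [d1 d2 d3] : [/\ {for x, continuous wq}, wq x <> 0 & dot (wq x) (x - y0) = 0].
      by apply: wqP; left; exists phi, t.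
    rewrite !(dotC (x - y0)); exact: (And4 (conj c1 d1) (conj c2 d2) (@ky _) (conj c3 d3)).
  - by move=> t _; rewrite /k !vec3E /Phi cper.
  - by move=> phi _; rewrite /k !vec3E !scale0r.
have ipsi : psi <= psi <= pi by apply/andP; split.
have ipi : psi <= (pi : R) <= pi by apply/andP; split.
have sphPhi t : sph (vec3 Phi t 0) = sph (vec3 0 t 0).
  by rewrite /sph /dir !vec3E -[Phi]add0r (periodicn (@cosD2pi R)) (periodicn (@sinD2pi R)).
have [A2 [q2 [cA2 A20 q20 A2E]]] : exists A rho : R -> R, [/\ continuous A, A Phi = A 0,
    forall phi, 0 < rho phi & forall phi, 0 <= phi <= Phi -> let x := sph (vec3 phi psi 0) in
      dot (wp x) (hq x) = rho phi * cos (A phi) /\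
      triple (r^-1 *: (x - y0)) (wp x) (hq x) = rho phi * sin (A phi)].
  apply: (@field_angle y0 r Phi psi pi pi psi sph wp hq r0 (ltW Phi0) ipi ipsi csph _ (fun t _ => sphPhi t)).
  - move=> phi t hphi ht x.
    have [c1 c2 c3] : [/\ {for x, continuous wp}, wp x <> 0 & dot (wp x) (x - y0) = 0].
      by apply: wpP; right; exists phi, t.
    split.
    + exact: (conj c1 (chq x)).
    + apply: (conj c2) => e; have := hqq (vec3 phi t 0); rewrite -/x e dot0l vec3E => /esym/eqP.
      rewrite sqrf_eq0 subr_eq0 => /eqP c4; have /andP[s1 s2] := ht.
      have : cos t <= cos psi by apply: cos_le.
      by rewrite -c4 leNgt cpsi1.
    + exact: sphy.
    + have e : dot (x - y0) (hq x) = 0 by rewrite /x sphE dotZl uhq mulr0.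
      by rewrite dotC c3.
  - by move=> phi _; rewrite /sph /dir !vec3E sinpi !mul0r !scale0r.
have i0psi : 0 <= (0 : R) <= psi by apply/andP; split.
have ipsi' : 0 <= psi <= psi by apply/andP; split.
have [A3 [q3 [cA3 A30 q30 A3E]]] : exists A rho : R -> R, [/\ continuous A, A Phi = A 0,
    forall phi, 0 < rho phi & forall phi, 0 <= phi <= Phi -> let x := sph (vec3 phi psi 0) in
      dot (hp x) (wq x) = rho phi * cos (A phi) /\
      triple (r^-1 *: (x - y0)) (hp x) (wq x) = rho phi * sin (A phi)].
  apply: (@field_angle y0 r Phi 0 psi 0 psi sph hp wq r0 (ltW Phi0) i0psi ipsi' csph _ (fun t _ => sphPhi t)).
  - move=> phi t hphi ht x.
    have [c1 c2 c3] : [/\ {for x, continuous wq}, wq x <> 0 & dot (wq x) (x - y0) = 0].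
      by apply: wqP; right; exists phi, t.
    split.
    + exact: (conj (chp x) c1).
    + apply: (conj _ c2) => e; have := hpp (vec3 phi t 0); rewrite -/x e dot0l vec3E => /esym/eqP.
      rewrite sqrf_eq0 => /eqP c4; have /andP[s1 s2] := ht.
      have h : cos psi <= cos t by apply: cos_le.
      have : 0 < 1 + cos t by rewrite ltr_pwDl// (le_trans cpsi0 h).
      by rewrite c4 ltxx.
    + exact: sphy.
    + have e : dot (x - y0) (hp x) = 0 by rewrite /x sphE dotZl uhp mulr0.
      by rewrite (dotC _ (wq x)) c3.
  - by move=> phi _; rewrite /sph /dir !vec3E sin0 !mul0r !scale0r.
pose cl (x : R) := Num.max 0 (Num.min Phi x).
have clI x : 0 <= cl x <= Phi by rewrite /cl le_max lexx /= ge_max (ltW Phi0) /= ge_min lexx.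
have clE x : 0 <= x <= Phi -> cl x = x by move=> /andP[lx xh]; rewrite /cl min_r// max_r.
have ccl x : {for x, continuous cl}.
  by apply: (continuous_max (f := fun=> 0)); [exact: cvg_cst|
    apply: (continuous_min (f := fun=> Phi)); [exact: cvg_cst|exact: cvg_id]].
(* The angle from [hq] to [hp] is [pi - 2 * phi]. Composing angles, [A1] is [A2 + A3 + pi - 2 * phi]
   modulo full turns, so [B] is [pi] modulo full turns. *)
pose B phi := A1 phi - (A2 phi + A3 phi - (phi + phi)).
have BE phi : 0 <= phi <= Phi -> cos (B phi) = -1 /\ sin (B phi) = 0.
  move=> hphi; pose x := sph (vec3 phi psi 0); pose d := dir (vec3 phi psi 0).
  have kx : k (vec3 phi 1 0) = x by rewrite /k !vec3E scale1r Fc.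
  have ux : r^-1 *: (x - y0) = d by rewrite -/(uu x) uusph.
  have [h1 h1'] := A1E phi hphi; rewrite kx ux in h1 h1'.
  have [h2 h2'] := A2E phi hphi; rewrite /= -/x ux in h2 h2'.
  have [h3 h3'] := A3E phi hphi; rewrite /= -/x ux in h3 h3'.
  have h4 : dot (hq x) (hp x) = sin psi ^+ 2 * - cos (phi + phi).
    by have [_ _ _ -> _] := fields (vec3 phi psi 0); rewrite !vec3E cosD; ring.
  have h4' : triple d (hq x) (hp x) = sin psi ^+ 2 * sin (phi + phi).
    by have [_ _ _ _ ->] := fields (vec3 phi psi 0); rewrite !vec3E sinD; ring.
  have dd : dot d d = 1 by exact: dirdir.
  have dwp : dot d (wp x) = 0.
    have [_ _ c3] : [/\ {for x, continuous wp}, wp x <> 0 & dot (wp x) (x - y0) = 0].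
      by apply: wpP; right; exists phi, psi.
    by rewrite -ux dotZl dotC c3 mulr0.
  have dwq : dot d (wq x) = 0.
    have [_ _ c3] : [/\ {for x, continuous wq}, wq x <> 0 & dot (wq x) (x - y0) = 0].
      by apply: wqP; right; exists phi, psi.
    by rewrite -ux dotZl dotC c3 mulr0.
  have dhq : dot d (hq x) = 0 by exact: uhq.
  have dhp : dot d (hp x) = 0 by exact: uhp.
  have r1 := triple_re dd dwp dhq dhp; have i1 := triple_im (wp x) (hp x) dhq.
  have r2 := triple_re dd dwp dhp dwq; have i2 := triple_im (wp x) (wq x) dhp.
  have mq : 0 < dot (hq x) (hq x).
    by rewrite hqq vec3E; apply: exprn_gt0; rewrite subr_gt0.
  have mp : 0 < dot (hp x) (hp x).
    by rewrite hpp vec3E; apply: exprn_gt0; exact: ltr_pwDl ltr01 cpsi0.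
  pose Pa := A2 phi + A3 phi - (phi + phi).
  have [a1 a1'] := angle_addition h2 h2' h3 h3'.
  pose kap := q2 phi * q3 phi * sin psi ^+ 2.
  pose m := dot (hq x) (hq x) * dot (hp x) (hp x) * q1 phi.
  have kap0 : 0 < kap by exact: mulr_gt0 (mulr_gt0 (q20 phi) (q30 phi)) spsi.
  have m0 : 0 < m by exact: mulr_gt0 (mulr_gt0 mq mp) (q10 phi).
  have E1 : m * cos (A1 phi) = - (kap * cos Pa).
    rewrite /m -mulrA -h1 -mulrA r2 mulrBr !mulrA r1 i1 h4 h4' /kap /Pa cosB.
    transitivity (- (sin psi ^+ 2 * (cos (phi + phi) * (dot (wp x) (hq x) * dot (hp x) (wq x) -
      triple d (wp x) (hq x) * triple d (hp x) (wq x)) + sin (phi + phi) *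
      (dot (wp x) (hq x) * triple d (hp x) (wq x) + triple d (wp x) (hq x) * dot (hp x) (wq x))))).
      by ring.
    by rewrite a1 a1'; ring.
  have E2 : m * sin (A1 phi) = - (kap * sin Pa).
    rewrite /m -mulrA -h1' -mulrA i2 mulrDr !mulrA r1 i1 h4 h4' /kap /Pa sinB.
    transitivity (- (sin psi ^+ 2 * (cos (phi + phi) * (dot (wp x) (hq x) * triple d (hp x) (wq x) +
      triple d (wp x) (hq x) * dot (hp x) (wq x)) - sin (phi + phi) *
      (dot (wp x) (hq x) * dot (hp x) (wq x) - triple d (wp x) (hq x) * triple d (hp x) (wq x))))).
      by ring.
    by rewrite a1 a1'; ring.
  have km : kap = m.
    apply/eqP; rewrite -(@eqrXn2 _ 2)// ?ltW//; apply/eqP.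
    transitivity ((- (kap * cos Pa)) ^+ 2 + (- (kap * sin Pa)) ^+ 2).
      by rewrite !sqrrN !exprMn -mulrDr cos2Dsin2 mulr1.
    by rewrite -E1 -E2 !exprMn -mulrDr cos2Dsin2 mulr1.
  have mn : m != 0 by rewrite gt_eqF.
  have C1 : cos (A1 phi) = - cos Pa by apply: (mulfI mn); rewrite E1 km; ring.
  have S1 : sin (A1 phi) = - sin Pa by apply: (mulfI mn); rewrite E2 km; ring.
  rewrite /B -/Pa cosB sinB C1 S1; split; last by ring.
  by rewrite -[in RHS](cos2Dsin2 Pa); ring.
have cB t : {for t, continuous B}.
  exact: (cont_add (cA1 t) (cont_opp (cont_add (cont_add (cA2 t) (cA3 t))
    (cont_opp (cont_add (cont_id t) (cont_id t)))))).
(* As an angle coordinate of [polar], [B] is constant by uniqueness of lifts. But [A1], [A2] and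
   [A3] return after [Phi], whereas [phi + phi] grows by [2 * Phi]. *)
pose b1 t : V := vec3 (B (cl t)) 0 0.
have cb1 t : {for t, continuous b1}.
  exact: (cont_vec3 (cont_comp (ccl t) (cB _)) (cont_cst 0 t) (cont_cst 0 t)).
have pb1 t : polar (b1 t) = polar (b1 0).
  have [h1 h2] := BE _ (clI t); have [h3 h4] := BE _ (clI 0).
  by apply: row3P; rewrite /polar !vec3E ?h1 ?h2 ?h3 ?h4.
have cR : connected [set: R] by apply: (@is_convex_connected R R^o).
have nb1 (z : R) : \forall w \near z, polar (b1 w) = polar (b1 0).
  exact: (@filterE _ (nbhs z) (nbhs_filter z)).
have := lift_unique (@hausdorff_row R) (@polar_locally_injective R) cR (fun z _ => cb1 z)
  (fun z _ => cont_cst (b1 0) z) (fun z _ => nb1 z) (I : setT 0) erefl (I : setT Phi).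
move=> /(congr1 (fun v : V => v ord0 0)); rewrite /b1 !vec3E.
rewrite clE; last by rewrite (ltW Phi0) lexx.
rewrite clE; last by rewrite (ltW Phi0) lexx.
by rewrite /B A10 A20 A30; lra.
Qed.

End Unbranched.

(** * Conclusion *)

Section Charts.
Variable R : realType.

(** The logistic function and its inverse. *)
Lemma chart_interval (r : R) : 0 < r -> exists rho lam : R -> R, [/\ continuous rho,
  forall t, 0 < rho t < r, forall s, 0 < s < r -> {for s, continuous lam} &
  forall s, 0 < s < r -> rho (lam s) = s].
Proof.
move=> r0; exists (fun t => r * (expR t * (1 + expR t)^-1)), (fun s => ln (s * (r + - s)^-1)).
have pos (t : R) : 0 < 1 + expR t by rewrite addr_gt0 ?expR_gt0.
split=> [t|t|s /andP[s0 sr]|s /andP[s0 sr]].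
- apply: (cont_mul (cont_cst r t)); apply: (cont_mul (@continuous_expR R t)).
  apply: cont_inv; last by rewrite gt_eqF.
  exact: (cont_add (cont_cst (1 : R) t) (@continuous_expR R t)).
- rewrite mulr_gt0 ?mulr_gt0 ?expR_gt0 ?invr_gt0//= -[ltRHS]mulr1 ltr_pM2l//.
  by rewrite ltr_pdivrMr// mul1r ltrDr.
- have d0 : 0 < r + - s by rewrite subr_gt0.
  apply: (cont_comp (g := @ln R)); last by apply: continuous_ln; rewrite mulr_gt0 ?invr_gt0.
  apply: (cont_mul (cont_id s)); apply: cont_inv; last by rewrite gt_eqF.
  exact: (cont_add (cont_cst r s) (cont_opp (cont_id s))).
- have d0 : 0 < r + - s by rewrite subr_gt0.
  rewrite lnK ?posrE ?mulr_gt0 ?invr_gt0//; field; apply/andP; split; apply/eqP; lra.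
Qed.

Lemma chart_halfline (r : R) : exists rho lam : R -> R, [/\ continuous rho,
  forall t, r < rho t, forall s, r < s -> {for s, continuous lam} &
  forall s, r < s -> rho (lam s) = s].
Proof.
exists (fun t => r + expR t), (fun s => ln (s + - r)); split=> [t|t|s rs|s rs].
- exact: (cont_add (cont_cst r t) (@continuous_expR R t)).
- by rewrite ltrDl expR_gt0.
- apply: (cont_comp (g := @ln R)); last by apply: continuous_ln; rewrite subr_gt0.
  exact: (cont_add (cont_id s) (cont_cst (- r) s)).
- by rewrite lnK ?posrE ?subr_gt0// addrC subrK.
Qed.

End Charts.

Section Diffeo.
Variables (R : realType) (F : 'rV[R]_3 -> 'rV[R]_3).
Hypothesis dF : local_diffeo F.

Lemma local_diffeo_continuous : continuous F.
Proof.
move=> x; have [U [W [G [[_ Ux _ _] [_ _ dU _]]]]] := dF x.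
exact: differentiable_continuous (dU x Ux).
Qed.

Lemma local_diffeo_invertible : locally_invertible F.
Proof.
move=> x; have [U [W [G [[oU Ux oW FU] [GF FG _ dG]]]]] := dF x.
have Wx : W (F x) by rewrite -FU; exists x.
have /nbhs_ballP[d d0 dW] : nbhs (F x) W by apply: open_nbhs_nbhs.
exists d => //; exists G; split; last exact: GF.
move=> w /dW Ww; split; last by have [] := FG w Ww.
exact: differentiable_continuous (dG w Ww).
Qed.

Lemma local_diffeo_injective : locally_injective F.
Proof.
move=> x; have [U [W [G [[oU Ux _ _] [GF _ _ _]]]]] := dF x.
exists U; first by apply: open_nbhs_nbhs.
by move=> u v /set_mem Uu /set_mem Uv e; rewrite -(GF u Uu) e GF.
Qed.

End Diffeo.

Theorem theorem2 (R : realType) (F : 'rV[R]_3 -> 'rV[R]_3) :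
  polynomial_map3 F -> local_diffeo F -> ~ is_line (nonproper_set F).
Proof.
move=> pF dF [clS [f [g [cf fS gf cg]]]].
have cF := local_diffeo_continuous dF; have invF := local_diffeo_invertible dF.
have injF := local_diffeo_injective dF.
set S := nonproper_set F in clS fS cg.
have Sf t : S (f t) by rewrite -fS; exists t.
have fg y : S y -> f (g y) = y by rewrite -fS => -[t _ <-]; rewrite gf.
have [D lines] := polynomial_map_on_lines pF.
have curves y : S y -> exists phi : 'I_3 -> {poly R}, [/\ forall i, (size (phi i) <= D.+1)%N,
    exists i, (1 < size (phi i))%N, curve phi 0 = y & forall t, S (curve phi t)].
  exact: curve_through.
have ext := extrema_finite cf Sf fg gf cg curves.
have axis := axis_finite cf Sf fg gf cg curves.
have shellL y : S y -> exists2 d : R, 0 < d & exists p q : R -> 'rV[R]_3,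
    forall r, 0 < r -> r <= d -> shell S y [set s | 0 < s < r] p q.
  move=> Sy; have [d d0 [th1 [th2 [e st]]]] := local_strands cf Sf gf cg ext axis (g y).
  rewrite fg// in st; exists d => //.
  exists (fun s => f (th1 s) - y), (fun s => f (th2 s) - y) => r r0 rd.
  apply: (shell_of_strands cf Sf fg gf) => //.
  - by rewrite (_ : mkset _ = `]0, r[%classic)//; apply: funext => s; rewrite /= in_itv.
  - by move=> s /= /andP[].
  - exact: chart_interval.
  - by apply: strands_sub st => s /= /andP[-> sr]; exact: lt_le_trans rd.
have [R0 R00 [th1 [th2 [e st]]]] := infinite_strands cf clS Sf gf cg ext axis 0.
have shell_oo : exists p q, shell S 0 [set s | R0 < s] p q.
  exists (fun s => f (th1 s) - 0), (fun s => f (th2 s) - 0).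
  apply: (shell_of_strands cf Sf fg gf _ _ _ st).
  - exact: open_gt.
  - by move=> s /=; exact: lt_trans.
  - exact: chart_halfline.
have LP := nonproper_setP F.
have cR : connected [set: R] by apply: (@is_convex_connected R R^o).
have [meets|disj] := pselect (exists x, S (F x)).
  have cS : connected S by rewrite -fS; apply: connected_continuous_connected => //; exact: continuous_subspaceT.
  exact: (branched_case cF invF injF clS cS LP shellL R00 shell_oo meets).
have cSc : connected (~` S).
  by rewrite -setTD; apply: (compl_connected shellL openT); exact: (@is_convex_connected R 'rV[R]_3).
have FS x : ~ S (F x) by move=> h; apply: disj; exists x.
have fL y : S y -> exists t, f t = y by move=> Sy; exists (g y); exact: fg.
have [d d0 [u1 [u2 [e' st']]]] := local_strands cf Sf gf cg ext axis 0.
(* Strands are parametrised by squared radii; [r < 1] gives [r ^+ 2 < r < d]. *)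
pose r := Num.min d 1 / 2.
have r0 : 0 < r by rewrite divr_gt0// lt_min d0 ltr01.
have Ir : 0 < r ^+ 2 < d.
  rewrite exprn_gt0//=.
  have r1 : r < 1 by rewrite /r ltr_pdivrMr// mul1r gt_min orbC ltr1n.
  have rd : r < d by rewrite /r ltr_pdivrMr// gt_min mulr_natr mulr2n ltrDl d0.
  by apply: lt_trans rd; rewrite expr2 -[ltRHS]mulr1 ltr_pM2l.
have [a1 a2 _ a3 _] := strands_right st' Ir; have [b1 b2 _ b3 _] := strands_left st' Ir.
apply: (unbranched_case cF invF injF cSc LP FS cf Sf fL (f_far clS Sf gf cg) r0 a2 b2).
- by move=> /addIr/(f_inj gf) h; move: a1 b1; rewrite h => h1 h2; have := lt_trans h1 h2; rewrite ltxx.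
- move=> t t0 h; rewrite addrC subrK; congr f; apply: a3 => //.
  rewrite lt_neqAle t0 andbT; apply/eqP => e0.
  by apply: (strands_center st' (t := t)); rewrite /= /sqdist ?h.
- move=> t t0 h; rewrite addrC subrK; congr f; apply: b3 => //.
  rewrite lt_neqAle t0 andbT; apply/eqP => e0.
  by apply: (strands_center st' (t := t)); rewrite /= /sqdist ?h.
Qed.
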